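(* Let $B\subset\mathbb{R}^2$ be the unit disk and let $k\ge 1$ be an integer such that $\mu_{k-1}(B)=\mu_k(B)$. Then $B$ is not a local minimizer for the problem $$\inf\{D(\Omega)^2\mu_{k-1}(\Omega) : \Omega\subset\mathbb{R}^2 \text{ nonempty, bounded, open and convex}\}.$$
   Context: For a nonempty bounded open convex set $\Omega\subset\mathbb{R}^2$, $D(\Omega)$ denotes its diameter, and $0=\mu_0(\Omega)<\mu_1(\Omega)\le\mu_2(\Omega)\le\cdots$ denote the eigenvalues, counted with multiplicity, of the Neumann Laplacian on $\Omega$: $\mu$ is an eigenvalue if there is $0\ne u\in H^1(\Omega)$ with $\int_\Omega\nabla u\cdot\nabla\varphi=\mu\int_\Omega u\varphi$ for all $\varphi\in H^1(\Omega)$. A set $\Omega_0$ is a local minimizer of a functional $F$ on the class of nonempty bounded open convex sets if there is $\delta>0$ such that $F(\Omega)\ge F(\Omega_0)$ for every $\Omega$ in the class whose closure is at Hausdorff distance less than $\delta$ from the closure of $\Omega_0$. *)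

(* Defs.v *)
From HB Require Import structures.
From mathcomp Require Import all_boot all_order all_algebra.
From mathcomp Require Import all_classical all_reals all_analysis.

Set Implicit Arguments.
Unset Strict Implicit.
Unset Printing Implicit Defensive.

Import Order.TTheory GRing.Theory Num.Theory.
Import numFieldNormedType.Exports.

Local Open Scope classical_set_scope.
Local Open Scope ring_scope.

(* The plane is R * R. The library norm of R * R is the sup norm; it is used   *)
(* only through its topology and its bounded sets. All metric notions below    *)
(* (disk, diameter, Hausdorff distance) are taken for the Euclidean distance.  *)
Notation leb2 R := (@lebesgue_measure R \x @lebesgue_measure R)%E.

Section Geometry.
Variable R : realType.
Implicit Types (p q : R * R) (A B Omega : set (R * R)).

Definition eucl_dist p q : R :=
  Num.sqrt ((p.1 - q.1) ^+ 2 + (p.2 - q.2) ^+ 2).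

Definition unit_disk : set (R * R) := [set p | p.1 ^+ 2 + p.2 ^+ 2 < 1].

Definition diameter A : R :=
  sup [set d | exists p q, [/\ A p, A q & d = eucl_dist p q]].

Definition dist_to_set A p : R := inf [set eucl_dist p q | q in A].

Definition hausdorff_dist A B : R :=
  Num.max (sup [set dist_to_set B p | p in A])
          (sup [set dist_to_set A q | q in B]).

Definition convex_domain : set (set (R * R)) :=
  [set Omega | [/\ Omega !=set0, bounded_set Omega, open Omega
                 & @convex_set R (R * R)%type Omega]].

Definition local_minimizer (C : set (set (R * R))) (F : set (R * R) -> R)
    (Omega0 : set (R * R)) : Prop :=
  exists2 delta : R, 0 < delta &
    forall Omega, C Omega ->
      hausdorff_dist (closure Omega) (closure Omega0) < delta ->
      F Omega0 <= F Omega.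

End Geometry.

Section Sobolev.
Variable R : realType.
Implicit Types (Omega : set (R * R)) (u v phi : R * R -> R).
Implicit Types (g h : 'I_2 -> R * R -> R).

Definition basis_vec (i : 'I_2) : R * R := if i == 0 then (1, 0) else (0, 1).

Definition pderiv (i : 'I_2) phi : R * R -> R :=
  fun p => 'D_(basis_vec i) phi p.

Definition iter_pderiv (s : seq 'I_2) phi : R * R -> R := foldr pderiv phi s.

Definition smooth phi : Prop :=
  forall s : seq 'I_2, continuous (iter_pderiv s phi) /\
    forall (i : 'I_2) p, derivable (iter_pderiv s phi) p (basis_vec i).

Definition support_of phi : set (R * R) := closure [set p | phi p != 0].

Definition test_function Omega phi : Prop :=
  [/\ smooth phi, compact (support_of phi) & support_of phi `<=` Omega].

(* Functions on Omega are represented by functions on the plane, of which only *)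
(* the values on Omega matter; elements of L^2(Omega) and H^1(Omega) are       *)
(* compared almost everywhere on Omega.                                        *)
Definition ae_zero Omega u : Prop := {ae leb2 R, forall p, Omega p -> u p = 0}.

Definition in_L2 Omega u : Prop :=
  measurable_fun (Omega : set (measurableTypeR R * measurableTypeR R)) u /\
  (leb2 R).-integrable Omega (fun p => (u p ^+ 2)%:E).

Definition weak_gradient Omega u g : Prop :=
  forall (i : 'I_2) phi, test_function Omega phi ->
    \int[leb2 R]_(p in Omega) (u p * pderiv i phi p) =
    - \int[leb2 R]_(p in Omega) (g i p * phi p).

(* u \in H^1(Omega), with (a representative of) its weak gradient g *)
Definition in_H1 Omega u g : Prop :=
  [/\ in_L2 Omega u, forall i, in_L2 Omega (g i) & weak_gradient Omega u g].

(* the eigenspace of lambda, which contains 0 *)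
Definition neumann_eigenspace Omega (lambda : R) : set (R * R -> R) :=
  [set u | exists2 g, in_H1 Omega u g &
    forall phi h, in_H1 Omega phi h ->
      \int[leb2 R]_(p in Omega) (\sum_(i < 2) g i p * h i p) =
      lambda * \int[leb2 R]_(p in Omega) (u p * phi p)].

Definition ae_independent Omega (n : nat) (u : 'I_n -> R * R -> R) : Prop :=
  forall c : 'I_n -> R, ae_zero Omega (fun p => \sum_(i < n) c i * u i p) ->
    forall i, c i = 0.

(* n <= dim (eigenspace of lambda); for n = 1: lambda is an eigenvalue *)
Definition multiplicity_ge Omega (lambda : R) (n : nat) : Prop :=
  exists u : 'I_n -> R * R -> R,
    (forall i, neumann_eigenspace Omega lambda (u i)) /\ ae_independent Omega u.

(* n <= #{k | mu k = lambda} *)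
Definition occurs_ge (mu : nat -> R) (lambda : R) (n : nat) : Prop :=
  exists s : 'I_n -> nat, injective s /\ forall i, mu (s i) = lambda.

(* mu lists the eigenvalues in nondecreasing order, each of them repeated      *)
(* according to its multiplicity                                               *)
Definition neumann_spectrum Omega (mu : nat -> R) : Prop :=
  {homo mu : m n / (m <= n)%N >-> m <= n} /\
  forall lambda n, multiplicity_ge Omega lambda n <-> occurs_ge mu lambda n.

Lemma neumann_spectrum_unique Omega (mu nu : nat -> R) :
  neumann_spectrum Omega mu -> neumann_spectrum Omega nu -> mu = nu.
Proof.
suff main (a b : nat -> R) k : (forall j, (j < k)%N -> a j = b j) ->
    neumann_spectrum Omega a -> neumann_spectrum Omega b -> ~ (a k < b k).
  move=> hm hn; apply/funext; elim/ltn_ind => k IH; apply/eqP.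
  have := main _ _ _ IH hm hn; have := main _ _ k (fun j lj => esym (IH j lj)) hn hm.
  by move=> /negP; rewrite -leNgt => ab /negP; rewrite -leNgt => ba; rewrite eq_le ab ba.
move=> eq_ab [a_mono a_cnt] [b_mono b_cnt] lt_ab.
pose A := [set j : 'I_k.+1 | a j == a k]%SET.
have /a_cnt /b_cnt [s [s_inj s_val]] : occurs_ge a (a k) #|A|.
  exists (fun i => val (enum_val i)); split => [i j /val_inj /enum_val_inj //|i].
  by have := enum_valP i; rewrite inE => /eqP.
have s_lt i : (s i < k)%N.
  by rewrite ltnNge; apply/negP => /b_mono; rewrite s_val leNgt lt_ab.
pose t i : 'I_k.+1 := Ordinal (ltnW (s_lt i) : (s i < k.+1)%N).
have t_inj : injective t by move=> i j [] /s_inj.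
have : (#|[set t i | i : 'I_#|A|]%SET| <= #|A :\ ord_max|)%N.
  apply/subset_leq_card/fintype.subsetP => _ /imsetP[i _ ->]; rewrite !inE -val_eqE /=.
  by rewrite neq_ltn s_lt /= eq_ab // s_val.
rewrite card_imset // card_ord [X in (X <= _)%N](cardsD1 ord_max).
by rewrite inE eqxx add1n ltnn.
Qed.

(* mu_k(Omega); the default value 0 is for sets without such a list *)
Definition neumann_eigenvalue Omega : nat -> R :=
  xget (fun=> 0) (neumann_spectrum Omega).

End Sobolev.

Arguments unit_disk {R}.
Arguments convex_domain {R}.

(* Main.v *)
From HB Require Import structures.
From mathcomp Require Import all_boot all_order all_algebra.
From mathcomp Require Import all_classical all_reals all_analysis.
From mathcomp Require Import measurable_realfun.
From mathcomp Require Import ring lra.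
Require Import Defs.

(** The disc [B] is compared with the disc [Omega] from which a thin cap
    [C = B `&` {x > c}] has been cut off. Cutting does not increase the diameter,
    so it is enough that it strictly decreases [mu = mu_(k-1)] when this
    eigenvalue equals [mu_k] ([cut_decreases]).

    Let [v] be a combination of the first [k + 1] eigenfunctions of the disc; its
    energy is at most [mu] times its mass. There is one coefficient more than
    conditions if [v] is to have mean zero over [C] and to be orthogonal in
    [Omega] to the first [k - 1] eigenfunctions of [Omega]. On [C], which is convex
    and small, the Poincare inequality makes the energy of [v] much larger than
    [mu] times its mass there. What is left for [Omega] is a Rayleigh quotient at
    most [mu], with equality only if [v] is an eigenfunction for [mu] that
    vanishes on [C]. The min-max principle gives [mu_(k-1)(Omega) < mu] unless
    such an eigenfunction exists.

    That such eigenfunctions exist for all small caps is excluded without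
    regularity theory ([unique_continuation]). The space of those that vanish on
    the cap at height [c] grows with [c] and has bounded dimension, hence is
    constant for [c] close to 1. A slightly rotated eigenfunction of this space vanishes on a slightly smaller cap, hence belongs
    to this space again; so its elements vanish on an annulus along the boundary
    ([vanishing_annulus]). Extended by zero and dilated by [s < 1], such a function
    remains an eigenfunction of the disc, with eigenvalue [mu / s ^+ 2]; here
    [mu > 0] because it is not the lowest eigenvalue. An interval of eigenvalues
    contradicts their discreteness ([no_compact_eigvec]).

    The eigenvalues being defined by a choice among all lists that count
    multiplicities, the argument rests on the existence of such a list for
    every convex domain ([neumann_spectral_system]). It comes from an abstract
    spectral theorem for two quadratic forms ([spectral_theorem]), whose
    compactness hypothesis is the Friedrichs inequality: the Poincare inequality
    on the cells of a fine grid ([H1_friedrichs]). The facts on Sobolev functions all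
    go through one characterization: on a convex set, [g] is the weak gradient
    of [u] exactly when the increment of [u] along almost every segment is the
    mean of [g] along it ([segment_identity], [weak_gradient_of_segments]). It
    yields the Poincare inequality, the effect of similarities, extension by
    zero, and explicit elements of the Sobolev space. *)

Set Implicit Arguments.
Unset Strict Implicit.
Unset Printing Implicit Defensive.

Import Order.TTheory GRing.Theory Num.Theory.
Import numFieldNormedType.Exports.

Local Open Scope classical_set_scope.
Local Open Scope ring_scope.

(** * Spectral theory of a pair of quadratic forms *)
Section Linear.
Variable R : realType.

(** Fewer linear conditions than unknowns: the source of every test vector
    below that has to satisfy finitely many orthogonality relations. *)
Lemma nontrivial_kernel (n m : nat) (M : 'I_n -> 'I_m -> R) : (m < n)%N ->
  exists2 c : 'I_n -> R, (exists i, c i != 0) &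
    forall j, \sum_(i < n) c i * M i j = 0.
Proof.
move=> ltmn; pose A := \matrix_(i < n, j < m) M i j.
have nz : kermx A != 0.
  by rewrite kermx_eq0 /row_free neq_ltn (leq_ltn_trans (rank_leq_col A) ltmn).
have /matrix0Pn[i [j nzij]] := nz.
exists (fun i' => kermx A i i'); first by exists j.
move=> j'; have /matrixP/(_ i j') := mulmx_ker A; rewrite [LHS]mxE [RHS]mxE => kA.
rewrite -[RHS]kA; by apply: eq_bigr => i0 _; rewrite [A i0 j']mxE.
Qed.

Lemma increasing_seq_ge (f : nat -> nat) n : increasing_seq f -> (n <= f n)%N.
Proof.
move=> fi; elim: n => // n IH; apply: leq_ltn_trans IH _.
by rewrite ltnNge; have := fi n.+1 n; rewrite !leEnat => ->; rewrite ltnn.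
Qed.

Lemma increasing_seq_cvgy (f : nat -> nat) : increasing_seq f -> f @ \oo --> \oo.
Proof.
move=> fi A [N _ NA]; exists N => // n /= Nn; apply: NA => /=.
exact: leq_trans Nn (increasing_seq_ge _ fi).
Qed.

Lemma bolzano_weierstrass_family (n : nat) (z : 'I_n -> nat -> R) (K : R) :
  (forall j k, `|z j k| <= K) ->
  exists2 f : nat -> nat, increasing_seq f & forall j, cvgn (z j \o f).
Proof.
elim: n z => [|n IH] z zK.
  by exists id => [m k|[]//].
have [f fi fc] := IH (fun j => z (lift ord0 j)) (fun j => zK _).
have : bounded_fun (z ord0 \o f).
  exists K; split; first by rewrite num_real.
  by move=> M KM k _ /=; rewrite (le_trans (zK _ _)) ?ltW.
move=> /bolzano_weierstrass[g gi gc].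
exists (f \o g) => [p q /=|j]; first by rewrite fi; exact: gi.
have [j0 ->|->] := unliftP ord0 j; last exact: gc.
have := fc j0 => /cvg_ex[l hl]; apply/cvg_ex; exists l.
apply: (@cvg_comp _ _ _ g (z (lift ord0 j0) \o f) _ \oo) hl.
exact: increasing_seq_cvgy.
Qed.

Lemma cvg_sum_ord (n : nat) (u : 'I_n -> nat -> R) (l : 'I_n -> R) :
  (forall j, u j k @[k --> \oo] --> l j) ->
  (\sum_(j < n) u j k) @[k --> \oo] --> \sum_(j < n) l j.
Proof.
elim: n u l => [|n IH] u l h.
  by under eq_fun do rewrite big_ord0; rewrite big_ord0; exact: cvg_cst.
under eq_fun do rewrite big_ord_recl; rewrite big_ord_recl.
by apply: cvgD; [exact: h|apply: IH => j; exact: h].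
Qed.

Lemma linear_coef_eq0 (A B : R) : 0 <= A ->
  (forall t : R, 0 <= t * B + t ^+ 2 * A) -> B = 0.
Proof.
move=> A0 h; have A1 : 0 < A + 1 by rewrite ltr_wpDl.
have := h (- B / (A + 1)).
rewrite (_ : _ + _ = - (B ^+ 2 / (A + 1) ^+ 2)); last by field; lra.
rewrite oppr_ge0 pmulr_lle0 ?invr_gt0 ?exprn_gt0// => hB; apply/eqP.
by rewrite -sqrf_eq0 eq_le hB sqr_ge0.
Qed.

End Linear.

Definition psd_form (R : realType) (H : lmodType R) (f : H -> H -> R) : Prop :=
  [/\ forall c x y z, f (c *: x + y) z = c * f x z + f y z,
      forall x y, f x y = f y x & forall x, 0 <= f x x].

Section Form.
Variables (R : realType) (H : lmodType R) (f : H -> H -> R).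
Hypothesis fP : psd_form f.
Let fl := let: And3 h _ _ := fP in h.

Lemma form_sym x y : f x y = f y x. Proof. by case: fP. Qed.
Lemma form_ge0 x : 0 <= f x x. Proof. by case: fP. Qed.
Lemma formDl x y z : f (x + y) z = f x z + f y z.
Proof. by have := fl 1 x y z; rewrite scale1r mul1r. Qed.
Lemma form0l z : f 0 z = 0.
Proof. by have := formDl 0 0 z; rewrite addr0 => h; lra. Qed.
Lemma formZl c x z : f (c *: x) z = c * f x z.
Proof. by have := fl c x 0 z; rewrite addr0 form0l addr0. Qed.
Lemma formNl x z : f (- x) z = - f x z.
Proof. by rewrite -scaleN1r formZl mulN1r. Qed.
Lemma formBl x y z : f (x - y) z = f x z - f y z.
Proof. by rewrite formDl formNl. Qed.
Lemma formDr x y z : f z (x + y) = f z x + f z y.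
Proof. by rewrite !(form_sym z) formDl. Qed.
Lemma formZr c x z : f z (c *: x) = c * f z x.
Proof. by rewrite !(form_sym z) formZl. Qed.
Lemma formBr x y z : f z (x - y) = f z x - f z y.
Proof. by rewrite !(form_sym z) formBl. Qed.
Lemma form_suml (I : Type) (r : seq I) (P : pred I) (F : I -> H) z :
  f (\sum_(i <- r | P i) F i) z = \sum_(i <- r | P i) f (F i) z.
Proof.
by elim/big_rec2: _ => [|i x y _ <-]; rewrite ?form0l // formDl.
Qed.
Lemma form_sumr (I : Type) (r : seq I) (P : pred I) (F : I -> H) z :
  f z (\sum_(i <- r | P i) F i) = \sum_(i <- r | P i) f z (F i).
Proof. by rewrite form_sym form_suml; apply: eq_bigr => i _; rewrite form_sym. Qed.
Lemma form_comb n (c : 'I_n -> R) (F : 'I_n -> H) z :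
  f (\sum_(i < n) c i *: F i) z = \sum_(i < n) c i * f (F i) z.
Proof. by rewrite form_suml; apply: eq_bigr => i _; rewrite formZl. Qed.
Lemma form_sqrD x y : f (x + y) (x + y) = f x x + 2 * f x y + f y y.
Proof. by rewrite formDl !formDr (form_sym y x); ring. Qed.
Lemma form_sqrB x y : f (x - y) (x - y) = f x x - 2 * f x y + f y y.
Proof. by rewrite formBl !formBr (form_sym y x); ring. Qed.
Lemma form_null x : f x x = 0 -> forall y, f x y = 0.
Proof.
move=> fx y; apply: (linear_coef_eq0 (form_ge0 y)) => t.
have := form_ge0 (2^-1 *: x + t *: y); rewrite form_sqrD !formZl !formZr fx.
by congr (_ <= _); field.
Qed.
Lemma form_cvg (x : nat -> H) y z : f (x n - y) (x n - y) @[n --> \oo] --> 0 ->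
  f (x n) z @[n --> \oo] --> f y z.
Proof.
move=> xy; pose K := 1 + f z z; have K0 : 0 < K by rewrite ltr_pwDl ?form_ge0.
apply/cvgrPdist_lt => e e0.
have d0 : 0 < e ^+ 2 / K by rewrite divr_gt0 ?exprn_gt0.
have /cvgrPdist_lt/(_ _ d0) := xy; apply: filterS => n.
rewrite sub0r normrN ger0_norm ?form_ge0 // => h.
rewrite -formBl -opprB formNl normrN.
set w := _ - _ in h *.
suff : `|f w z| ^+ 2 < e ^+ 2 by rewrite ltr_pXn2r ?nnegrE ?normr_ge0 ?ltW.
rewrite real_normK ?num_real //.
have cs : f w z ^+ 2 <= f w w * f z z.
  have [w0|w0] := eqVneq (f w w) 0; first by rewrite (form_null w0) w0 expr0n mul0r.
  have wp : 0 < f w w by rewrite lt_def w0 form_ge0.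
  have := form_ge0 (z - (f w z / f w w) *: w).
  rewrite form_sqrB formZr formZl formZr (form_sym z w).
  rewrite (_ : _ + _ = f z z - f w z ^+ 2 / f w w); last by field.
  by rewrite subr_ge0 ler_pdivrMr // mulrC.
apply: le_lt_trans cs _; apply: le_lt_trans (_ : _ <= f w w * K) _.
  by rewrite ler_wpM2l ?form_ge0 // lerDr.
by rewrite -ltr_pdivlMr.
Qed.
Lemma form_cvg_sqr (x : nat -> H) y : f (x n - y) (x n - y) @[n --> \oo] --> 0 ->
  f (x n) (x n) @[n --> \oo] --> f y y.
Proof.
move=> xy; rewrite (_ : (fun n => _) = fun n => f (x n - y) (x n - y) + 2 * f (x n) y - f y y).
  rewrite (_ : nbhs (f y y) = nbhs (0 + 2 * f y y - f y y)); last by congr nbhs; ring.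
  apply: cvgB; last exact: cvg_cst.
  by apply: cvgD (xy) _; apply: cvgM; [exact: cvg_cst|exact: form_cvg xy].
by apply/funext => n; rewrite form_sqrB; ring.
Qed.
End Form.

Section Spectral.
Variables (R : realType) (H : lmodType R) (a b : H -> H -> R).

(** Cauchy sequences for [a + b] converge, to a limit that is unique only
    modulo the null vectors of [a + b]. *)
Definition energy_complete : Prop :=
  forall x : nat -> H,
    (forall e : R, 0 < e -> exists N, forall m n, (N <= m)%N -> (N <= n)%N ->
       a (x m - x n) (x m - x n) + b (x m - x n) (x m - x n) < e) ->
  exists y, a (x n - y) (x n - y) @[n --> \oo] --> 0 /\
            b (x n - y) (x n - y) @[n --> \oo] --> 0.

(** A quantitative form of the compact embedding of the form domain: up to
    finitely many bounded functionals, [b] is arbitrarily small against [a]. *)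
Definition friedrichs : Prop :=
  forall L : R, 0 < L ->
  exists (N : nat) (l : 'I_N -> H -> R) (C : R),
    [/\ forall j c x y, l j (c *: x + y) = c * l j x + l j y,
        forall j x, l j x ^+ 2 <= C * b x x &
        forall x, b x x <= a x x / L + \sum_(j < N) l j x ^+ 2].

Definition eigvec (la : R) (x : H) : Prop := forall y, a x y = la * b x y.

(** Linear independence modulo the null space of [b]. *)
Definition indep n (x : 'I_n -> H) : Prop := forall c : 'I_n -> R,
  b (\sum_(i < n) c i *: x i) (\sum_(i < n) c i *: x i) = 0 -> forall i, c i = 0.

Definition infinite_dim : Prop := forall n, exists x : 'I_n -> H, indep x.

Hypotheses (aP : psd_form a) (bP : psd_form b).
Hypotheses (complete : energy_complete) (fried : friedrichs)
  (infdim : infinite_dim).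

Lemma lin_comb (l : H -> R) : (forall c x y, l (c *: x + y) = c * l x + l y) ->
  forall n (c : 'I_n -> R) (x : 'I_n -> H),
  l (\sum_(i < n) c i *: x i) = \sum_(i < n) c i * l (x i).
Proof.
move=> ll n c x; have l0 : l 0 = 0.
  by have := ll 1 0 0; rewrite scale1r addr0 mul1r => h; lra.
by elim/big_rec2: _ => [//|i u v _ <-]; rewrite ll.
Qed.

Definition orth (s : seq H) (x : H) : Prop := forall y, y \in s -> b y x = 0.

Lemma orth_lin s c x y : orth s x -> orth s y -> orth s (c *: x + y).
Proof.
by move=> sx sy z zs; rewrite (formDr bP) (formZr bP) sx // sy // mulr0 addr0.
Qed.

Lemma orthD s x y : orth s x -> orth s y -> orth s (x + y).
Proof. by move=> sx sy; rewrite -[x]scale1r; apply: orth_lin. Qed.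

Lemma orthZ s c x : orth s x -> orth s (c *: x).
Proof. by move=> sx z zs; rewrite (formZr bP) sx // mulr0. Qed.

Lemma exists_orth s : exists2 x, orth s x & b x x = 1.
Proof.
have [x xi] := infdim (size s).+1.
have [c [i ci] cs] := @nontrivial_kernel R _ (size s)
  (fun i j => b (x i) (nth 0 s j)) (ltnSn _).
pose v := \sum_(i < (size s).+1) c i *: x i.
have v0 : 0 < b v v.
  rewrite lt_def (form_ge0 bP) andbT; apply/eqP => /xi/(_ i) ci0.
  by rewrite ci0 eqxx in ci.
have sv : orth s v.
  move=> y ys; have ly : (index y s < size s)%N by rewrite index_mem.
  have := cs (Ordinal ly); rewrite /= nth_index // => <-.
  by rewrite (form_sym bP) (form_comb bP).
exists ((Num.sqrt (b v v))^-1 *: v); first exact: orthZ.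
rewrite (formZl bP) (formZr bP) mulrA -invfM -expr2 sqr_sqrtr ?ltW // mulVf //.
by rewrite gt_eqF.
Qed.

(** A minimizing sequence for the Rayleigh quotient: [friedrichs] and
    Bolzano-Weierstrass applied to finitely many functionals give a subsequence
    which is Cauchy for [b], and the parallelogram identity for
    [a - lambda b >= 0] makes it Cauchy for [a] as well. *)
Lemma rayleigh_minimizer s : exists y, [/\ orth s y, b y y = 1 &
  forall w, orth s w -> a y y * b w w <= a w w].
Proof.
pose S := [set r | exists2 x, orth s x & b x x = 1 /\ r = a x x].
have S0 : S !=set0.
  by have [x sx bx] := exists_orth s; exists (a x x); exists x.
have Slb : lbound S 0 by move=> _ [x _ [_ ->]]; exact: form_ge0.
have Sinf : has_inf S by split => //; exists 0.
pose la := inf S.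
have la0 : 0 <= la by exact: lb_le_inf.
have laS r : S r -> la <= r by apply: ge_inf; exists 0.
have ray w : orth s w -> la * b w w <= a w w.
  move=> sw; have [b0|b0] := eqVneq (b w w) 0.
    by rewrite b0 mulr0 form_ge0.
  have bp : 0 < b w w by rewrite lt_def b0 form_ge0.
  rewrite -ler_pdivlMr //; apply: laS.
  exists ((Num.sqrt (b w w))^-1 *: w); first exact: orthZ.
  rewrite (formZl bP) (formZr bP) (formZl aP) (formZr aP) !mulrA -!invfM -!expr2.
  by rewrite sqr_sqrtr ?ltW // mulVf // mulrC.
have [v vP] : {v : nat -> H & forall n, [/\ orth s (v n), b (v n) (v n) = 1 &
    a (v n) (v n) < la + n.+1%:R^-1]}.
  apply: (@choice _ _ (fun n x => [/\ orth s x, b x x = 1 & a x x < la + n.+1%:R^-1])) => n.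
  have n0 : (0 : R) < n.+1%:R^-1 by rewrite invr_gt0.
  by have [_ [x sx [bx ->]] xl] := inf_adherent n0 Sinf; exists x.
have L0 : 0 < la + 1 by rewrite ltr_wpDl.
have [N [l [C [ll lC lF]]]] := fried L0.
have lb j k : `|l j (v k)| <= C + 1.
  have [_ bv _] := vP k; have := lC j (v k); rewrite bv mulr1 => h.
  have C0 : 0 <= C by apply: le_trans h; exact: sqr_ge0.
  rewrite -(@ler_pXn2r _ 2%N) ?nnegrE ?addr_ge0 ?normr_ge0 // real_normK ?num_real //.
  by apply: le_trans h _; nra.
have [f fi fc] := bolzano_weierstrass_family lb.
pose z n := v (f n).
have zP n : [/\ orth s (z n), b (z n) (z n) = 1 & a (z n) (z n) < la + n.+1%:R^-1].
  have [h1 h2 h3] := vP (f n); split => //; apply: lt_le_trans h3 _.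
  by rewrite lerD2l lef_pV2 ?posrE // ler_nat ltnS increasing_seq_ge.
pose m j := limn (fun n => l j (z n)).
pose D n := \sum_(j < N) (l j (z n) - m j) ^+ 2.
have Dc : D n @[n --> \oo] --> 0.
  rewrite (_ : nbhs 0 = nbhs (\sum_(j < N) (m j - m j) ^+ 2)); last first.
    by congr nbhs; rewrite big1 // => j _; rewrite subrr expr0n.
  apply: cvg_sum_ord => j.
  under eq_fun do rewrite expr2; rewrite expr2.
  have h : (l j (z n) - m j) @[n --> \oo] --> m j - m j.
    by apply: cvgB; [exact: fc|exact: cvg_cst].
  exact: cvgM.
have qz n k : a (z n - z k) (z n - z k) - la * b (z n - z k) (z n - z k)
    <= 2 * n.+1%:R^-1 + 2 * k.+1%:R^-1.
  have [sn bn an] := zP n; have [sk bk ak] := zP k.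
  have := ray _ (orthD sn sk); rewrite !(form_sqrB aP) !(form_sqrD aP).
  rewrite !(form_sqrB bP) !(form_sqrD bP) bn bk => h.
  by move: an ak h; move: n.+1%:R^-1 k.+1%:R^-1 => p q; lra.
have bz n k : b (z n - z k) (z n - z k) <=
    2 * n.+1%:R^-1 + 2 * k.+1%:R^-1 + (la + 1) * (2 * D n + 2 * D k).
  have h1 := qz n k; have := lF (z n - z k).
  have h2 : \sum_(j < N) l j (z n - z k) ^+ 2 <= 2 * D n + 2 * D k.
    rewrite !mulr_sumr -big_split /=; apply: ler_sum => j _.
    have -> : l j (z n - z k) = l j (z n) - l j (z k).
      by rewrite addrC -scaleN1r ll; ring.
    move: (l j (z n)) (l j (z k)) (m j) => p q r.
    by have := sqr_ge0 (p + q - 2 * r); lra.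
  set B := b _ _ in h1 *; set A := a _ _ in h1 *; set Sg := \sum_(j < N) _ in h2 *.
  move=> h3; have : B * (la + 1) <= A + Sg * (la + 1).
    by rewrite -ler_pdivlMr // mulrDl mulfK ?gt_eqF.
  have := ler_wpM2l (ltW L0) h2; move: h1 {h2 h3}.
  move: n.+1%:R^-1 k.+1%:R^-1 (D n) (D k) A B Sg => p q d1 d2 A B Sg {}h1 h4 h5.
  by lra.
have [y [ya yb]] : exists y, a (z n - y) (z n - y) @[n --> \oo] --> 0 /\
            b (z n - y) (z n - y) @[n --> \oo] --> 0.
  apply: complete => e e0.
  pose E n := 2 * n.+1%:R^-1 * (la + 2) + 2 * (la + 1) ^+ 2 * D n.
  have Ec : E n @[n --> \oo] --> 0.
    rewrite (_ : nbhs 0 = nbhs (2 * 0 * (la + 2) + 2 * (la + 1) ^+ 2 * 0)); last first.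
      by congr nbhs; ring.
    apply: cvgD; last by apply: cvgM Dc; exact: cvg_cst.
    apply: cvgM; last exact: cvg_cst.
    by apply: cvgM; [exact: cvg_cst|exact: cvg_harmonic].
  have e2 : 0 < e / 2 by rewrite divr_gt0.
  have /cvgrPdist_lt/(_ _ e2)[M _ hM] := Ec.
  exists M => n k Mn Mk; have := hM n Mn; have := hM k Mk.
  rewrite /= !sub0r !normrN => /ltr_normlW hk /ltr_normlW hn.
  have h1 := qz n k; have h2 := bz n k.
  rewrite /E in hk hn; set B := b _ _ in h1 h2 *; set A := a _ _ in h1 *.
  have := ler_wpM2l (ltW L0) h2; move: hn hk h1 {h2}.
  move: n.+1%:R^-1 k.+1%:R^-1 (D n) (D k) A B => p q d1 d2 A B hn hk {}h1 {}h2.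
  have : A + B <= 2 * p + 2 * q + (la + 1) * B by lra.
  by lra.
have sy : orth s y.
  move=> w ws; have := form_cvg bP yb (z := w).
  have -> : (fun n => b (z n) w) = fun=> 0.
    by apply/funext => n; rewrite (form_sym bP); have [h _ _] := zP n; exact: h.
  move=> /cvg_lim h; rewrite (form_sym bP) -h //; exact: lim_cst.
have by1 : b y y = 1.
  have := form_cvg_sqr bP yb.
  have -> : (fun n => b (z n) (z n)) = fun=> 1.
    by apply/funext => n; have [_ h _] := zP n.
  by move=> /cvg_lim <- //; exact: lim_cst.
have ay : a y y <= la.
  have h := form_cvg_sqr aP ya.
  have h2 : la + n.+1%:R^-1 @[n --> \oo] --> la + 0.
    by apply: cvgD; [exact: cvg_cst|exact: cvg_harmonic].
  rewrite -[la]addr0 -(cvg_lim _ h2) // -(cvg_lim _ h) //.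
  apply: ler_lim; [by apply/cvg_ex; eexists; exact: h|by apply/cvg_ex; eexists; exact: h2|].
  by apply: nearW => n; have [_ _ /ltW] := zP n.
exists y; split => // w sw; apply: le_trans (ray _ sw).
by rewrite ler_wpM2r ?form_ge0.
Qed.

(** The eigenvalues are not recorded: they are the Rayleigh quotients. *)
Definition eigsystem (s : seq H) : Prop := forall i, (i < size s)%N ->
  eigvec (a (nth 0 s i) (nth 0 s i)) (nth 0 s i) /\
  forall j, (j < size s)%N -> b (nth 0 s i) (nth 0 s j) = (i == j)%:R.

(** A minimizer on the orthogonal complement of [s] is critical there; on the
    span of [s] the eigenvalue equation holds because both sides vanish. *)
Lemma eigsystem_step s : eigsystem s -> exists y,
  [/\ eigsystem (rcons s y), orth s y &
      forall w, orth s w -> a y y * b w w <= a w w].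
Proof.
move=> es; have [y [sy by1 ymin]] := rayleigh_minimizer s.
have nys i : (i < size s)%N -> b y (nth 0 s i) = 0.
  by move=> si; rewrite (form_sym bP); apply: sy; exact: mem_nth.
have critical w : orth s w -> a y w = a y y * b y w.
  move=> sw; apply/eqP; rewrite -subr_eq0; apply/eqP.
  have h := ymin w sw.
  suff : 2 * (a y w - a y y * b y w) = 0 by move=> ?; lra.
  apply: (@linear_coef_eq0 _ (a w w - a y y * b w w)); first by rewrite subr_ge0.
  move=> t; have := ymin _ (orthD sy (orthZ t sw)).
  rewrite (form_sqrD aP) (form_sqrD bP) !(formZl aP) !(formZr aP) !(formZl bP).
  by rewrite !(formZr bP) by1; lra.
have ey : eigvec (a y y) y.
  move=> z; pose p := \sum_(i < size s) b (nth 0 s i) z *: nth 0 s i.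
  have bp j : (j < size s)%N -> b (nth 0 s j) p = b (nth 0 s j) z.
    move=> sj; rewrite /p (form_sumr bP) (bigD1 (Ordinal sj)) //= big1 => [|i].
      by rewrite (formZr bP) (proj2 (es _ sj)) // eqxx mulr1 addr0.
    move=> ij; rewrite (formZr bP) (proj2 (es _ sj)) // (_ : (j == i) = false).
      by rewrite mulr0.
    by apply/negP => /eqP ji; move: ij; rewrite -val_eqE /= ji eqxx.
  have sw : orth s (z - p).
    move=> x xs; rewrite (formBr bP) -(nth_index 0 xs) bp ?index_mem //.
    by rewrite subrr.
  have := critical _ sw; rewrite (formBr aP) (formBr bP).
  have -> : a y p = 0.
    rewrite /p (form_sumr aP) big1 // => i _; rewrite (formZr aP) (form_sym aP y).
    by rewrite (proj1 (es _ (ltn_ord i))) (form_sym bP _ y) nys ?mulr0.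
  have -> : b y p = 0.
    by rewrite /p (form_sumr bP) big1 // => i _; rewrite (formZr bP) nys ?mulr0.
  by rewrite !subr0.
exists y; split => // i; rewrite size_rcons ltnS leq_eqVlt => /orP[/eqP ->|si].
  rewrite nth_rcons ltnn eqxx; split => // j; rewrite ltnS leq_eqVlt.
  case/orP=> [/eqP ->|sj]; first by rewrite nth_rcons ltnn !eqxx.
  by rewrite nth_rcons sj nys // gt_eqF.
rewrite nth_rcons si; split; first exact: (proj1 (es _ si)).
move=> j; rewrite ltnS leq_eqVlt => /orP[/eqP ->|sj].
  by rewrite nth_rcons ltnn eqxx (form_sym bP _ y) nys // lt_eqF.
by rewrite nth_rcons sj; exact: (proj2 (es _ si)).
Qed.

(** A space on which [a <= L b] has bounded dimension, since otherwise the
    functionals of [friedrichs] would have a common zero in it. *)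
Lemma friedrichs_finite (L : R) : exists N, forall n (x : 'I_n -> H), indep x ->
  (forall c : 'I_n -> R, let v := \sum_(i < n) c i *: x i in a v v <= L * b v v) ->
  (n <= N)%N.
Proof.
pose M := `|L| + 1; have M0 : 0 < M by rewrite ltr_wpDl.
have [N [l [C [ll lC lF]]]] := fried M0.
exists N => n x xi xa; rewrite leqNgt; apply/negP => ltNn.
have [c [i ci] cs] := @nontrivial_kernel R _ N (fun i j => l j (x i)) ltNn.
have ln := ler_norm L.
move: (xa c); set v := \sum_(i < n) _ => /= av.
have := lF v; rewrite big1 => [|j _]; last first.
  by rewrite /v (lin_comb (ll j)) cs expr0n.
have b0 := form_ge0 bP v.
rewrite addr0 ler_pdivlMr // => h.
have : b v v = 0 by apply/eqP; rewrite eq_le b0 andbT; rewrite /M in h; nra.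
by move=> /xi/(_ i) ci0; rewrite ci0 eqxx in ci.
Qed.

Lemma orthonormal_indep (e : nat -> H) n (s : 'I_n -> nat) : injective s ->
  (forall i j, b (e i) (e j) = (i == j)%:R) -> indep (e \o s).
Proof.
move=> sinj on c; set v := \sum_(i < n) _ => bv i.
have := form_null bP bv (e (s i)); rewrite /v (form_comb bP) (bigD1 i) //= on eqxx.
rewrite mulr1 big1 ?addr0 // => j ji; rewrite on (inj_eq sinj) (negbTE ji).
by rewrite mulr0.
Qed.

(** The last two clauses are the lower half of the min-max principle and the
    divergence of the eigenvalues; together they replace the completeness of
    the orthonormal system. *)
Definition spectral_system (nu : nat -> R) (e : nat -> H) : Prop :=
  [/\ {homo nu : m n / (m <= n)%N >-> m <= n},
      forall i j, b (e i) (e j) = (i == j)%:R,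
      forall i, eigvec (nu i) (e i),
      forall k v, (forall i, (i < k)%N -> b (e i) v = 0) -> nu k * b v v <= a v v &
      forall L, exists k, L < nu k].

Theorem spectral_theorem : exists nu e, spectral_system nu e.
Proof.
have [g gP] : {g : seq H -> H & forall s, eigsystem s ->
    [/\ eigsystem (rcons s (g s)), orth s (g s) &
      forall w, orth s w -> a (g s) (g s) * b w w <= a w w]}.
  apply: (@choice _ _ (fun s y => eigsystem s -> [/\ eigsystem (rcons s y), orth s y &
      forall w, orth s w -> a y y * b w w <= a w w])) => s.
  have [/eigsystem_step[y ys]|ns] := pselect (eigsystem s); first by exists y.
  by exists 0 => /ns.
pose S := fix S n := if n is m.+1 then rcons (S m) (g (S m)) else [::].
have sS n : size (S n) = n by elim: n => //= n IH; rewrite size_rcons IH.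
have eS n : eigsystem (S n) by elim: n => [//|n /gP[]].
pose e n := g (S n).
have nS n i : (i < n)%N -> nth 0 (S n) i = e i.
  elim: n i => [//|n IH] i; rewrite ltnS leq_eqVlt /= nth_rcons sS => /orP[/eqP ->|ni].
    by rewrite ltnn eqxx.
  by rewrite ni IH.
have on i j : b (e i) (e j) = (i == j)%:R.
  have im : (i < (maxn i j).+1)%N by rewrite ltnS leq_maxl.
  have jm : (j < (maxn i j).+1)%N by rewrite ltnS leq_maxr.
  have := proj2 (@eS (maxn i j).+1 i _) j; rewrite !sS !nS //; exact.
have ev i : eigvec (a (e i) (e i)) (e i).
  by have := proj1 (@eS i.+1 i _); rewrite sS !nS //; exact.
have vmin k v : (forall i, (i < k)%N -> b (e i) v = 0) ->
    a (e k) (e k) * b v v <= a v v.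
  move=> kv; have [_ _] := gP _ (eS k); apply => x xS.
  have ik : (index x (S k) < k)%N by rewrite -[X in (_ < X)%N]sS index_mem.
  by rewrite -(nth_index 0 xS) nS // kv.
exists (fun n => a (e n) (e n)), e; split => //.
- move=> m n mn; have := @vmin m (e n); rewrite on eqxx mulr1; apply => i im.
  by rewrite on ltn_eqF // (leq_trans im).
- move=> L; apply: contrapT => nL.
  have {nL}nuL k : a (e k) (e k) <= L.
    by rewrite leNgt; apply/negP => kL; apply: nL; exists k.
  have [N NP] := friedrichs_finite L.
  have := NP N.+1 (e \o val) (orthonormal_indep val_inj on).
  suff ok : forall c : 'I_N.+1 -> R, let v := \sum_(i < N.+1) c i *: (e \o val) i in
      a v v <= L * b v v by rewrite ltnn => /(_ ok).
  move=> {NP} c /=.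
  rewrite (form_comb aP) (form_comb bP) mulr_sumr; apply: ler_sum => i _.
  rewrite !(form_sumr aP) !(form_sumr bP) (bigD1 i) //= [X in _ <= _ * (_ * X)](bigD1 i) //=.
  rewrite !big1 ?addr0 => [|j ji|j ji].
  + rewrite (formZr aP) (formZr bP) on eqxx /=.
    have := ler_wpM2l (sqr_ge0 (c i)) (nuL i); move: (a (e i) (e i)) (c i) => p q; lra.
  + by rewrite (formZr bP) on eq_sym (inj_eq val_inj) (negbTE ji) mulr0.
  + by rewrite (formZr aP) ev on eq_sym (inj_eq val_inj) (negbTE ji) !mulr0.
Qed.

Lemma eigvec_orth la mu x y : eigvec la x -> eigvec mu y -> la != mu -> b x y = 0.
Proof.
move=> ex ey lm; have := ex y; rewrite (form_sym aP) ey (form_sym bP) => /eqP.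
by rewrite -subr_eq0 -mulrBl mulf_eq0 subr_eq0 eq_sym (negbTE lm) /= => /eqP.
Qed.

Lemma eigvec_comb la n (c : 'I_n -> R) (x : 'I_n -> H) :
  (forall i, eigvec la (x i)) -> eigvec la (\sum_(i < n) c i *: x i).
Proof.
move=> ex y; rewrite (form_comb aP) (form_comb bP) mulr_sumr.
by apply: eq_bigr => i _; rewrite ex mulrCA.
Qed.

(** Among too many independent eigenvectors for [la] some combination is
    orthogonal to all [e i], and then the fourth clause of [spectral_system]
    contradicts [la < nu K]. *)
Lemma multiplicity_occurs nu e la n : spectral_system nu e ->
  (exists2 x : 'I_n -> H, (forall i, eigvec la (x i)) & indep x) <->
  occurs_ge nu la n.
Proof.
move=> [mono on ev vmin unb]; split; last first.
  move=> [s [sinj sla]]; exists (e \o s); last exact: orthonormal_indep.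
  by move=> i; rewrite -(sla i); exact: ev.
move=> [x xla xi]; have [K laK] := unb la.
have nuK j : nu j = la -> (j < K)%N.
  by move=> jla; rewrite ltnNge; apply/negP => /mono; rewrite jla leNgt laK.
pose J := [set j : 'I_K | nu j == la]%SET.
have [nJ|Jn] := leqP n #|J|.
  exists (fun i => val (enum_val (widen_ord nJ i))); split.
    move=> i j /val_inj /enum_val_inj ij; apply: val_inj.
    exact: (congr1 val ij).
  by move=> i; have := enum_valP (widen_ord nJ i); rewrite inE => /eqP.
have [c [i ci] cs] := @nontrivial_kernel R _ _
  (fun i (j : 'I_#|J|) => b (x i) (e (val (enum_val j)))) Jn.
move: (xi c); set v := \sum_(i < n) _ => xic.
have vla : eigvec la v by exact: eigvec_comb.
have ve k : b (e k) v = 0.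
  have [kla|kla] := eqVneq (nu k) la; last exact: eigvec_orth (ev k) vla kla.
  have kJ : Ordinal (nuK _ kla) \in J by rewrite inE /= kla.
  have := cs (enum_rank_in kJ (Ordinal (nuK _ kla))).
  by rewrite enum_rankK_in // => <-; rewrite (form_sym bP) /v (form_comb bP).
have bv : b v v != 0 by apply/eqP => /xic/(_ i) ci0; rewrite ci0 eqxx in ci.
have bp : 0 < b v v by rewrite lt_def bv form_ge0.
by have := @vmin K v (fun i _ => ve i); rewrite vla ler_pM2r // leNgt laK.
Qed.

End Spectral.

(** * Changes of variables in the plane *)

(** The area measure under a name of its own, to carry the sigma-finiteness
    that the iterated integrals need. *)
Definition lebplane (R : realType) :
    set (measurableTypeR R * measurableTypeR R) -> \bar R := leb2 R.
HB.instance Definition _ (R : realType) := Measure.on (@lebplane R).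

Lemma lebplane_sigma_finite (R : realType) : sigma_finite setT (@lebplane R).
Proof.
have /sigma_finiteP[F [TF ndF Foo]] := sigma_finiteT (@lebesgue_measure R).
exists (fun n => F n `*` F n).
  rewrite -setXTT TF predeqE => -[x y]; split.
    move=> [/= [n _ Fnx] [k _ Gky]]; exists (maxn n k) => //; split.
    - by move: x Fnx; exact/subsetPset/ndF/leq_maxl.
    - by move: y Gky; exact/subsetPset/ndF/leq_maxr.
  by move=> [n _ []/= ? ?]; split; exists n.
move=> k; have [? ?] := Foo k.
split; first exact: measurableX.
by rewrite /lebplane product_measure1E// lte_mul_pinfty// ge0_fin_numE.
Qed.

HB.instance Definition _ (R : realType) :=
  Measure_isSigmaFinite.Build _ _ _ (@lebplane R) (@lebplane_sigma_finite R).

Section Affine.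
Variable R : realType.
Local Notation P := (measurableTypeR R * measurableTypeR R)%type.
Local Notation leb := (@lebesgue_measure R).
Local Notation mu := (leb2 R).

Lemma measurable_affine (a c : R) :
  measurable_fun setT ((fun x => a * x + c) : measurableTypeR R -> measurableTypeR R).
Proof.
apply: (@measurable_funD _ _ _ setT (fun x => a * x) (fun=> c)) => //.
exact: (@measurable_funM _ _ _ setT (fun=> a) id).
Qed.

(** Both sides agree on half-open intervals, which determine the measure. *)
Lemma leb_affine (a c : R) (A : set (measurableTypeR R)) : a != 0 -> measurable A ->
  leb ((fun x => a * x + c) @^-1` A) = ((`|a|^-1)%R%:E * leb A)%E.
Proof.
move=> a0 mA; have na : 0 < `|a| by rewrite normr_gt0.
pose f := (fun x => a * x + c) : measurableTypeR R -> measurableTypeR R.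
have mf : measurable_fun setT f by exact: measurable_affine.
pose m0 : {measure set (measurableTypeR R) -> \bar R} := pushforward leb f.
pose m : {measure set (measurableTypeR R) -> \bar R} := mscale (NngNum (normr_ge0 a)) (m0 mf).
have key : forall X, ocitv X -> leb X = m X.
  move=> _ [[x y] _ <-]; rewrite /m /= /mscale /= /pushforward.
  pose u := (x - c) / a; pose v := (y - c) / a.
  have [ap|an|/eqP] := ltgtP a 0; last by rewrite (negbTE a0).
    have -> : f @^-1` `]x, y] = `[v, u[%classic.
      apply/seteqP; split => t /=; rewrite !in_itv /= /f /u /v.
        by move=> /andP[h1 h2]; rewrite ler_ndivrMr // ltr_ndivlMr //; apply/andP; split; lra.
      by rewrite ler_ndivrMr // ltr_ndivlMr // => /andP[h1 h2]; apply/andP; split; lra.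
    rewrite lebesgue_measure_itv /= lebesgue_measure_itv /= !lte_fin /u /v.
    rewrite ltr_nM2r ?invr_lt0 // ltrD2r; case: ifP => xy; last by rewrite mule0.
    by rewrite -!EFinB -EFinM ltr0_norm //; congr EFin; field.
  have -> : f @^-1` `]x, y] = `]u, v]%classic.
    apply/seteqP; split => t /=; rewrite !in_itv /= /f /u /v.
      by move=> /andP[h1 h2]; rewrite ltr_pdivrMr // ler_pdivlMr //; apply/andP; split; lra.
    by rewrite ltr_pdivrMr // ler_pdivlMr // => /andP[h1 h2]; apply/andP; split; lra.
  rewrite lebesgue_measure_itv /= lebesgue_measure_itv /= !lte_fin /u /v.
  rewrite ltr_pM2r ?invr_gt0 // ltrD2r; case: ifP => xy; last by rewrite mule0.
  by rewrite -!EFinB -EFinM gtr0_norm //; congr EFin; field.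
have := lebesgue_measure_unique key mA.
rewrite /m /= /mscale /= /pushforward => ->.
by rewrite muleA -EFinM mulVf ?gt_eqF // mul1e.
Qed.

Lemma mule_inv_norm (r s : R) (U V : \bar R) : r != 0 -> s != 0 ->
  (`|r * s|%R%:E * ((`|r|^-1)%R%:E * U * ((`|s|^-1)%R%:E * V)) = U * V)%E.
Proof.
move=> r0 s0; rewrite muleACA [LHS]muleA -!EFinM normrM mulrACA.
by rewrite !mulfV ?normr_eq0 // mulr1 mul1e.
Qed.

Definition scales_area (T : P -> P) (c : R) : Prop :=
  measurable_fun setT T /\
  forall A, measurable A -> mu (T @^-1` A) = (c%:E * mu A)%E.

Lemma scales_area_comp T S c d : scales_area T c -> scales_area S d ->
  scales_area (T \o S) (d * c).
Proof.
move=> [mT Tc] [mS Sd]; split; first exact: measurableT_comp.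
move=> A mA; rewrite comp_preimage Sd; first by rewrite Tc // muleA EFinM.
by rewrite -[X in measurable X]setTI; exact: mT.
Qed.

Lemma scales_area_diag (a b c d : R) : a != 0 -> b != 0 ->
  scales_area (fun p => (a * p.1 + c, b * p.2 + d)) (`|a * b|^-1).
Proof.
move=> a0 b0; have ab : 0 < `|a * b| by rewrite normr_gt0 mulf_neq0.
pose T := (fun p => (a * p.1 + c, b * p.2 + d)) : P -> P.
have mT : measurable_fun setT T.
  by apply/measurable_fun_pairP; split;
    [apply: (measurableT_comp (measurable_affine a c))|
     apply: (measurableT_comp (measurable_affine b d))].
split => // A mA.
pose m0 : {measure set P -> \bar R} := pushforward mu T.
pose m : {measure set P -> \bar R} := mscale (NngNum (normr_ge0 (a * b))) (m0 mT).
have key X Y : measurable X -> measurable Y -> m (X `*` Y) = (leb X * leb Y)%E.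
  move=> mX mY; rewrite /m /= /mscale /= /pushforward.
  have -> : T @^-1` (X `*` Y) =
    ((fun x => a * x + c) @^-1` X) `*` ((fun x => b * x + d) @^-1` Y) by [].
  rewrite product_measure1E; last 2 first.
    by rewrite -[Z in measurable Z]setTI; apply: measurable_affine.
    by rewrite -[Z in measurable Z]setTI; apply: measurable_affine.
  by rewrite -(mule_inv_norm (leb X) (leb Y) a0 b0); congr (_ * (_ * _))%E; apply: leb_affine.
rewrite (product_measure_unique key mA) /m /= /mscale /= /pushforward.
by rewrite muleA -EFinM mulVf ?gt_eqF // mul1e.
Qed.

Lemma scales_area_shear2 (a : R) : scales_area (fun p => (p.1, p.2 + a * p.1)) 1.
Proof.
split.
  apply/measurable_fun_pairP; split; first exact: measurable_fst.
  apply: (@measurable_funD _ _ _ setT snd (fun p : P => a * p.1)) => //.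
  by apply: (@measurable_funM _ _ _ setT (fun=> a) fst).
move=> A mA; rewrite mul1e /product_measure1; apply: eq_integral => x _ /=.
have -> : xsection ((fun p => (p.1, p.2 + a * p.1)) @^-1` A) x =
    (fun y => 1 * y + a * x) @^-1` xsection A x.
  by apply/seteqP; split => y /=; rewrite /xsection /= !inE /= mul1r.
by rewrite leb_affine ?oner_neq0 ?normr1 ?invr1 ?mul1e //; exact: measurable_xsection.
Qed.

Lemma scales_area_swap : scales_area (fun p => (p.2, p.1)) 1.
Proof.
pose T := (fun p => (p.2, p.1)) : P -> P.
have mT : measurable_fun setT T.
  by apply/measurable_fun_pairP; split; [exact: measurable_snd|exact: measurable_fst].
split => // A mA; rewrite mul1e.
pose m : {measure set P -> \bar R} := pushforward mu T.
have key X Y : measurable X -> measurable Y -> m mT (X `*` Y) = (leb X * leb Y)%E.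
  move=> mX mY; rewrite /m /pushforward /=.
  have TXY : T @^-1` (X `*` Y) = Y `*` X by apply/seteqP; split => -[x y] /= [].
  by transitivity (mu (Y `*` X)); [rewrite -TXY|rewrite product_measure1E // muleC].
exact/esym/(product_measure_unique key mA).
Qed.

(** The matrix is a product of shears, a diagonal matrix and exchanges of the
    coordinates. *)
Lemma scales_area_similarity (a b : R) : a != 0 ->
  scales_area (fun p => (a * p.1 - b * p.2, b * p.1 + a * p.2)) (a ^+ 2 + b ^+ 2)^-1.
Proof.
move=> a0; have ab0 : 0 < a ^+ 2 + b ^+ 2.
  by rewrite ltr_pwDl ?sqr_ge0 // lt_def sqrf_eq0 a0 sqr_ge0.
have d0 : (a ^+ 2 + b ^+ 2) / a != 0 by apply: mulf_neq0; [rewrite gt_eqF|rewrite invr_neq0].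
have h := scales_area_comp (scales_area_shear2 (b / a))
  (scales_area_comp (scales_area_diag 0 0 a0 d0)
    (scales_area_comp scales_area_swap (scales_area_comp (scales_area_shear2 (- b / a))
    scales_area_swap))).
rewrite !mul1r !mulr1 in h.
rewrite (_ : (fun p => _) = fun p : P => (fun p => (p.1, p.2 + b / a * p.1))
  ((fun p : P => (a * p.1 + 0, (a ^+ 2 + b ^+ 2) / a * p.2 + 0))
    ((fun p : P => (p.2, p.1)) ((fun p : P => (p.1, p.2 + (- b / a) * p.1))
    ((fun p : P => (p.2, p.1)) p))))); last first.
  by apply/funext => -[x y] /=; congr pair; field.
rewrite [X in scales_area _ X](_ : _ = `|a * ((a ^+ 2 + b ^+ 2) / a)|^-1); first exact: h.
by rewrite mulrCA mulfV // mulr1 gtr0_norm.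
Qed.

Section Integral.
Variables (T : P -> P) (c : R).
Hypothesis Tc : scales_area T c.
Hypothesis c0 : 0 < c.

Lemma ge0_integral_scales (f : P -> \bar R) : measurable_fun setT f ->
  (forall p, (0 <= f p)%E) -> (\int[mu]_p f (T p) = c%:E * \int[mu]_p f p)%E.
Proof.
move=> mf f0; have [mT Tm] := Tc.
rewrite -(@ge0_integral_pushforward _ _ _ _ _ T mT mu setT f) //.
rewrite -(@ge0_integral_mscale _ _ _ mu setT _ (NngNum (ltW c0))) //.
by apply: eq_measure_integral => A mA _; exact: Tm.
Qed.

Lemma null_scales A : measurable A -> mu A = 0 -> mu (T @^-1` A) = 0.
Proof. by move=> mA A0; have [_ ->] := Tc; rewrite // A0 mule0. Qed.

Lemma negligible_scales A : mu.-negligible A -> mu.-negligible (T @^-1` A).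
Proof.
move=> [B [mB B0 AB]]; exists (T @^-1` B); split.
- by have [mT _] := Tc; rewrite -[X in measurable X]setTI; exact: mT.
- exact: null_scales.
- by move=> p /AB.
Qed.

Lemma ae_scales (Q : P -> Prop) : {ae mu, forall p, Q p} -> {ae mu, forall p, Q (T p)}.
Proof. exact: negligible_scales. Qed.

Lemma integrable_scales (f : P -> \bar R) :
  mu.-integrable setT f -> mu.-integrable setT (f \o T).
Proof.
move=> /integrableP[mf fi]; apply/integrableP; split.
  by apply: measurableT_comp mf _; case: Tc.
rewrite (ge0_integral_scales (f := fun p => `|f p|%E)) //.
  by rewrite lte_mul_pinfty // lee_fin ltW.
exact: measurableT_comp mf.
Qed.

Lemma integral_scales (f : P -> R) : mu.-integrable setT (EFin \o f) ->
  \int[mu]_p f (T p) = c * \int[mu]_p f p.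
Proof.
move=> fi; have /integrableP[mf _] := fi; rewrite /Rintegral.
have h : (\int[mu]_p (f (T p))%:E = c%:E * \int[mu]_p (f p)%:E)%E.
  rewrite integralE [X in _ = (_ * X)%E]integralE.
  have -> : (\int[mu]_p (fun p => (f (T p))%:E)^\+ p = c%:E * \int[mu]_p (EFin \o f)^\+ p)%E.
    by rewrite -ge0_integral_scales //; [apply: eq_integral => p _; rewrite !funeposE|exact: measurable_funepos].
  have -> : (\int[mu]_p (fun p => (f (T p))%:E)^\- p = c%:E * \int[mu]_p (EFin \o f)^\- p)%E.
    by rewrite -ge0_integral_scales //; [apply: eq_integral => p _; rewrite !funenegE|exact: measurable_funeneg].
  move: (integrable_neg_fin_num measurableT fi); set u := integral _ _ _.
  by set v := integral _ _ _ => vfin; rewrite [RHS]muleBr // fin_num_adde_defl ?fin_numN.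
by rewrite h fineM //; exact: integrable_fin_num.
Qed.

End Integral.

End Affine.

(** * Smooth bumps *)
Section Bumps.
Variable R : realType.

(** The functions [x^-k exp (-c/x)] extended by zero; their linear span is
    stable under differentiation. *)
Definition flat (c : R) (k : nat) (x : R) : R :=
  if 0 < x then (x^-1) ^+ k * expR (- c * x^-1) else 0.

Lemma flat_neg c k x : x <= 0 -> flat c k x = 0.
Proof. by rewrite /flat ltNge => ->. Qed.

Lemma flat_ge0 c k x : 0 <= flat c k x.
Proof.
rewrite /flat; case: ifP => // x0.
by rewrite mulr_ge0 ?expR_ge0 // exprn_ge0 // invr_ge0 ltW.
Qed.

Lemma flat_gt0 c k x : (0 < flat c k x) = (0 < x).
Proof.
rewrite /flat; case: ifP => x0; last by rewrite ltxx.
by rewrite mulr_gt0 ?expR_gt0 // exprn_gt0 // invr_gt0.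
Qed.

(** The exponential beats every power of [x^-1]; the bound by a multiple of
    [|x|] gives both continuity at 0 and, through [flat c k x / x =
    flat c k.+1 x], the derivative there. *)
Lemma flat_bound c k : 0 < c -> exists K, forall x, `|flat c k x| <= K * `|x|.
Proof.
move=> c0; pose K := k.+1`!%:R / c ^+ k.+1.
have K0 : 0 < K by rewrite divr_gt0 ?exprn_gt0 // ltr0n fact_gt0.
exists K => x; rewrite ger0_norm ?flat_ge0 //.
rewrite /flat; case: ifP => [x0|_]; last by rewrite mulr_ge0 // ltW.
rewrite (gtr0_norm x0) mulNr expRN.
have cx : 0 < c * x^-1 by rewrite mulr_gt0 ?invr_gt0.
have := expR_ge1Dxn k (ltW cx); set e := expR _ => he.
have f0 : (0 : R) < k.+1`!%:R by rewrite ltr0n fact_gt0.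
have t0 : 0 < (c * x^-1) ^+ k.+1 / k.+1`!%:R by rewrite divr_gt0 ?exprn_gt0.
have e0 : 0 < e by exact: expR_gt0.
rewrite ler_pdivrMr //.
have -> : (x^-1) ^+ k = K * x * ((c * x^-1) ^+ k.+1 / k.+1`!%:R).
  rewrite /K exprMn !exprS; set y := x^-1 ^+ k; set z := c ^+ k.
  have z0 : z != 0 by rewrite expf_neq0 ?gt_eqF.
  by field; rewrite z0 !gt_eqF.
rewrite ler_pM2l; first by apply: le_trans _ he; rewrite lerDr ler01.
by rewrite mulr_gt0.
Qed.

Lemma is_derive_flat (c : R) k (x : R) : 0 < c ->
  is_derive x 1 (flat c k) (c * flat c k.+2 x + (- k%:R) * flat c k.+1 x).
Proof.
move=> c0; have [x0|x0|->] := ltgtP x 0.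
- rewrite !flat_neg ?ltW // !mulr0 addr0.
  apply: (@near_eq_is_derive _ _ _ (cst 0)).
  near=> y; rewrite flat_neg // ltW //; near: y; exact: lt_nbhsl.
- have dV : is_derive x 1 (fun y : R => y^-1) (- x ^- 2).
    have := @is_deriveV R id x 1 1; rewrite /= => h; apply: is_derive_eq.
      by apply: h; rewrite gt_eqF.
    by rewrite /GRing.scale /= mulr1.
  have dk : is_derive x 1 (fun y : R => (y^-1) ^+ k) (k%:R * (x^-1) ^+ k.-1 * - x ^- 2).
    have := @is_deriveX R R (fun y : R => y^-1) k x 1 _ dV.
    by rewrite exprfctE.
  have de : is_derive x 1 (fun y : R => expR (- c * y^-1))
      (expR (- c * x^-1) * (- c * - x ^- 2)).
    have dl : is_derive x 1 (fun y : R => - c * y^-1) (- c * - x ^- 2).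
      by apply: is_derive_eq; rewrite /GRing.scale /= .
    exact: (@is_derive1_comp R expR (fun y : R => - c * y^-1)).
  have key : is_derive x 1 (fun y : R => (y^-1) ^+ k * expR (- c * y^-1))
      (c * flat c k.+2 x + (- k%:R) * flat c k.+1 x).
    apply: is_derive_eq; rewrite /GRing.scale /= /flat x0.
    by rewrite -exprVn; case: (k) => [|m] /=; rewrite !exprS ?expr0; set y := x^-1; ring.
  refine (near_eq_is_derive _ key).
  near=> y; rewrite /flat; have -> // : 0 < y; near: y; exact: lt_nbhsr.
- apply/is_derive1_caratheodory; exists (flat c k.+1); split.
  + move=> z; rewrite (flat_neg c k (lexx 0)) !subr0 /flat; case: ifP => z0; last by rewrite mul0r.
    by rewrite exprS; field; rewrite gt_eqF.
  + have [K HK] := flat_bound k.+1 c0.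
    rewrite /prop_for /continuous_at (flat_neg c k.+1 (lexx 0)).
    apply/cvgrPdist_le => e e0.
    have K0 : 0 <= K by have := HK 1; rewrite normr1 mulr1; apply: le_trans.
    near=> z; rewrite sub0r normrN; apply: le_trans (HK z) _.
    apply: (@le_trans _ _ ((K + 1) * `|z|)); first by rewrite ler_wpM2r // lerDl.
    rewrite mulrC -ler_pdivlMr ?ltr_wpDl //.
    near: z; apply: (@filterS _ (nbhs (0:R)) _ [set z | `|0 - z| < e / (K + 1)]).
      by move=> z /=; rewrite sub0r normrN => /ltW.
    by apply: nbhsx_ballx; rewrite divr_gt0 // ltr_wpDl.
  + by rewrite !flat_neg // !mulr0 addr0.
Unshelve. all: by end_near. Qed.

(** A class containing the bumps and closed under differentiation, which makes
    the products of two of its members smooth on the plane. *)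
Inductive bumpable : (R -> R) -> Prop :=
| bump_flat c k s a : 0 < c -> bumpable (fun x => flat c k (s * x + a))
| bump_add f g : bumpable f -> bumpable g -> bumpable (fun x => f x + g x)
| bump_mul f g : bumpable f -> bumpable g -> bumpable (fun x => f x * g x)
| bump_scale (r : R) f : bumpable f -> bumpable (fun x => r * f x).

Lemma bumpable_derive f : bumpable f ->
  exists2 f', bumpable f' & forall x : R, is_derive x 1 f (f' x).
Proof.
elim=> {f} [c k s a c0|f g _ [f' bf' df] _ [g' bg' dg]
           |f g bf [f' bf' df] bg [g' bg' dg]|r f _ [f' bf' df]].
- exists (fun x => s * (c * flat c k.+2 (s * x + a) + (- k%:R) * flat c k.+1 (s * x + a))).
    by do 2?constructor; do 2?constructor.
  move=> x; have da : is_derive x 1 (fun y : R => s * y + a) s.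
    by apply: is_derive_eq; rewrite /GRing.scale /= mulr1 addr0.
  have := @is_derive1_comp R (flat c k) (fun y => s * y + a) x _ _
    (is_derive_flat k (s * x + a) c0) da.
  by rewrite mulrC.
- by exists (fun x => f' x + g' x); [constructor|move=> x; exact: is_deriveD].
- exists (fun x => f x * g' x + g x * f' x); first by do 2?constructor.
  by move=> x; exact: is_deriveM.
- exists (fun x => r * f' x); first by constructor.
  by move=> x; exact: is_deriveZ.
Qed.

Lemma is_derive_continuous (f f' : R -> R) :
  (forall x : R, is_derive x 1 f (f' x)) -> continuous f.
Proof.
move=> df x; apply: differentiable_continuous; apply/derivable1_diffP.
by have [] := df x.
Qed.

Lemma bumpable_continuous f : bumpable f -> continuous f.
Proof. by move=> /bumpable_derive[f' _ df]; exact: is_derive_continuous df. Qed.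

Lemma is_derive_partial1 (phi : R * R -> R) (p : R * R) (d : R) :
  is_derive p.1 1 (fun x => phi (x, p.2)) d <-> is_derive p (basis_vec R 0) phi d.
Proof.
have e : (fun h : R => h^-1 *: ((phi \o shift p) (h *: basis_vec R 0) - phi p)) =
    (fun h : R => h^-1 *: (((fun x => phi (x, p.2)) \o shift p.1) (h *: 1) - phi (p.1, p.2))).
  apply/funext => h; case: p => x y; congr (_ *: (phi _ - _)) => /=.
  by rewrite /basis_vec /=; congr pair; rewrite /= /GRing.scale /= mulr0 add0r.
split=> -[dd <-].
  by split; [rewrite /derivable e|rewrite /derive e].
by split; [rewrite /derivable -e|rewrite /derive -e].
Qed.

Lemma is_derive_partial2 (phi : R * R -> R) (p : R * R) (d : R) :
  is_derive p.2 1 (fun y => phi (p.1, y)) d <-> is_derive p (basis_vec R 1) phi d.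
Proof.
have e : (fun h : R => h^-1 *: ((phi \o shift p) (h *: basis_vec R 1) - phi p)) =
    (fun h : R => h^-1 *: (((fun y => phi (p.1, y)) \o shift p.2) (h *: 1) - phi (p.1, p.2))).
  apply/funext => h; case: p => x y; congr (_ *: (phi _ - _)) => /=.
  by rewrite /basis_vec /=; congr pair; rewrite /= /GRing.scale /= mulr0 add0r.
split=> -[dd <-].
  by split; [rewrite /derivable e|rewrite /derive e].
by split; [rewrite /derivable -e|rewrite /derive -e].
Qed.

Definition tensor (f g : R -> R) : R * R -> R := fun p => f p.1 * g p.2.

Lemma pderiv_tensor0 f g f' : (forall x : R, is_derive x 1 f (f' x)) ->
  forall p, is_derive p (basis_vec R 0) (tensor f g) (tensor f' g p).
Proof.
move=> df p; apply/is_derive_partial1; rewrite /tensor /=.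
have := df p.1 => dfp.
have -> : (fun x => f x * g p.2) = g p.2 *: f.
  by apply/funext => x; rewrite /GRing.scale /= mulrC.
by apply: is_derive_eq; rewrite /GRing.scale /= mulrC.
Qed.

Lemma pderiv_tensor1 f g g' : (forall x : R, is_derive x 1 g (g' x)) ->
  forall p, is_derive p (basis_vec R 1) (tensor f g) (tensor f g' p).
Proof.
move=> df p; apply/is_derive_partial2; rewrite /tensor /=.
have := df p.2 => dfp.
by have := @is_deriveZ R R R g (f p.1) p.2 1 _ dfp.
Qed.

Lemma continuous_tensor f g : continuous f -> continuous g -> continuous (tensor f g).
Proof.
move=> cf cg p; apply: cvgM.
  by apply: (continuous_comp (f := fst) (g := f)); [exact: cvg_fst|exact: cf].
by apply: (continuous_comp (f := snd) (g := g)); [exact: cvg_snd|exact: cg].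
Qed.

Lemma smooth_tensor f g : bumpable f -> bumpable g -> smooth (tensor f g).
Proof.
move=> bf bg s.
have [f1 [g1 [bf1 bg1 ->]]] : exists f1 g1, [/\ bumpable f1, bumpable g1 &
    iter_pderiv s (tensor f g) = tensor f1 g1].
  elim: s => [|i s [f1 [g1 [bf1 bg1 e]]]]; first by exists f, g.
  rewrite /= e; have [->|i1] := eqVneq i 0.
    have [f2 bf2 df] := bumpable_derive bf1; exists f2, g1; split => //.
    by apply/funext => p; have [_] := pderiv_tensor0 g1 df p.
  have [g2 bg2 dg] := bumpable_derive bg1; exists f1, g2; split => //.
  apply/funext => p; have [_] := pderiv_tensor1 f1 dg p.
  by rewrite /pderiv /basis_vec /= (negbTE i1).
split; first by apply: continuous_tensor; exact: bumpable_continuous.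
move=> i p; have [->|i1] := eqVneq i 0.
  have [f2 _ df] := bumpable_derive bf1.
  by have [] := pderiv_tensor0 g1 df p.
have [g2 _ dg] := bumpable_derive bg1.
have [+ _] := pderiv_tensor1 f1 dg p.
by rewrite /basis_vec /= (negbTE i1).
Qed.

(** A bump supported in [[a, b]] that increases to the indicator of the open
    interval as [n] grows. *)
Definition bump (n : nat) (a b x : R) : R :=
  flat n.+1%:R^-1 0 (1 * x + - a) * flat n.+1%:R^-1 0 (-1 * x + b).

Lemma bumpable_bump n a b : bumpable (bump n a b).
Proof. by constructor; constructor; rewrite invr_gt0. Qed.

Lemma flat0_le1 c x : 0 < c -> flat c 0 x <= 1.
Proof.
move=> c0; rewrite /flat; case: ifP => // x0.
by rewrite expr0 mul1r -expR0 ler_expR mulNr oppr_le0 mulr_ge0 ?ltW ?invr_gt0.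
Qed.

Lemma bump_ge0 n a b x : 0 <= bump n a b x.
Proof. by rewrite mulr_ge0 ?flat_ge0. Qed.

Lemma bump_le1 n a b x : bump n a b x <= 1.
Proof. by rewrite mulr_ile1 ?flat_ge0 ?flat0_le1 // invr_gt0. Qed.

Lemma bump_gt0 n a b x : (0 < bump n a b x) = (a < x < b).
Proof.
rewrite /bump mul1r mulN1r [- x + b]addrC.
have [ax|xa] := ltP a x; last by rewrite flat_neg ?mul0r ?ltxx // subr_le0.
have [xb|bx] := ltP x b; last by rewrite [X in _ * X]flat_neg ?mulr0 ?ltxx // subr_le0.
by rewrite mulr_gt0 ?flat_gt0 ?subr_gt0.
Qed.

Lemma bump_eq0 n a b x : ~~ (a < x < b) -> bump n a b x = 0.
Proof.
by rewrite -(bump_gt0 n) -leNgt => h; apply/eqP; rewrite eq_le h bump_ge0.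
Qed.

Lemma bump_cvg a b x : bump n a b x @[n --> \oo] --> (\1_(`]a, b[%classic) x : R).
Proof.
rewrite indicE; have [|nx] := boolP (x \in `]a, b[%classic); last first.
  have h n : bump n a b x = 0.
    by apply: bump_eq0; move: nx; rewrite notin_setE /= in_itv /= => /negP.
  by under eq_fun do rewrite h; exact: cvg_cst.
rewrite inE /= in_itv /= => /andP[ax xb].
have c y : 0 < y -> flat n.+1%:R^-1 0 y @[n --> \oo] --> (1 : R).
  move=> y0; rewrite /flat y0.
  under eq_fun do rewrite expr0 mul1r.
  have h : (- n.+1%:R^-1 * y^-1) @[n --> \oo] --> (0 : R).
    rewrite -[X in _ --> X](mul0r y^-1) -[X in X * _]oppr0.
    by apply: cvgM; [apply: cvgN; exact: cvg_harmonic|exact: cvg_cst].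
  have := (@cvg_comp _ _ _ (fun n : nat => - n.+1%:R^-1 * y^-1) (@expR R) \oo (nbhs (0 : R)) (nbhs (expR (0 : R))) h (@continuous_expR R 0)).
  by rewrite expR0.
rewrite /bump -[X in _ --> X](mulr1 1); apply: cvgM; apply: c.
  by rewrite mul1r subr_gt0.
by rewrite mulN1r addrC subr_gt0.
Qed.

Lemma closed_rect (a b c d : R) : closed (`[a, b]%classic `*` `[c, d]%classic).
Proof.
apply: compact_closed; first exact: norm_hausdorff.
by apply: compact_setX; exact: segment_compact.
Qed.

Lemma test_function_bump (Om : set (R * R)) n m a b c d :
  `[a, b]%classic `*` `[c, d]%classic `<=` Om ->
  test_function Om (tensor (bump n a b) (bump m c d)).
Proof.
move=> abcd; have supp : support_of (tensor (bump n a b) (bump m c d)) `<=`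
    `[a, b]%classic `*` `[c, d]%classic.
  rewrite /support_of closureE => p; apply; split; first exact: closed_rect.
  move=> q /=; rewrite /tensor => h; split => /=; rewrite in_itv /=; apply: contra_neqT h.
    by move=> h; rewrite bump_eq0 ?mul0r //; apply: contra h => /andP[/ltW -> /ltW].
  by move=> h; rewrite mulrC bump_eq0 ?mul0r //; apply: contra h => /andP[/ltW -> /ltW].
split; first by apply: smooth_tensor; exact: bumpable_bump.
  apply: (subclosed_compact _ _ supp); first exact: closed_closure.
  by apply: compact_setX; exact: segment_compact.
exact: subset_trans supp abcd.
Qed.

End Bumps.

(** * The fundamental lemma of the calculus of variations *)
Section Variations.
Variable R : realType.
Local Notation P := (measurableTypeR R * measurableTypeR R)%type.
Local Notation mu := (leb2 R).

Lemma RintegralE (D : set P) (w : P -> R) : measurable D ->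
  mu.-integrable D (EFin \o w) ->
  (\int[mu]_(p in D) (w p)%:E = (\int[mu]_(p in D) w p)%:E)%E.
Proof. by move=> mD wi; rewrite /Rintegral fineK //; exact: integrable_fin_num. Qed.

(** The sets over whose preimages the integral of [w] vanishes form a Dynkin
    system. *)
Lemma dynkin_vanishing d (T : measurableType d) (pi : P -> T) (G : set (set T))
    (D : set P) (w : P -> R) :
  d.-measurable = <<s G >> -> setI_closed G ->
  measurable_fun setT pi -> measurable D -> mu.-integrable D (EFin \o w) ->
  \int[mu]_(p in D) w p = 0 ->
  (forall A, G A -> \int[mu]_(p in D `&` pi @^-1` A) w p = 0) ->
  forall E, measurable E -> \int[mu]_(p in D `&` pi @^-1` E) w p = 0.
Proof.
move=> mG GI mpi mD wi D0 G0 E mE.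
have mpre S : measurable S -> measurable (D `&` pi @^-1` S).
  by move=> mS; apply: measurableI => //; rewrite -[X in measurable X]setTI; exact: mpi.
have wiS S : measurable S -> mu.-integrable (D `&` pi @^-1` S) (EFin \o w).
  by move=> mS; apply: integrableS wi => //; exact: mpre.
apply: (@dynkin_induction _ T G [set S | \int[mu]_(p in D `&` pi @^-1` S) w p = 0]) => //.
- by rewrite /= preimage_setT setIT.
- move=> S mS /= S0.
  have DE : D = (D `&` pi @^-1` S) `|` (D `&` pi @^-1` (~` S)).
    by rewrite -setIUr -preimage_setU setUCr preimage_setT setIT.
  have := D0; rewrite {1}DE Rintegral_setU.
  + by rewrite S0 add0r.
  + exact: mpre.
  + by apply: mpre; exact: measurableC.
  + by rewrite -DE.
  + by apply/disj_setPS => p [[_ /= pS] [_ /=]].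
- move=> F mF tF F0 /=.
  rewrite /Rintegral preimage_bigcup setI_bigcupr integral_bigcup.
  + rewrite eseries0 // => i _ _.
    by rewrite RintegralE ?F0 //; [exact: mpre|exact: wiS].
  + apply/trivIsetP => i j _ _ ij; rewrite setIACA setIid -preimage_setI.
    by move/trivIsetP : tF => /(_ i j I I ij) ->; rewrite preimage_set0 setI0.
  + by move=> i; exact: mpre.
  + rewrite -setI_bigcupr -preimage_bigcup; apply: wiS.
    by apply: bigcupT_measurable.
- by rewrite -mG.
Qed.

Lemma dynkin_coordinate (pi : P -> measurableTypeR R) (D : set P) (w : P -> R) :
  measurable_fun setT pi -> measurable D -> mu.-integrable D (EFin \o w) ->
  \int[mu]_(p in D) w p = 0 ->
  (forall a b, \int[mu]_(p in D `&` pi @^-1` `]a, b[%classic) w p = 0) ->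
  forall E, measurable E -> \int[mu]_(p in D `&` pi @^-1` E) w p = 0.
Proof.
move=> mpi mD wi D0 oo; apply: (@dynkin_vanishing _ _ pi (@RGenOpens.G R)) => //.
- exact: RGenOpens.measurableE.
- move=> _ _ [a [b ->]] [c [d ->]]; exists (Num.max a c), (Num.min b d).
  apply/seteqP; split => x /=; rewrite !in_itv /= gt_max lt_min.
    by move=> [/andP[-> ->] /andP[-> ->]].
  by move=> /andP[/andP[-> ->] /andP[-> ->]].
- by move=> _ [a [b ->]]; exact: oo.
Qed.

Lemma measurable_itv_rect (i j : interval R) :
  measurable ([set` i] `*` [set` j] : set P).
Proof. by apply: measurableX; exact: measurable_itv. Qed.

Lemma ae_zero_rect (a b c d : R) (w : P -> R) :
  mu.-integrable setT (EFin \o w) ->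
  (forall a' b' c' d', a <= a' -> b' <= b -> c <= c' -> d' <= d ->
    \int[mu]_(p in (`]a', b'[ : set R) `*` (`]c', d'[ : set R)) w p = 0) ->
  {ae mu, forall p, (a < p.1 < b) -> (c < p.2 < d) -> w p = 0}.
Proof.
move=> wi h; set Q := (`]a, b[ : set R) `*` (`]c, d[ : set R).
have mQ : measurable (Q : set P) by exact: measurable_itv_rect.
have wiQ : mu.-integrable Q (EFin \o w) by exact: integrableS wi.
have Q0 : \int[mu]_(p in Q) w p = 0 by exact: h.
have mfst : measurable_fun setT (fst : P -> measurableTypeR R) by exact: measurable_fst.
have msnd : measurable_fun setT (snd : P -> measurableTypeR R) by exact: measurable_snd.
have step1 a' b' (E : set (measurableTypeR R)) : measurable E ->
    \int[mu]_(p in (Q `&` fst @^-1` `]a', b'[%classic) `&` snd @^-1` E) w p = 0.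
  move=> mE; apply: dynkin_coordinate => //.
  - by apply: measurableI => //; rewrite -[X in measurable X]setTI; exact: mfst.
  - apply: integrableS wiQ => //.
    by apply: measurableI => //; rewrite -[X in measurable X]setTI; exact: mfst.
  - rewrite (_ : _ `&` _ = (`](Num.max a a'), (Num.min b b')[ : set R) `*` (`]c, d[ : set R)).
      by apply: h; rewrite ?le_max ?ge_min ?lexx.
    apply/seteqP; split => p; rewrite /Q /= !in_itv /= gt_max lt_min.
      by move=> [[/andP[-> ->] ->] /andP[-> ->]].
    by move=> [/andP[/andP[-> ->] /andP[-> ->]] ->].
  - move=> c' d'; rewrite (_ : _ `&` _ `&` _ =
      (`](Num.max a a'), (Num.min b b')[ : set R) `*` (`](Num.max c c'), (Num.min d d')[ : set R)).
      by apply: h; rewrite ?le_max ?ge_min ?lexx.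
    apply/seteqP; split => p; rewrite /Q /= !in_itv /= !gt_max !lt_min.
      by move=> [[[/andP[-> ->] /andP[-> ->]] /andP[-> ->]] /andP[-> ->]].
    by move=> [/andP[/andP[-> ->] /andP[-> ->]] /andP[/andP[-> ->] /andP[-> ->]]].
have step2 (E F : set (measurableTypeR R)) : measurable E -> measurable F ->
    \int[mu]_(p in Q `&` (E `*` F)) w p = 0.
  move=> mE mF; rewrite (_ : Q `&` (E `*` F) = (Q `&` snd @^-1` F) `&` fst @^-1` E); last first.
    by apply/seteqP; split => p /=; [move=> [? []]|move=> [[]]].
  have mQF : measurable (Q `&` snd @^-1` F : set P).
    by apply: measurableI => //; rewrite -[X in measurable X]setTI; exact: msnd.
  apply: dynkin_coordinate => //.
  - exact: integrableS wiQ.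
  - have := step1 a b F mF; congr (_ = _); congr Rintegral; apply/seteqP; split => p /=.
      by move=> [[? ?] ?].
    by move=> [[/= ? ?] ?].
  - move=> a' b'; have := step1 a' b' F mF; congr (_ = _); congr Rintegral.
    by rewrite setIAC.
have step3 (E : set P) : measurable E -> \int[mu]_(p in Q `&` E) w p = 0.
  apply: (@dynkin_vanishing _ P id [set A `*` B | A in measurable & B in measurable]) => //.
  - exact: measurable_prod_measurableType.
  - move=> _ _ [A mA [B mB <-]] [C mC [D mD <-]]; exists (A `&` C); first exact: measurableI.
    by exists (B `&` D); [exact: measurableI|rewrite setXI].
  - by move=> _ [A mA [B mB <-]]; exact: step2.
have : ae_eq mu Q (EFin \o w) (cst 0%E).
  apply: integral_ae_eq => // E EQ mE; rewrite integral0.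
  have wE : mu.-integrable E (EFin \o w) by apply: integrableS wi.
  by have := step3 _ mE; rewrite (setIidr EQ) RintegralE // => ->.
apply: filterS => p /= h1 h2 h3.
by have : (w p)%:E = 0%E; [apply: h1; split; rewrite /= in_itv|case].
Qed.

Lemma integrable_mulr_bounded (w f : P -> R) (K : R) :
  mu.-integrable setT (EFin \o w) -> measurable_fun setT f ->
  (forall p, `|f p| <= K) -> mu.-integrable setT (EFin \o (fun p => w p * f p)).
Proof.
move=> wi mf fK; have /integrableP[/measurable_EFinP mw _] := wi.
apply: (@le_integrable _ _ _ _ _ measurableT _ (fun p => K%:E * (EFin \o w) p)%E).
- by apply/measurable_EFinP; exact: measurable_funM.
- move=> p _ /=; rewrite lee_fin normrM [leRHS]normrM mulrC ler_wpM2r //.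
  by apply: le_trans (fK p) _; exact: ler_norm.
- exact: integrableZl.
Qed.

Lemma measurable_tensor (f g : R -> R) : continuous f -> continuous g ->
  measurable_fun setT (tensor f g : P -> measurableTypeR R).
Proof.
move=> cf cg; apply: measurable_funM.
  by apply: (measurableT_comp (continuous_measurable_fun cf)); exact: measurable_fst.
by apply: (measurableT_comp (continuous_measurable_fun cg)); exact: measurable_snd.
Qed.

Lemma tensor_bump_le1 n m (a b c d : R) p : `|tensor (bump n a b) (bump m c d) p| <= 1.
Proof.
rewrite /tensor ger0_norm; last by rewrite mulr_ge0 ?bump_ge0.
by apply: mulr_ile1; rewrite ?bump_ge0 ?bump_le1.
Qed.

Lemma integral_rect_bump (a b c d : R) (w : P -> R) :
  mu.-integrable setT (EFin \o w) ->
  (forall n, \int[mu]_p (w p * tensor (bump n a b) (bump n c d) p) = 0) ->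
  \int[mu]_(p in (`]a, b[ : set R) `*` (`]c, d[ : set R)) w p = 0.
Proof.
move=> wi h; set Q := (X in Rintegral _ X _).
have mQ : measurable (Q : set P) by exact: measurable_itv_rect.
have /integrableP[/measurable_EFinP mw _] := wi.
have mt n : measurable_fun setT (tensor (bump n a b) (bump n c d) : P -> measurableTypeR R).
  by apply: measurable_tensor; apply: bumpable_continuous; exact: bumpable_bump.
pose f_ n (p : P) := (w p * tensor (bump n a b) (bump n c d) p)%:E.
pose f (p : P) := (w p * \1_Q p)%:E.
have [] := @dominated_convergence _ P R mu setT measurableT f_ f (fun p => `|w p|%:E).
- by move=> n; apply/measurable_EFinP; exact: (measurable_funM mw (mt n)).
- by apply/measurable_EFinP; apply: measurable_funM => //; exact: measurable_indic.
- apply: aeW => p _; apply/fine_cvgP; split; first exact: nearW.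
  apply: cvgM; first exact: cvg_cst.
  have -> : (\1_Q p : R) = \1_(`]a, b[%classic) p.1 * \1_(`]c, d[%classic) p.2.
    rewrite !indicE /Q in_setX; case: (_ \in _); case: (_ \in _); rewrite /=;
    by rewrite ?mulr1 ?mulr0.
  by apply: cvgM; exact: bump_cvg.
- by have := integrable_abse wi.
- apply: aeW => p n _ /=; rewrite lee_fin normrM ler_piMr //.
  by have := tensor_bump_le1 n n a b c d p.
move=> fi _; have -> : (fun n => \int[mu]_p f_ n p)%E = cst 0%E.
  apply/funext => n; rewrite /f_ RintegralE ?h //.
  apply: (@integrable_mulr_bounded _ _ 1) => //; first exact: mt.
  by move=> p; have := tensor_bump_le1 n n a b c d p.
move=> /cvg_lim; rewrite lim_cst // => /(_ (@ereal_hausdorff _)) f0.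
rewrite /Rintegral; suff -> : (\int[mu]_(p in Q) (w p)%:E = 0)%E by [].
rewrite [RHS]f0 [LHS]integral_mkcond; apply: eq_integral => p _; rewrite /f patchE indicE.
by case: ifPn => pQ; rewrite ?mulr1 ?mulr0.
Qed.

Lemma between_near (x y e r1 r2 : R) :
  x - e < r1 -> r2 < x + e -> r1 <= y -> y <= r2 -> `|x - y| < e.
Proof. by move=> *; rewrite ltr_norml; apply/andP; split; lra. Qed.

(** Rational rectangles, so that countably many of them exhaust an open set. *)
Let rat4 := ((rat * rat) * (rat * rat))%type.
Let open_rect (r : rat4) : set (R * R) :=
  `]ratr r.1.1, ratr r.1.2[%classic `*` `]ratr r.2.1, ratr r.2.2[%classic.
Let closed_rect (r : rat4) : set (R * R) :=
  `[ratr r.1.1, ratr r.1.2]%classic `*` `[ratr r.2.1, ratr r.2.2]%classic.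

Lemma open_rational_rect (U : set (R * R)) p : open U -> U p ->
  exists r : rat4, open_rect r p /\ closed_rect r `<=` U.
Proof.
move=> oU Up; have /nbhs_ballP[e /= e0 eU] := open_nbhs_nbhs (conj oU Up).
have lt1 x : x - e < x by rewrite ltrBlDr ltrDl.
have lt2 x : x < x + e by rewrite ltrDl.
have [r1] := rat_in_itvoo (lt1 p.1); rewrite in_itv /= => /andP[a1 b1].
have [r2] := rat_in_itvoo (lt2 p.1); rewrite in_itv /= => /andP[a2 b2].
have [r3] := rat_in_itvoo (lt1 p.2); rewrite in_itv /= => /andP[a3 b3].
have [r4] := rat_in_itvoo (lt2 p.2); rewrite in_itv /= => /andP[a4 b4].
exists ((r1, r2), (r3, r4)); split.
  by split; rewrite /= in_itv /= ?b1 ?b3.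
move=> q [/= ]; rewrite !in_itv /= => /andP[q1 q2] /andP[q3 q4]; apply: eU.
by split; [exact: between_near a1 b2 q1 q2|exact: between_near a3 b4 q3 q4].
Qed.

Lemma open_ae_rect (U : set (R * R)) (Q : P -> Prop) : open U ->
  (forall a b c d : R, `[a, b]%classic `*` `[c, d]%classic `<=` U ->
     {ae mu, forall p, (a < p.1 < b) -> (c < p.2 < d) -> Q p}) ->
  {ae mu, forall p, U p -> Q p}.
Proof.
move=> oU h.
pose S (r : rat4) (p : P) : Prop := closed_rect r `<=` U -> open_rect r p -> Q p.
have hS r : {ae mu, forall p, S r p}.
  have [rU|nrU] := pselect (closed_rect r `<=` U); last by apply: aeW => p /nrU.
  apply: (negligibleS _ (h _ _ _ _ rU)) => p /= nS hp; apply: nS => _ [] /=.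
  by rewrite !in_itv; exact: hp.
have : {ae mu, forall p, forall n, if unpickle n is Some r then S r p else True}.
  apply: ae_foralln => n; case: (unpickle n) => [r|]; first exact: hS.
  exact: aeW.
apply: filterS => p Sp Up; have [r [rp rU]] := open_rational_rect oU Up.
by have := Sp (pickle r); rewrite pickleK; exact.
Qed.

Lemma open_measurable_plane (U : set (R * R)) : open U -> measurable (U : set P).
Proof.
move=> oU; pose F n : set P := if unpickle n is Some r then
  (if `[< open_rect r `<=` U >] then open_rect r else set0) else set0.
have -> : (U : set P) = \bigcup_n F n.
  apply/seteqP; split => [p Up|p [n _]]; last first.
    by rewrite /F; case: (unpickle n) => // r; case: asboolP => // rU /rU.
  have [r [rp rU]] := open_rational_rect oU Up.
  exists (pickle r); [by []|rewrite /F pickleK].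
  case: asboolP => // -[] q [/= ]; rewrite !in_itv /= => /andP[q1 q2] /andP[q3 q4].
  by apply: rU; split; rewrite /= in_itv /= ?(ltW q1) ?(ltW q2) ?(ltW q3) ?(ltW q4).
apply: bigcupT_measurable => n; rewrite /F; case: (unpickle n) => // r.
by case: ifP => // _; exact: measurable_itv_rect.
Qed.

(** On a rectangle inside [U], the bumps turn the hypothesis into the vanishing
    of the integrals of [w] over all smaller rectangles. *)
Theorem fundamental_lemma (U : set (R * R)) (w : P -> R) : open U ->
  mu.-integrable setT (EFin \o w) ->
  (forall n a b c d, `[a, b]%classic `*` `[c, d]%classic `<=` U ->
     \int[mu]_p (w p * tensor (bump n a b) (bump n c d) p) = 0) ->
  {ae mu, forall p, U p -> w p = 0}.
Proof.
move=> oU wi h; apply: open_ae_rect => // a b c d abcd.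
apply: ae_zero_rect => // a' b' c' d' aa' bb' cc' dd'.
apply: integral_rect_bump => // n; apply: h => q [/= q1 q2]; apply: abcd.
move: q1 q2; rewrite !in_itv /= => /andP[q1 q2] /andP[q3 q4].
by split; rewrite /= in_itv /=; apply/andP; split; lra.
Qed.

End Variations.

(** * Square integrable functions on plane domains *)
Section PlaneSets.
Variable R : realType.
Local Notation P := (measurableTypeR R * measurableTypeR R)%type.
Local Notation mu := (leb2 R).

Lemma bounded_rect (U : set (R * R)) : bounded_set U ->
  exists2 M, 0 < M & forall p, U p -> `|p.1| <= M /\ `|p.2| <= M.
Proof.
move=> [M [_ hM]]; exists (`|M| + 1); first by rewrite ltr_wpDl.
move=> p Up; have := hM (`|M| + 1) _ p Up; rewrite /= prod_normE ge_max => /(_ _)/andP.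
by apply; apply: le_lt_trans (ler_norm M) _; rewrite ltrDl.
Qed.

Lemma rect_bounded (U : set (R * R)) M : (forall p, U p -> `|p.1| <= M /\ `|p.2| <= M) ->
  bounded_set U.
Proof.
move=> h; exists M; split; first by rewrite num_real.
move=> N MN p /h[h1 h2]; rewrite /= prod_normE ge_max.
by rewrite !(le_trans _ (ltW MN)).
Qed.

Lemma bounded_finite_measure (U : set (R * R)) : bounded_set U ->
  measurable (U : set P) -> (mu U < +oo)%E.
Proof.
move=> /bounded_rect[M M0 hM] mU.
pose Q : set P := `[- M, M]%classic `*` `[- M, M]%classic.
have mQ : measurable Q by exact: measurable_itv_rect.
apply: (@le_lt_trans _ _ (mu Q)).
  apply: le_measure; rewrite ?inE // => p /hM[h1 h2].
  by split; rewrite /= in_itv /= -ler_norml.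
rewrite /Q product_measure1E //.
by rewrite /= lebesgue_measure_itv /=; case: ifP => _; rewrite ?mul0e ?ltry // -EFinB -EFinM ltry.
Qed.

End PlaneSets.

Section L2.
Variable R : realType.
Local Notation P := (measurableTypeR R * measurableTypeR R)%type.
Local Notation mu := (leb2 R).
Variable D : set (R * R).
Hypotheses (mD : measurable (D : set P)) (finD : (mu D < +oo)%E).
Implicit Types u v : R * R -> R.

Lemma integrable_cst (c : R) : mu.-integrable D (EFin \o (fun=> c) : P -> \bar R).
Proof.
apply/integrableP; split; first exact/measurable_EFinP.
by rewrite (integral_cst mu mD `|c|%:E) /= lte_mul_pinfty.
Qed.

Lemma L2_mul u v : in_L2 D u -> in_L2 D v ->
  mu.-integrable D (EFin \o (fun p => u p * v p) : P -> \bar R).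
Proof.
move=> [mu_ iu] [mv iv].
apply: (@le_integrable _ _ _ _ _ mD _ (fun p : P => (u p ^+ 2)%:E + (v p ^+ 2)%:E)%E).
- by apply/measurable_EFinP; exact: measurable_funM.
- move=> p _ /=; rewrite lee_fin normrM [leRHS]ger0_norm ?addr_ge0 ?sqr_ge0 //.
  rewrite -(real_normK (num_real (u p))) -(real_normK (num_real (v p))).
  by move: (normr_ge0 (u p)) (normr_ge0 (v p)); set x := `|u p|; set y := `|v p|; nra.
- exact: integrableD.
Qed.

Lemma L2_cst (c : R) : in_L2 D (fun=> c).
Proof. by split; [exact: measurable_cst|exact: integrable_cst]. Qed.

Lemma L2_integrable u : in_L2 D u -> mu.-integrable D (EFin \o u : P -> \bar R).
Proof.
move=> hu; have := L2_mul hu (L2_cst 1).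
by apply: eq_integrable => // p _ /=; rewrite mulr1.
Qed.

Lemma L2_lin (c : R) u v : in_L2 D u -> in_L2 D v -> in_L2 D (fun p => c * u p + v p).
Proof.
move=> hu hv; have [mu_ iu] := hu; have [mv iv] := hv.
have m : measurable_fun (D : set P) (fun p => c * u p + v p).
  by apply: measurable_funD => //; apply: measurable_funM => //; exact: measurable_cst.
split => //.
apply: (@le_integrable _ _ _ _ _ mD _
  (fun p : P => ((2 * c ^+ 2)%:E * (u p ^+ 2)%:E + 2%:E * (v p ^+ 2)%:E))%E).
- by apply/measurable_EFinP; exact: measurable_funX.
- move=> p _ /=; rewrite lee_fin [leRHS]ger0_norm; last first.
    by move: (sqr_ge0 c) (sqr_ge0 (u p)) (sqr_ge0 (v p)); nra.
  rewrite ger0_norm ?sqr_ge0 //; have := sqr_ge0 (c * u p - v p).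
  by move: (u p) (v p) => x y; nra.
- by apply: integrableD => //; apply: integrableZl.
Qed.

Definition dot u v : R := \int[mu]_(p in D) (u p * v p).

Lemma dotC u v : dot u v = dot v u.
Proof. by apply: eq_Rintegral => p _; rewrite mulrC. Qed.

Lemma dot_lin c u v w : in_L2 D u -> in_L2 D v -> in_L2 D w ->
  dot (fun p => c * u p + v p) w = c * dot u w + dot v w.
Proof.
move=> hu hv hw; rewrite /dot.
have -> : \int[mu]_(p in D) ((c * u p + v p) * w p) =
    \int[mu]_(p in D) (c * (u p * w p) + v p * w p).
  by apply: eq_Rintegral => p _; rewrite mulrDl mulrA.
rewrite RintegralD //.
- by rewrite RintegralZl //; exact: L2_mul.
- have := integrableZl mD c (L2_mul hu hw).
  by apply: eq_integrable => // p _ /=; rewrite EFinM.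
- exact: L2_mul.
Qed.

Lemma dot_ge0 u : 0 <= dot u u.
Proof. by apply: Rintegral_ge0 => p _; rewrite -expr2 sqr_ge0. Qed.

Lemma RintegralE_D (w : R * R -> R) : mu.-integrable D (EFin \o w : P -> \bar R) ->
  (\int[mu]_(p in D) (w p)%:E = (\int[mu]_(p in D) w p)%:E)%E.
Proof. exact: RintegralE. Qed.

Lemma dot_eq0 u : in_L2 D u -> (dot u u = 0 <-> ae_zero D u).
Proof.
move=> hu; have [mu_ iu] := hu.
have e : (\int[mu]_(p in D) `|(u p ^+ 2)%:E| = (dot u u)%:E)%E.
  rewrite -RintegralE_D; last exact: L2_mul.
  by apply: eq_integral => p _; rewrite /= ger0_norm ?sqr_ge0 // expr2.
have mf : measurable_fun (D : set P) (fun p => (u p ^+ 2)%:E).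
  by apply/measurable_EFinP; exact: measurable_funX.
have [h1 h2] := ae_eq_integral_abs mu mD mf.
split => [u0|u0].
  have : ae_eq mu D (fun p => (u p ^+ 2)%:E) (cst 0%E) by apply: h1; rewrite e u0.
  by apply: filterS => p h Dp; have [/eqP] := h Dp; rewrite sqrf_eq0 => /eqP.
have : (dot u u)%:E = 0%E.
  rewrite -e h2 //; apply: (negligibleS _ u0) => p /= nS h0; apply: nS => Dp.
  by rewrite (h0 Dp) expr0n.
by case.
Qed.

Lemma dot_cst1 u : dot u (fun=> 1) = \int[mu]_(p in D) u p.
Proof. by apply: eq_Rintegral => p _; rewrite mulr1. Qed.

Lemma cauchy_schwarz u v : in_L2 D u -> in_L2 D v ->
  dot u v ^+ 2 <= dot v v * dot u u.
Proof.
move=> hu hv; have key t : 0 <= dot u u - 2 * t * dot u v + t ^+ 2 * dot v v.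
  have hw := L2_lin (- t) hv hu.
  have := dot_ge0 (fun p => - t * v p + u p).
  rewrite (dot_lin (- t) hv hu hw) (dotC v) (dotC u (fun p => _ + _)).
  rewrite (dot_lin (- t) hv hu hv) (dot_lin (- t) hv hu hu) (dotC v u).
  by congr (_ <= _); ring.
move: (dot u u) (dot u v) (dot v v) key (dot_ge0 u) (dot_ge0 v) => a b c key a0 c0.
have [c1|c1] := ltrP 0 c.
  by have := key (b / c); rewrite (_ : _ + _ = a - b ^+ 2 / c);
    [rewrite subr_ge0 ler_pdivrMr // mulrC|field; rewrite gt_eqF].
have c2 : c = 0 by lra.
have [->|b0] := eqVneq b 0; first by rewrite expr0n mulr_ge0.
have := key ((a + 1) / (2 * b)); rewrite c2 (_ : _ + _ = - 1); last by field.
by rewrite oppr_ge0 ler10.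
Qed.

Lemma cauchy_schwarz_cst u : in_L2 D u ->
  (\int[mu]_(p in D) u p) ^+ 2 <= fine (mu D) * dot u u.
Proof.
move=> hu; have := cauchy_schwarz hu (L2_cst 1); rewrite !dot_cst1 Rintegral_cst //.
by rewrite mul1r.
Qed.

Lemma L2_bounded u (K : R) : measurable_fun (D : set P) u -> (forall p, `|u p| <= K) ->
  in_L2 D u.
Proof.
move=> m hK; split => //; apply: (le_integrable mD _ _ (integrable_cst (K ^+ 2))).
  exact/measurable_EFinP/measurable_funX.
move=> p _ /=; rewrite lee_fin !ger0_norm ?sqr_ge0 //.
rewrite -(real_normK (num_real (u p))) lerXn2r ?nnegrE //.
exact: le_trans (hK p).
Qed.

End L2.

Section Fubini.
Context d1 d2 (T1 : measurableType d1) (T2 : measurableType d2) (R : realType).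
Variables (m1 : {sigma_finite_measure set T1 -> \bar R})
  (m2 : {sigma_finite_measure set T2 -> \bar R}).

Lemma integrable_fine (m : {measure set T1 -> \bar R}) (f : T1 -> \bar R) :
  m.-integrable setT f -> m.-integrable setT (EFin \o (fine \o f)).
Proof.
move=> fi; have /integrableP[mf _] := fi.
apply: le_integrable fi => //.
  by apply/measurable_EFinP; apply: measurableT_comp mf; exact: fine_measurable.
by move=> x _ /=; case: (f x) => //= ; rewrite normr0 leey.
Qed.

Lemma Rintegral_fine (m : {measure set T1 -> \bar R}) (f : T1 -> \bar R) :
  m.-integrable setT f -> \int[m]_x fine (f x) = fine (\int[m]_x f x)%E.
Proof.
move=> fi; rewrite /Rintegral; congr fine; apply: ae_eq_integral => //.
- by have /integrableP[mf _] := integrable_fine fi.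
- by have /integrableP[mf _] := fi.
have := integrable_ae measurableT fi.
by apply: filterS => x fx _; rewrite /= fineK //; exact: fx.
Qed.
End Fubini.

Section Fubini2.
Context d1 d2 (T1 : measurableType d1) (T2 : measurableType d2) (R : realType).
Variables (m1 : {sigma_finite_measure set T1 -> \bar R})
  (m2 : {sigma_finite_measure set T2 -> \bar R}).

Lemma Rfubini (f : T1 -> T2 -> R) :
  (m1 \x m2)%E.-integrable setT (fun z => (f z.1 z.2)%:E) ->
  [/\ m1.-integrable setT (EFin \o (fun x => \int[m2]_y f x y)),
      m2.-integrable setT (EFin \o (fun y => \int[m1]_x f x y)) &
      \int[m1]_x \int[m2]_y f x y = \int[m2]_y \int[m1]_x f x y].
Proof.
move=> fi.
have i1 := integrable_fubini_F fi.
have /integrableP[mf _] := fi.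
have i2 : m2.-integrable setT (fubini_G m1 (fun z => (f z.1 z.2)%:E)).
  apply/integrableP; split; first exact: (measurable_fubini_G fi).
  have h := (integrable21ltyP m1 m2 mf).1 fi; apply: (le_lt_trans _ h); apply: ge0_le_integral => //.
  - by apply: measurableT_comp => //; exact: (measurable_fubini_G fi).
  - have := @measurable_fun_fubini_tonelli_G _ _ _ _ _ m1 (fun z : T1 * T2 => `|(f z.1 z.2)%:E|%E).
    by apply => //; exact: measurableT_comp mf.
  - move=> y _; apply: le_abse_integral => //.
    exact: (measurableT_comp mf (measurable_pair2 y)).
split; [exact: integrable_fine i1|exact: integrable_fine i2|].
transitivity (fine (\int[m1]_x fubini_F m2 (fun z => (f z.1 z.2)%:E) x)%E).
  by rewrite -Rintegral_fine.
transitivity (fine (\int[m2]_y fubini_G m1 (fun z => (f z.1 z.2)%:E) y)%E).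
  by rewrite integral12_prod_meas1 // integral21_prod_meas1.
by rewrite -Rintegral_fine.
Qed.

Lemma tonelli_swap (f : T1 -> T2 -> \bar R) :
  measurable_fun setT (fun z : T1 * T2 => f z.1 z.2) ->
  (forall x y, (0 <= f x y)%E) ->
  (\int[m1]_x \int[m2]_y f x y = \int[m2]_y \int[m1]_x f x y)%E.
Proof.
by move=> mf f0; exact: (@fubini_tonelli _ _ _ _ _ m1 m2 (fun z => f z.1 z.2)).
Qed.

Lemma integrable_prod_tonelli (f : T1 -> T2 -> R) (C : R) (A : set T2) :
  measurable A -> (m2 A < +oo)%E ->
  measurable_fun setT (fun z : T1 * T2 => f z.1 z.2) ->
  (forall x y, ~ A y -> f x y = 0) ->
  (forall y, A y -> (\int[m1]_x `|f x y|%:E <= C%:E)%E) ->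
  (m1 \x m2)%E.-integrable setT (fun z => (f z.1 z.2)%:E).
Proof.
move=> mA Afin mf f0 fC.
have mf' : measurable_fun setT (fun z : T1 * T2 => (f z.1 z.2)%:E) by exact/measurable_EFinP.
apply/integrable21ltyP => //=.
apply: (@le_lt_trans _ _ (\int[m2]_y (`|C| * \1_A y)%:E)%E).
  apply: ge0_le_integral => //.
  - by move=> y _; apply: integral_ge0.
  - have := @measurable_fun_fubini_tonelli_G _ _ _ _ _ m1 (fun z : T1 * T2 => `|f z.1 z.2|%:E).
    apply => //; apply/measurable_EFinP; exact: measurableT_comp mf.
  - by apply/measurable_EFinP; apply: measurable_funM => //; exact: measurable_indic.
  - move=> y _; rewrite indicE; case: (boolP (y \in A)) => yA.
      rewrite mulr1; apply: le_trans (fC y _) _; first by rewrite inE in yA.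
      by rewrite lee_fin ler_norm.
    rewrite mulr0 integral0_eq // => x _; rewrite f0 ?normr0 //.
    by move: yA; rewrite notin_setE.
under eq_integral do rewrite EFinM.
rewrite ge0_integralZl //; last by apply/measurable_EFinP; exact: measurable_indic.
by rewrite integral_indic // setIT lte_mul_pinfty.
Qed.

End Fubini2.

(** * Increments of Sobolev functions along segments *)
Section Segments.
Variable R : realType.
Local Notation P := (measurableTypeR R * measurableTypeR R)%type.
Local Notation mu := (leb2 R).
Local Notation leb := (@lebesgue_measure R).

Definition translate (h : R * R) (t : R) (p : R * R) : R * R :=
  (p.1 + t * h.1, p.2 + t * h.2).

Definition segment_closed (U : set (R * R)) : Prop := forall p q t,
  U p -> U q -> 0 <= t -> t <= 1 -> U (p.1 + t * (q.1 - p.1), p.2 + t * (q.2 - p.2)).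

Lemma convex_setP (U : set (R * R)) :
  @convex_set R (R * R)%type U <-> segment_closed U.
Proof.
split => [cU p q t Up Uq t0 t1|cU p q t].
  have := @cU q p (Itv01 t0 t1); rewrite !inE => /(_ Uq Up).
  congr (U _); rewrite /conv /=.
  by congr pair; rewrite /= /GRing.scale /= /unstable.onem; ring.
move=> /set_mem Up /set_mem Uq; apply/mem_set.
have h := cU q p t%:num Uq Up (ge0 t) (le1 t).
suff -> : conv t p q = (q.1 + t%:num * (p.1 - q.1), q.2 + t%:num * (p.2 - q.2)) by exact: h.
rewrite /conv /=; case: (p) => p1 p2; case: (q) => q1 q2.
by congr pair; rewrite /= /GRing.scale /= /unstable.onem; ring.
Qed.

Lemma segment_closed_translate U h p t : segment_closed U -> U p -> U (translate h 1 p) ->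
  0 <= t -> t <= 1 -> U (translate h t p).
Proof.
move=> cU Up Uq t0 t1; have := cU _ _ _ Up Uq t0 t1.
by congr (U _); rewrite /translate /=; congr pair; ring.
Qed.

Lemma scales_area_translate h t : @scales_area R (translate h t) 1.
Proof.
have := @scales_area_diag R 1 1 (t * h.1) (t * h.2) (oner_neq0 _) (oner_neq0 _).
rewrite mulr1 normr1 invr1; congr (scales_area _ _).
by apply/funext => p; rewrite /translate !mul1r.
Qed.

Lemma integral_translate h t (f : P -> R) : mu.-integrable setT (EFin \o f) ->
  \int[mu]_p f (translate h t p) = \int[mu]_p f p.
Proof.
by move=> fi; rewrite (integral_scales (scales_area_translate h t)) // mul1r.
Qed.

Lemma measurable_translate h :
  measurable_fun setT ((fun z : P * measurableTypeR R => translate h z.2 z.1) :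
    P * measurableTypeR R -> P).
Proof.
apply/measurable_fun_pairP; split; apply: measurable_funD.
- exact: (measurableT_comp measurable_fst measurable_fst).
- by apply: measurable_funM; [exact: measurable_snd|exact: measurable_cst].
- exact: (measurableT_comp measurable_snd measurable_fst).
- by apply: measurable_funM; [exact: measurable_snd|exact: measurable_cst].
Qed.

Definition unit_itv : set (measurableTypeR R) := `[(0 : R), 1]%classic.

Lemma measurable_unit : measurable unit_itv. Proof. exact: measurable_itv. Qed.

Lemma leb_unit : leb unit_itv = 1%E.
Proof. by rewrite /unit_itv lebesgue_measure_itv /= lte_fin ltr01 -EFinB subr0. Qed.

Lemma FTC_unit (k k' : R -> R) : (forall t : R, is_derive t 1 k (k' t)) -> continuous k' ->
  \int[leb]_(t in unit_itv) k' t = k 1 - k 0.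
Proof.
move=> dk ck'; rewrite /Rintegral /unit_itv (@continuous_FTC2 _ k' k) //.
- exact: continuous_subspaceT.
- have ck := is_derive_continuous dk; split.
  + by move=> t _; have [] := dk t.
  + by apply: cvg_at_right_filter; exact: ck.
  + by apply: cvg_at_left_filter; exact: ck.
- by move=> t _; rewrite derive1E; have [_] := dk t.
Qed.

(** [flat c k] is small near 0 by [flat_bound] and at most 1 to the right of 1. *)
Lemma bumpable_bounded (f : R -> R) : bumpable f -> exists K, forall x, `|f x| <= K.
Proof.
elim=> {f} [c k s a c0|f g _ [K fK] _ [L gL]|f g _ [K fK] _ [L gL]|r f _ [K fK]].
- have [K hK] := flat_bound k c0; exists (`|K| + 1) => x; set y := s * x + a.
  have [y1|y1] := lerP `|y| 1.
    apply: le_trans (hK y) _; apply: (@le_trans _ _ (`|K| * 1)).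
      by apply: ler_pM => //; [|exact: ler_norm]; have := hK 1; rewrite normr1 mulr1; apply: le_trans.
    by rewrite mulr1 lerDl.
  apply: (@le_trans _ _ 1); last by rewrite lerDr.
  rewrite ger0_norm ?flat_ge0 // /flat; case: ifP => // y0.
  apply: mulr_ile1; rewrite ?expR_ge0 //.
  + by rewrite exprn_ge0 // invr_ge0 ltW.
  + rewrite exprn_ile1 ?invr_ge0 ?(ltW y0) // invf_le1 //.
    by rewrite -(gtr0_norm y0) ltW.
  + by rewrite -expR0 ler_expR mulNr oppr_le0 ltW // mulr_gt0 ?invr_gt0.
- by exists (K + L) => x; rewrite (le_trans (ler_normD _ _)) // lerD.
- by exists (K * L) => x; rewrite normrM ler_pM.
- by exists (`|r| * K) => x; rewrite normrM ler_wpM2l.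
Qed.

Lemma bump_translate n a b c x : bump n a b (x - c) = bump n (a + c) (b + c) x :> R.
Proof. by rewrite /bump; congr (flat _ _ _ * flat _ _ _); ring. Qed.

Lemma is_derive_minus (f f' : R -> R) c : (forall x : R, is_derive x 1 f (f' x)) ->
  forall x : R, is_derive x 1 (fun y => f (y - c)) (f' (x - c)).
Proof.
move=> df x; have da : is_derive x 1 (fun y : R => y - c) 1.
  by apply: is_derive_eq; rewrite oppr0 addr0.
by have := @is_derive1_comp R f (fun y => y - c) x _ _ (df (x - c)) da; rewrite mulr1.
Qed.

Lemma is_derive_line (f f' : R -> R) x c : (forall y : R, is_derive y 1 f (f' y)) ->
  forall t : R, is_derive t 1 (fun t => f (x - t * c)) (- c * f' (x - t * c)).
Proof.
move=> df t; have da : is_derive t 1 (fun t : R => x - t * c) (- c).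
  by apply: is_derive_eq; rewrite /GRing.scale /=; ring.
have := @is_derive1_comp R f (fun t => x - t * c) t _ _ (df (x - t * c)) da.
by rewrite mulrC.
Qed.

Local Notation ext u U := (u \_ U).

Lemma L2_ext (U : set (R * R)) u : measurable (U : set P) -> (mu U < +oo)%E -> in_L2 U u ->
  mu.-integrable setT (EFin \o (ext u U : P -> R)) /\
  mu.-integrable setT (EFin \o (fun p : P => ext u U p ^+ 2)).
Proof.
move=> mU fU hu; have [mu_ iu] := hu; split.
  have /(integrable_mkcond _ mU) := L2_integrable mU fU hu.
  by apply: eq_integrable => // p _; rewrite /= !patchE; case: ifP.
have /(integrable_mkcond _ mU) := iu.
by apply: eq_integrable => // p _; rewrite /= !patchE; case: ifP => // _; rewrite expr0n.
Qed.

Lemma Rintegral_ext (U : set (R * R)) (u v : R * R -> R) :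
  \int[mu]_(p in U) (u p * v p) = \int[mu]_p (ext u U p * v p).
Proof.
rewrite Rintegral_mkcond; apply: eq_Rintegral => p _.
by rewrite !patchE; case: ifP => // _; rewrite mul0r.
Qed.

Section SegmentIdentity.
Variables (U : set (R * R)) (u : R * R -> R) (g : 'I_2 -> R * R -> R).
Hypotheses (oU : open U) (bU : bounded_set U) (cU : segment_closed U).
Hypotheses (hu : in_L2 U u) (hg : forall i, in_L2 U (g i)).
Variable h : R * R.

Let mU : measurable (U : set P). Proof. exact: open_measurable_plane. Qed.
Let fU : (mu U < +oo)%E. Proof. exact: bounded_finite_measure. Qed.
Let uT : P -> R := ext u U.
Let gT i : P -> R := ext (g i) U.
Definition directional (p : P) : R := h.1 * ext (g 0) U p + h.2 * ext (g 1) U p.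
Local Notation G := directional.
Definition segment_mean (p : P) : R :=
  \int[leb]_(t in unit_itv) G (translate h t p).

Let iu : mu.-integrable setT (EFin \o uT).
Proof. by have [] := L2_ext mU fU hu. Qed.
Let ig i : mu.-integrable setT (EFin \o gT i).
Proof. by have [] := L2_ext mU fU (hg i). Qed.
Let iG : mu.-integrable setT (EFin \o G).
Proof.
have := integrableD measurableT (integrableZl measurableT h.1 (ig 0))
  (integrableZl measurableT h.2 (ig 1)).
by apply: eq_integrable.
Qed.
Let mfun (f : P -> R) : mu.-integrable setT (EFin \o f) -> measurable_fun setT f.
Proof. by move=> /integrableP[/measurable_EFinP]. Qed.

Let F (p : P) (t : measurableTypeR R) : R := G (translate h t p) * \1_unit_itv t.

Let mF : measurable_fun setT (fun z : P * measurableTypeR R => F z.1 z.2).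
Proof.
apply: measurable_funM; first exact: (measurableT_comp (mfun iG) (measurable_translate h)).
exact: (measurableT_comp (measurable_indic measurable_unit) measurable_snd).
Qed.

Let normint (f : P -> R) : mu.-integrable setT (EFin \o f) ->
  exists C, (\int[mu]_p `|f p|%:E)%E = C%:E.
Proof.
move=> fi; exists (fine (\int[mu]_p `|f p|%:E)%E).
by rewrite fineK //; apply: integrable_fin_num => //; exact: (integrable_abse fi).
Qed.

Let FintK (k : P -> R) (K : R) : measurable_fun setT k -> (forall p, `|k p| <= K) ->
  (@lebplane R \x leb)%E.-integrable setT (fun z => (F z.1 z.2 * k z.1)%:E).
Proof.
move=> mk kK; have [C hC] := normint iG.
apply: (@integrable_prod_tonelli _ _ _ _ _ (@lebplane R) leb (fun p t => F p t * k p) (K * C)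
  unit_itv measurable_unit).
- by rewrite [X in (X < _)%E]leb_unit ltry.
- by apply: measurable_funM => //; exact: (measurableT_comp mk measurable_fst).
- move=> p t nt; rewrite /F indicE; case: (boolP (t \in unit_itv)); last by rewrite mulr0 mul0r.
  by rewrite inE.
- move=> t _; have K0 : 0 <= K by apply: le_trans (kK (0, 0)).
  have mGt : measurable_fun setT (fun p : P => `|G (translate h t p)|%:E).
    apply/measurable_EFinP; apply: measurableT_comp => //.
    by apply: (measurableT_comp (mfun iG)); have [] := scales_area_translate h t.
  apply: (@le_trans _ _ (\int[mu]_p (K%:E * `|G (translate h t p)|%:E))%E).
    apply: ge0_le_integral => //.
    + apply/measurable_EFinP; apply: measurableT_comp => //; apply: measurable_funM => //.
      exact: (measurableT_comp mF (measurable_pair2 t)).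
    + exact: measurable_funeM.
    + move=> p _; rewrite -EFinM lee_fin !normrM mulrC ler_pM //.
      rewrite -[leRHS]mulr1 ler_wpM2l // indicE; case: (_ \in _); rewrite /= ?normr1 ?normr0 //.
  rewrite ge0_integralZl ?lee_fin //.
  rewrite (ge0_integral_scales (scales_area_translate h t) ltr01 (f := fun p => `|G p|%:E)) //.
    by rewrite mul1e hC.
  by apply/measurable_EFinP; apply: measurableT_comp => //; exact: mfun.
Qed.

Let Fint : (@lebplane R \x leb)%E.-integrable setT (fun z => (F z.1 z.2)%:E).
Proof.
have h1 (p : P) : `|(fun=> 1 : R) p| <= 1 :> R by rewrite normr1.
have := @FintK (fun=> 1) 1 (measurable_cst _) h1.
by apply: eq_integrable => // z _; rewrite mulr1.
Qed.

Let Rint_unit (k : R -> R) :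
  \int[leb]_(t in unit_itv) k t = \int[leb]_t (k t * \1_unit_itv t).
Proof.
rewrite Rintegral_mkcond; apply: eq_Rintegral => t _.
by rewrite patchE indicE; case: ifP => _; rewrite ?mulr1 ?mulr0.
Qed.

Let meanE p : segment_mean p = \int[leb]_t F p t.
Proof. by rewrite /segment_mean Rint_unit. Qed.

Lemma segment_mean_integrable : mu.-integrable setT (EFin \o segment_mean).
Proof.
have [h1 _ _] := @Rfubini _ _ P (measurableTypeR R) R (@lebplane R) leb F Fint.
by apply: eq_integrable h1 => // p _; rewrite /= meanE.
Qed.

Let test_slice (k : P -> R) (K : R) t : measurable_fun setT k -> (forall p, `|k p| <= K) ->
  \int[mu]_p (F p t * k p) = \1_unit_itv t * \int[mu]_p (G p * k (translate h (- t) p)).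
Proof.
move=> mk kK.
have -> : (fun p => F p t * k p) = (fun p => \1_unit_itv t * (G (translate h t p) * k p)).
  by apply/funext => p; rewrite /F; ring.
have iGk : mu.-integrable setT (EFin \o (fun p => G p * k (translate h (- t) p))).
  apply: (integrable_mulr_bounded (K := K)) => //.
  by apply: (measurableT_comp mk); have [] := scales_area_translate h (- t).
have tK p : translate h (- t) (translate h t p) = p.
  by case: p => x y; rewrite /translate /=; congr pair; ring.
have e : (fun p => G (translate h t p) * k p) =
    (fun p => (fun p => G p * k (translate h (- t) p)) (translate h t p)).
  by apply/funext => p /=; rewrite tK.
rewrite RintegralZl //; last first.
  have := integrable_scales (scales_area_translate h t) ltr01 iGk.
  by apply: eq_integrable => // p _; rewrite /= tK.
by rewrite e (integral_translate h t iGk).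
Qed.

Lemma segment_mean_test_integrable (k : P -> R) (K : R) : measurable_fun setT k ->
  (forall p, `|k p| <= K) -> leb.-integrable unit_itv
    (EFin \o (fun t => \int[mu]_p (G p * k (translate h (- t) p)))).
Proof.
move=> mk kK.
have [_ iFk _] := @Rfubini _ _ P (measurableTypeR R) R (@lebplane R) leb
  (fun p t => F p t * k p) (FintK mk kK).
apply/(integrable_mkcond _ measurable_unit); apply: eq_integrable iFk => // t _.
rewrite patchE [LHS](congr1 EFin (test_slice t mk kK)) indicE.
by case: ifP => _; rewrite ?mul1r ?mul0r.
Qed.

(** Fubini moves the translation from the gradient onto the test function. *)
Lemma segment_mean_test (k : P -> R) (K : R) : measurable_fun setT k ->
  (forall p, `|k p| <= K) ->
  \int[mu]_p (segment_mean p * k p) =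
  \int[leb]_(t in unit_itv) \int[mu]_p (G p * k (translate h (- t) p)).
Proof.
move=> mk kK; have Fk := FintK mk kK; have [_ iFk fub] :=
  @Rfubini _ _ P (measurableTypeR R) R (@lebplane R) leb (fun p t => F p t * k p) Fk.
transitivity (\int[mu]_p \int[leb]_t (F p t * k p)).
  rewrite /Rintegral; congr fine; apply: ae_eq_integral => //.
  - apply/measurable_EFinP; apply: measurable_funM => //.
    exact: mfun segment_mean_integrable.
  - by have [/integrableP[]] :=
      @Rfubini _ _ P (measurableTypeR R) R (@lebplane R) leb (fun p t => F p t * k p) Fk.
  have := ae_integrable1 Fint; apply: filterS => p ip _.
  by rewrite meanE -RintegralZr.
rewrite -/mu fub Rint_unit; apply: eq_Rintegral => t _.
by rewrite -/mu (test_slice t mk kK) mulrC.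
Qed.

(** For a bump supported in [U] and in its translate by [- h], convexity keeps
    the support of the bump translated by [t h] inside [U], so that the weak
    formulation applies to it for all [t] in the unit interval. *)
Lemma weak_translate n a b c d t : weak_gradient U u g -> 0 <= t -> t <= 1 ->
  `[a, b]%classic `*` `[c, d]%classic `<=` U `&` [set p | U (translate h 1 p)] ->
  forall f' g' : R -> R, bumpable f' -> bumpable g' ->
  (forall x : R, is_derive x 1 (bump n a b) (f' x)) ->
  (forall x : R, is_derive x 1 (bump n c d) (g' x)) ->
  \int[mu]_p (uT p * (h.1 * tensor f' (bump n c d) (translate h (- t) p) +
                      h.2 * tensor (bump n a b) g' (translate h (- t) p))) =
  - \int[mu]_p (G p * tensor (bump n a b) (bump n c d) (translate h (- t) p)).
Proof.
move=> wg t0 t1 abcd f' g' bf' bg' df dg.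
set fa := bump n a b; set gc := bump n c d.
pose phi := tensor (fun x => fa (x - t * h.1)) (fun y => gc (y - t * h.2)).
have trE (f1 g1 : R -> R) p : tensor f1 g1 (translate h (- t) p) =
    tensor (fun x => f1 (x - t * h.1)) (fun y => g1 (y - t * h.2)) p.
  by rewrite /tensor /translate /= !mulNr.
have tphi : test_function U phi.
  have -> : phi = tensor (bump n (a + t * h.1) (b + t * h.1)) (bump n (c + t * h.2) (d + t * h.2)).
    by apply/funext => p; rewrite /phi /tensor /fa /gc !bump_translate.
  apply: test_function_bump => -[x y] [/= ]; rewrite !in_itv /= => /andP[x1 x2] /andP[y1 y2].
  have [] := abcd (x - t * h.1, y - t * h.2).
    by split; rewrite /= in_itv /=; apply/andP; split; lra.
  move=> U1 U2; have := segment_closed_translate cU U1 U2 t0 t1.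
  by rewrite /translate /= !subrK.
have := wg 0 _ tphi; have := wg 1 _ tphi.
have -> : pderiv 0 phi = tensor (fun x => f' (x - t * h.1)) (fun y => gc (y - t * h.2)).
  apply/funext => p.
  by have [_] := pderiv_tensor0 (fun y => gc (y - t * h.2)) (is_derive_minus (t * h.1) df) p.
have -> : pderiv 1 phi = tensor (fun x => fa (x - t * h.1)) (fun y => g' (y - t * h.2)).
  apply/funext => p.
  by have [_] := pderiv_tensor1 (fun x => fa (x - t * h.1)) (is_derive_minus (t * h.2) dg) p.
rewrite !(Rintegral_ext U) => e1 e0.
have bt (f1 g1 : R -> R) (w : P -> R) : bumpable f1 -> bumpable g1 ->
    mu.-integrable setT (EFin \o w) ->
    mu.-integrable setT (EFin \o (fun p => w p * tensor f1 g1 (translate h (- t) p))).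
  move=> b1 b2 iw; have [K1 hK1] := bumpable_bounded b1; have [K2 hK2] := bumpable_bounded b2.
  apply: (integrable_mulr_bounded (K := K1 * K2)) => //.
    apply: (measurableT_comp (measurable_tensor (bumpable_continuous b1) (bumpable_continuous b2))).
    by have [] := scales_area_translate h (- t).
  by move=> p; rewrite normrM ler_pM.
have bfa : bumpable fa by exact: bumpable_bump.
have bgc : bumpable gc by exact: bumpable_bump.
have lin (x y : R) (k1 k2 : P -> R) : mu.-integrable setT (EFin \o k1) ->
    mu.-integrable setT (EFin \o k2) ->
    \int[mu]_p (x * k1 p + y * k2 p) = x * \int[mu]_p k1 p + y * \int[mu]_p k2 p.
  move=> i1 i2; rewrite RintegralD //; first by rewrite !RintegralZl.
    exact: (integrableZl measurableT x i1).
  exact: (integrableZl measurableT y i2).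
have tr (f1 g1 : R -> R) (w : P -> R) : \int[mu]_p (w p * tensor f1 g1 (translate h (- t) p)) =
    \int[mu]_p (w p * tensor (fun x => f1 (x - t * h.1)) (fun y => g1 (y - t * h.2)) p).
  by apply: eq_Rintegral => p _; rewrite trE.
transitivity (h.1 * \int[mu]_p (uT p * tensor f' gc (translate h (- t) p)) +
              h.2 * \int[mu]_p (uT p * tensor fa g' (translate h (- t) p))).
  rewrite -lin; [|exact: bt|exact: bt].
  by apply: eq_Rintegral => p _; ring.
transitivity (- (h.1 * \int[mu]_p (gT 0 p * tensor fa gc (translate h (- t) p)) +
              h.2 * \int[mu]_p (gT 1 p * tensor fa gc (translate h (- t) p)))).
  by rewrite !tr e0 e1 !mulrN opprD.
congr (- _); rewrite -lin; [|exact: bt|exact: bt].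
by apply: eq_Rintegral => p _; rewrite /G /gT; ring.
Qed.

End SegmentIdentity.
End Segments.

Section SegmentTheorems.
Variable R : realType.
Local Notation P := (measurableTypeR R * measurableTypeR R)%type.
Local Notation mu := (leb2 R).
Local Notation leb := (@lebesgue_measure R).
Local Notation ext u U := (u \_ U).

Lemma continuous_translate (h : R * R) t : continuous (translate h t).
Proof.
rewrite (_ : translate h t = (fun p : R * R => p + (t * h.1, t * h.2))).
  by move=> p; apply: cvgD; [exact: cvg_id|exact: cvg_cst].
by apply/funext => -[].
Qed.

Lemma tensor_bounded (f g : R -> R) : bumpable f -> bumpable g ->
  exists K, forall p, `|tensor f g p| <= K.
Proof.
move=> /bumpable_bounded[K1 hK1] /bumpable_bounded[K2 hK2]; exists (K1 * K2) => p.
by rewrite normrM ler_pM.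
Qed.

Lemma RintegralB2 (f1 f2 : P -> R) : mu.-integrable setT (EFin \o f1) ->
  mu.-integrable setT (EFin \o f2) ->
  \int[mu]_p (f1 p - f2 p) = \int[mu]_p f1 p - \int[mu]_p f2 p.
Proof. by move=> i1 i2; rewrite RintegralB. Qed.

Lemma RintegralB3 (f1 f2 f3 : P -> R) : mu.-integrable setT (EFin \o f1) ->
  mu.-integrable setT (EFin \o f2) -> mu.-integrable setT (EFin \o f3) ->
  \int[mu]_p (f1 p - f2 p - f3 p) = \int[mu]_p f1 p - \int[mu]_p f2 p - \int[mu]_p f3 p.
Proof.
move=> i1 i2 i3; rewrite -RintegralB2 // -RintegralB2 //.
have := integrableB measurableT i1 i2; exact: eq_integrable.
Qed.

(** Tested against a bump [phi], the increment of [u] becomes [u] tested against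
    an increment of [phi]. The latter is the integral of directional derivatives
    of translates of [phi], onto which the weak formulation applies; undoing the
    translations gives the segment mean tested against [phi]. *)
Theorem segment_identity (U : set (R * R)) u g h :
  open U -> bounded_set U -> segment_closed U -> in_H1 U u g ->
  {ae mu, forall p, U p -> U (translate h 1 p) ->
    u (translate h 1 p) - u p = segment_mean U g h p}.
Proof.
move=> oU bU cU [hu hg wg].
have mU : measurable (U : set P) by exact: open_measurable_plane.
have fU : (mu U < +oo)%E by exact: bounded_finite_measure.
have [iu _] := L2_ext mU fU hu.
have iu1 : mu.-integrable setT (EFin \o (fun p : P => ext u U (translate h 1 p))).
  exact: (integrable_scales (scales_area_translate h 1) ltr01 iu).
have im := segment_mean_integrable oU bU hg h.
pose w (p : P) := ext u U (translate h 1 p) - ext u U p - segment_mean U g h p.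
have iw : mu.-integrable setT (EFin \o w).
  have := integrableB measurableT (integrableB measurableT iu1 iu) im.
  by apply: eq_integrable.
have mfun (f : P -> R) : mu.-integrable setT (EFin \o f) -> measurable_fun setT f.
  by move=> /integrableP[/measurable_EFinP].
suff h0 : {ae mu, forall p, (U `&` [set p | U (translate h 1 p)]) p -> w p = 0}.
  apply: (negligibleS _ h0) => p /= nS w0; apply: nS => Up Up1.
  have := w0 (conj Up Up1); rewrite /w !patchE !mem_set // => /eqP.
  by rewrite subr_eq0 => /eqP.
apply: fundamental_lemma => //.
  apply: openI => //; apply: open_comp oU => p _; exact: continuous_translate.
move=> n a b c d abcd; set fa := bump n a b; set gc := bump n c d.
have bfa : bumpable fa by exact: bumpable_bump.
have bgc : bumpable gc by exact: bumpable_bump.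
have [f' bf' df] := bumpable_derive bfa; have [g' bg' dg] := bumpable_derive bgc.
pose phi : P -> R := tensor fa gc.
have mphi : measurable_fun setT phi.
  by apply: measurable_tensor; exact: bumpable_continuous.
have [K hK] := tensor_bounded bfa bgc.
have mtr t (k : P -> R) : measurable_fun setT k -> measurable_fun setT (fun p => k (translate h t p)).
  by move=> mk; apply: (measurableT_comp mk); have [] := scales_area_translate h t.
have iphi (v : P -> R) : mu.-integrable setT (EFin \o v) ->
    mu.-integrable setT (EFin \o (fun p => v p * phi p)).
  by move=> iv; apply: (integrable_mulr_bounded (K := K)).
have iphi' (v : P -> R) t : mu.-integrable setT (EFin \o v) ->
    mu.-integrable setT (EFin \o (fun p => v p * phi (translate h t p))).
  move=> iv; apply: (integrable_mulr_bounded (K := K)) => //; exact: mtr.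
pose D (p : P) (t : R) := h.1 * tensor f' gc (translate h (- t) p) +
                      h.2 * tensor fa g' (translate h (- t) p).
have [K1 hK1] := tensor_bounded bf' bgc; have [K2 hK2] := tensor_bounded bfa bg'.
have mD : measurable_fun setT (fun z : P * measurableTypeR R => D z.1 z.2).
  have mt : measurable_fun setT (fun z : P * measurableTypeR R => translate h (- z.2) z.1 : P).
    apply: (measurableT_comp (measurable_translate h) (g := fun z : P * measurableTypeR R =>
      (z.1, - z.2) : P * measurableTypeR R)).
    apply/measurable_fun_pairP; split; first exact: measurable_fst.
    by apply: measurable_funN; exact: measurable_snd.
  apply: measurable_funD; apply: measurable_funM; try exact: measurable_cst.
    by apply: (measurableT_comp _ mt); apply: measurable_tensor; exact: bumpable_continuous.
  by apply: (measurableT_comp _ mt); apply: measurable_tensor; exact: bumpable_continuous.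
pose KD := `|h.1| * K1 + `|h.2| * K2.
have hD p t : `|D p t| <= KD.
  rewrite (le_trans (ler_normD _ _)) // (normrM h.1) (normrM h.2) lerD //.
    by rewrite ler_wpM2l.
  by rewrite ler_wpM2l.
have KD0 : 0 <= KD by apply: le_trans (hD (0, 0) 0).
pose F (p : P) (t : measurableTypeR R) := ext u U p * (D p t * \1_(@unit_itv R) t).
have mind : measurable_fun setT (fun z : P * measurableTypeR R => \1_(@unit_itv R) z.2 : R).
  exact: (measurableT_comp (measurable_indic (@measurable_unit R)) measurable_snd).
have iF : (@lebplane R \x leb)%E.-integrable setT (fun z => (F z.1 z.2)%:E).
  apply: (@integrable_prod_tonelli _ _ _ _ _ (@lebplane R) leb F
    (KD * fine (\int[mu]_p `|ext u U p|%:E)%E) (@unit_itv R) (@measurable_unit R)).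
  - by rewrite [X in (X < _)%E]leb_unit ltry.
  - apply: measurable_funM; first exact: (measurableT_comp (mfun _ iu) measurable_fst).
    exact: measurable_funM.
  - move=> p t nt; rewrite /F indicE; case: (boolP (t \in @unit_itv R)).
      by rewrite inE.
    by rewrite !mulr0.
  - move=> t _; apply: (@le_trans _ _ (\int[mu]_p (KD%:E * `|ext u U p|%:E))%E).
      apply: ge0_le_integral => //.
      + apply/measurable_EFinP; apply: measurableT_comp => //; apply: measurable_funM.
          exact: mfun.
        by apply: measurable_funM => //; exact: (measurableT_comp mD (measurable_pair2 t)).
      + apply: measurable_funeM; apply/measurable_EFinP; apply: measurableT_comp => //.
        exact: mfun.
      + move=> p _; rewrite -EFinM lee_fin !normrM mulrC ler_pM //.
        rewrite -[leRHS]mulr1 ler_pM // indicE; case: (_ \in _); rewrite /= ?normr1 ?normr0 //.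
    rewrite ge0_integralZl ?lee_fin //; last first.
      by apply/measurable_EFinP; apply: measurableT_comp => //; exact: mfun.
    rewrite EFinM fineK //; apply: integrable_fin_num => //; exact: (integrable_abse iu).
have [_ iFt fub] := @Rfubini _ _ P (measurableTypeR R) R (@lebplane R) leb F iF.
have key : \int[mu]_p (segment_mean U g h p * phi p) =
    - \int[mu]_p (ext u U p * (phi p - phi (translate h (-1) p))).
  rewrite (segment_mean_test oU bU hg h mphi hK).
  transitivity (- \int[leb]_t \int[mu]_p F p t).
    rewrite Rintegral_mkcond -mulN1r -RintegralZl //.
    apply: eq_Rintegral => t _; rewrite patchE; case: ifPn => ht; last first.
      rewrite /F (_ : (fun p => _) = fun=> 0); last first.
        by apply/funext => p; rewrite indicE (negbTE ht) !mulr0.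
      by rewrite Rintegral_cst // mul0r mulr0.
    have := ht; rewrite inE /unit_itv /= in_itv /= => /andP[t0 t1].
    have wt := weak_translate oU bU cU hu hg wg t0 t1 abcd bf' bg' df dg.
    rewrite mulN1r -[LHS]opprK -[in LHS]wt; congr (- _); apply: eq_Rintegral => p _.
    by rewrite /F /D indicE ht mulr1.
  congr (- _); rewrite -/mu in fub *; rewrite -fub.
  apply: eq_Rintegral => p _; rewrite /F.
  have cD : continuous (D p).
    have cc (f1 g1 : R -> R) : bumpable f1 -> bumpable g1 ->
        continuous (fun t => tensor f1 g1 (translate h (- t) p)).
      move=> b1 b2; rewrite (_ : (fun t => _) =
        fun t => f1 (p.1 - t * h.1) * g1 (p.2 - t * h.2)); last first.
        by apply/funext => t; rewrite /tensor /translate /= !mulNr.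
      have [f2 _ df1] := bumpable_derive b1; have [g2 _ dg1] := bumpable_derive b2.
      have k1 := is_derive_continuous (is_derive_line p.1 h.1 df1).
      have k2 := is_derive_continuous (is_derive_line p.2 h.2 dg1).
      by move=> t; apply: cvgM; [exact: k1|exact: k2].
    move=> t; apply: cvgD; apply: cvgM; try exact: cvg_cst; exact: cc.
  have ftc : \int[leb]_(t in @unit_itv R) D p t = phi p - phi (translate h (-1) p).
    have dk (t : R) : is_derive t 1 (fun t => - (fa (p.1 - t * h.1) * gc (p.2 - t * h.2))) (D p t).
      have d1 := is_derive_line p.1 h.1 df t; have d2 := is_derive_line p.2 h.2 dg t.
      have d3 := is_deriveN (is_deriveM d1 d2).
      apply: is_derive_eq d3 _; rewrite /GRing.scale /= /D /tensor /translate /= !mulNr; ring.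
    rewrite (FTC_unit dk cD).
    by rewrite /phi /tensor /translate /= !mul1r !mul0r !subr0 !mulN1r; ring.
  have iDp : leb.-integrable setT (EFin \o (D p \_ (@unit_itv R) : measurableTypeR R -> R)).
    apply: (@le_integrable _ _ _ leb setT measurableT _ (EFin \o (fun t => KD * \1_(@unit_itv R) t))).
    - apply/measurable_EFinP; apply/(measurable_restrictT _ (@measurable_unit R)).
      by apply: measurable_funTS; exact: continuous_measurable_fun.
    - move=> t _; rewrite /= lee_fin patchE indicE normrM (ger0_norm KD0).
      by case: ifP => _; rewrite /= ?normr1 ?normr0 ?mulr1 ?mulr0.
    - have ii : leb.-integrable setT (EFin \o (\1_(@unit_itv R) : measurableTypeR R -> R)).
        apply/integrableP; split.
          by apply/measurable_EFinP; exact: measurable_indic (@measurable_unit R).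
        rewrite (eq_integral (fun t => (\1_(@unit_itv R) t)%:E)); last first.
          by move=> t _; rewrite /= indicE; case: (_ \in _); rewrite /= ?normr1 ?normr0.
        rewrite integral_indic //; last exact: measurable_unit.
        by rewrite setIT [X in (X < _)%E]leb_unit ltry.
      by have := integrableZl measurableT KD ii; apply: eq_integrable.
  rewrite -ftc (Rintegral_mkcond _ (@unit_itv R)) -(RintegralZl (ext u U p) measurableT iDp).
  apply: eq_Rintegral => t _; congr (_ * _); rewrite patchE indicE.
  by case: ifP => _; rewrite ?mulr1 ?mulr0.
have iu1phi : \int[mu]_p (ext u U (translate h 1 p) * phi p) =
    \int[mu]_p (ext u U p * phi (translate h (-1) p)).
  have := integral_translate h 1 (iphi' _ (-1) iu); rewrite /= => <-.
  apply: eq_Rintegral => -[x y] _; congr (_ * phi _).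
  by rewrite /translate /=; congr pair; ring.
have iA := iphi _ iu1; have iB := iphi _ iu; have iC := iphi _ im; have iE := iphi' _ (-1) iu.
have split3 : \int[mu]_p (w p * phi p) = \int[mu]_p (ext u U (translate h 1 p) * phi p) -
    \int[mu]_p (ext u U p * phi p) - \int[mu]_p (segment_mean U g h p * phi p).
  rewrite -(RintegralB3 iA iB iC); apply: eq_Rintegral => p _.
  by rewrite /w !mulrBl.
have split2 : \int[mu]_p (ext u U p * (phi p - phi (translate h (-1) p))) =
    \int[mu]_p (ext u U p * phi p) - \int[mu]_p (ext u U p * phi (translate h (-1) p)).
  rewrite -(RintegralB2 iB iE); apply: eq_Rintegral => p _.
  by rewrite mulrBr.
rewrite split3 key iu1phi opprK split2.
by rewrite addrA subrK subrr.
Qed.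

Lemma unit_jensen (k : R -> R) : measurable_fun setT (k : measurableTypeR R -> R) ->
  (((\int[leb]_(t in @unit_itv R) k t) ^+ 2)%:E <= \int[leb]_(t in @unit_itv R) (k t ^+ 2)%:E)%E.
Proof.
move=> mk; have mI := @measurable_unit R.
have mk1 : measurable_fun (@unit_itv R) k by exact: measurable_funTS.
have [->|fin] := eqVneq (\int[leb]_(t in @unit_itv R) (k t ^+ 2)%:E)%E +oo%E.
  by rewrite leey.
have i2 : leb.-integrable (@unit_itv R) (fun t => (k t ^+ 2)%:E).
  apply/integrableP; split; first by apply/measurable_EFinP; exact: measurable_funX.
  have -> : (\int[leb]_(t in @unit_itv R) `|(k t ^+ 2)%:E| =
      \int[leb]_(t in @unit_itv R) (k t ^+ 2)%:E)%E.
    by apply: eq_integral => t _; rewrite /= ger0_norm ?sqr_ge0.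
  by rewrite lt_neqAle fin leey.
have ic (c : R) : leb.-integrable (@unit_itv R) (EFin \o (fun=> c)).
  apply/integrableP; split; first exact/measurable_EFinP.
  by rewrite (integral_cst leb mI `|c|%:E) [X in (_ * X)%E]leb_unit mule1 ltry.
have i1 : leb.-integrable (@unit_itv R) (EFin \o k).
  apply: (@le_integrable _ _ _ _ _ mI _ (fun t => 1%:E + (k t ^+ 2)%:E)%E).
  - exact/measurable_EFinP.
  - move=> t _ /=; rewrite lee_fin [leRHS]ger0_norm ?addr_ge0 ?sqr_ge0 //.
    rewrite -(real_normK (num_real (k t))); move: `|k t| (normr_ge0 (k t)) => x x0.
    by have := sqr_ge0 (x - 1); lra.
  - by apply: integrableD => //; exact: ic.
set m := \int[leb]_(t in @unit_itv R) k t.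
have e2 : (\int[leb]_(t in @unit_itv R) (k t ^+ 2)%:E =
    (\int[leb]_(t in @unit_itv R) k t ^+ 2)%:E)%E.
  by rewrite /Rintegral fineK //; exact: integrable_fin_num.
have i3 : leb.-integrable (@unit_itv R) (EFin \o (fun t => k t ^+ 2 + (- (2 * m)) * k t)).
  have := integrableD mI i2 (integrableZl mI (- (2 * m)) i1); exact: eq_integrable.
have : 0 <= \int[leb]_(t in @unit_itv R) ((k t - m) ^+ 2).
  by apply: Rintegral_ge0 => t _; exact: sqr_ge0.
have -> : \int[leb]_(t in @unit_itv R) ((k t - m) ^+ 2) =
    \int[leb]_(t in @unit_itv R) ((k t ^+ 2 + (- (2 * m)) * k t) + m ^+ 2).
  by apply: eq_Rintegral => t _; ring.
rewrite (RintegralD mI i3 (ic (m ^+ 2))).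
have i4 : leb.-integrable (@unit_itv R) (EFin \o (fun t => (- (2 * m)) * k t)).
  by have := integrableZl mI (- (2 * m)) i1; exact: eq_integrable.
have i5 : leb.-integrable (@unit_itv R) (EFin \o (fun t => k t ^+ 2)) by [].
rewrite (RintegralD mI i5 i4).
rewrite RintegralZl // Rintegral_cst // [X in fine X]leb_unit mulr1 -/m e2 lee_fin.
by move: (Rintegral _ _ _) => q; lra.
Qed.

End SegmentTheorems.

(** * The Poincare inequality on convex domains *)
Section Poincare.
Variable R : realType.
Local Notation P := (measurableTypeR R * measurableTypeR R)%type.
Local Notation mu := (leb2 R).
Local Notation leb := (@lebesgue_measure R).
Local Notation ext u U := (u \_ U).

Lemma measurable_translate3 : measurable_fun setT
  (fun z : (P * measurableTypeR R) * P => translate z.1.1 z.1.2 z.2 : P).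
Proof.
have m11 := measurableT_comp (@measurable_fst _ _ P (measurableTypeR R))
  (@measurable_fst _ _ (P * measurableTypeR R)%type P).
have m12 := measurableT_comp (@measurable_snd _ _ P (measurableTypeR R))
  (@measurable_fst _ _ (P * measurableTypeR R)%type P).
have m2 := @measurable_snd _ _ (P * measurableTypeR R)%type P.
apply/measurable_fun_pairP; split; apply: measurable_funD.
- exact: (measurableT_comp measurable_fst m2).
- by apply: measurable_funM; [exact: m12|exact: (measurableT_comp measurable_fst m11)].
- exact: (measurableT_comp measurable_snd m2).
- by apply: measurable_funM; [exact: m12|exact: (measurableT_comp measurable_snd m11)].
Qed.

Lemma measurable_translate2 (s : R) : measurable_fun setT
  (fun z : P * P => translate z.1 s z.2 : P).
Proof.
apply: (measurableT_comp measurable_translate3 (g := fun z : P * P => ((z.1, s), z.2))).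
apply/measurable_fun_pairP; split; last exact: measurable_snd.
by apply/measurable_fun_pairP; split; [exact: measurable_fst|exact: measurable_cst].
Qed.

Lemma ge0_intZl d (T : measurableType d) (nu : {measure set T -> \bar R}) (k : R)
    (f : T -> \bar R) : 0 <= k -> measurable_fun setT f -> (forall x, (0 <= f x)%E) ->
  (\int[nu]_x (k%:E * f x) = k%:E * \int[nu]_x f x)%E.
Proof. by move=> k0 mf f0; rewrite ge0_integralZl. Qed.

Section Domain.
Variables (U : set (R * R)) (oU : open U) (bU : bounded_set U).
Let mU : measurable (U : set P). Proof. exact: open_measurable_plane. Qed.
Let fU : (mu U < +oo)%E. Proof. exact: bounded_finite_measure. Qed.
Let m : R := fine (mu U).
Let m_fin : (mu U = m%:E)%E. Proof. by rewrite fineK // ge0_fin_numE. Qed.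
Let m0 : 0 <= m. Proof. exact: fine_ge0. Qed.
Let chi (p : P) : R := \1_(U : set P) p.
Let mchi : measurable_fun setT chi. Proof. exact: measurable_indic. Qed.
Let chi0 p : 0 <= chi p. Proof. by []. Qed.
Let chi1 p : chi p <= 1. Proof. by rewrite /chi indicE; case: (_ \in _). Qed.
Let chiE p : chi p = (p \in (U : set P))%:R. Proof. exact: indicE. Qed.

Let incr_ge0 h (u : R * R -> R) p :
  0 <= chi p * (chi (translate h 1 p) * (ext u U (translate h 1 p) - ext u U p) ^+ 2).
Proof. by rewrite mulr_ge0 // mulr_ge0 // sqr_ge0. Qed.

Let int_chi (f : R * R -> R) : (forall p, U p -> 0 <= f p) ->
  (\int[mu]_p (chi p * f p)%:E = \int[mu]_(p in U) (f p)%:E)%E.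
Proof.
move=> f0; rewrite [RHS]integral_mkcond; apply: eq_integral => p _.
by rewrite patchE /chi indicE; case: ifP; rewrite /= ?mul1r ?mul0r.
Qed.

Lemma variance_expand u c : in_L2 U u ->
  (\int[mu]_(p in U) ((u p - c) ^+ 2)%:E =
   (dot U u u - 2 * c * \int[mu]_(p in U) u p + c ^+ 2 * m)%:E)%E.
Proof.
move=> hu; pose one : R * R -> R := fun=> 1.
have h1 : in_L2 U one := L2_cst mU fU 1.
have hw := L2_lin mU (- c) h1 hu.
have -> : (\int[mu]_(p in U) ((u p - c) ^+ 2)%:E =
    \int[mu]_(p in U) ((- c * one p + u p) * (- c * one p + u p))%:E)%E.
  by apply: eq_integral => p _; rewrite /one; congr EFin; ring.
rewrite RintegralE //; last exact: L2_mul.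
have := dot_lin mU (- c) h1 hu hw; rewrite {1}/dot => ->.
rewrite (dotC U one) (dotC U u (fun p => _ + _)).
rewrite (dot_lin mU (- c) h1 hu h1).
rewrite (dot_lin mU (- c) h1 hu hu) (dotC U one u) !dot_cst1.
rewrite Rintegral_cst // -/m; congr EFin; ring.
Qed.

(** In the variables [p] and [q = p + h] this is the double integral of
    [(u q - u p) ^+ 2] over pairs of points of [U]. *)
Lemma double_variance u : in_L2 U u ->
  (\int[mu]_h \int[mu]_p (chi p * (chi (translate h 1 p) * (ext u U (translate h 1 p) - ext u U p) ^+ 2))%:E =
   (2 * m * dot U u u - 2 * (\int[mu]_(p in U) u p) ^+ 2)%:E)%E.
Proof.
move=> hu; have [mu_ _] := hu.
have mu' : measurable_fun setT (ext u U : P -> R) by apply/(measurable_restrictT _ mU).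
have mt := measurable_translate2 1.
rewrite (@tonelli_swap _ _ P P R (@lebplane R) (@lebplane R)); last 2 first.
- apply/measurable_EFinP; apply: measurable_funM.
    exact: (measurableT_comp mchi measurable_snd).
  apply: measurable_funM; first exact: (measurableT_comp mchi mt).
  apply: measurable_funX; apply: measurable_funB; first exact: (measurableT_comp mu' mt).
  exact: (measurableT_comp mu' measurable_snd).
- by move=> h p; rewrite lee_fin; exact: incr_ge0.
set A := dot U u u; set B := \int[mu]_(p in U) u p.
have inner (p : P) : (\int[mu]_h (chi p * (chi (translate h 1 p) * (ext u U (translate h 1 p) - ext u U p) ^+ 2))%:E =
    (chi p * (A - 2 * ext u U p * B + (ext u U p) ^+ 2 * m))%:E)%E.
  have sc := scales_area_translate p 1.
  pose f (q : P) : \bar R := ((chi p)%:E * (chi q * (ext u U q - ext u U p) ^+ 2)%:E)%E.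
  have mk : measurable_fun setT (fun q : P => (chi q * (ext u U q - ext u U p) ^+ 2)%:E).
    apply/measurable_EFinP; apply: measurable_funM => //; apply: measurable_funX.
    by apply: measurable_funB => //; exact: measurable_cst.
  have mf : measurable_fun setT f by exact: measurable_funeM.
  have f0 q : (0 <= f q)%E by rewrite /f -EFinM lee_fin mulr_ge0 // mulr_ge0 // sqr_ge0.
  transitivity (\int[mu]_h f (translate p 1 h))%E.
    apply: eq_integral => h _; rewrite /f -EFinM; congr (chi p * _)%:E.
    have -> // : translate h 1 p = translate p 1 h.
    by rewrite /translate !mul1r ![p.1 + _]addrC ![p.2 + _]addrC.
  rewrite (ge0_integral_scales sc ltr01 mf f0) /f.
  rewrite mul1e (ge0_intZl _ _ mk) //; last by move=> q; rewrite lee_fin mulr_ge0 ?sqr_ge0.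
  rewrite int_chi => [|q _]; last exact: sqr_ge0.
  rewrite [in RHS]EFinM -variance_expand //; congr (_ * _)%E.
  by apply: eq_integral => q Uq; rewrite patchE Uq.
under eq_integral do rewrite inner.
have e : (\int[mu]_p (chi p * (A - 2 * ext u U p * B + (ext u U p) ^+ 2 * m))%:E =
    \int[mu]_(p in U) (A - 2 * u p * B + (u p) ^+ 2 * m)%:E)%E.
  rewrite [RHS]integral_mkcond; apply: eq_integral => p _.
  by rewrite !patchE /chi indicE; case: ifP; rewrite /= ?mul1r ?mul0r.
rewrite e.
have iA : mu.-integrable U (EFin \o (fun=> A) : P -> \bar R) by exact: integrable_cst.
have iB : mu.-integrable U (EFin \o (fun p => - (2 * B) * u p) : P -> \bar R).
  have := integrableZl mU (- (2 * B)) (L2_integrable mU fU hu).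
  exact: eq_integrable.
have iC : mu.-integrable U (EFin \o (fun p => m * (u p * u p)) : P -> \bar R).
  have := integrableZl mU m (L2_mul mU hu hu); exact: eq_integrable.
have iAB : mu.-integrable U (EFin \o (fun p => A + - (2 * B) * u p) : P -> \bar R).
  have := integrableD mU iA iB; exact: eq_integrable.
have iABC : mu.-integrable U (EFin \o (fun p => (A + - (2 * B) * u p) + m * (u p * u p)) : P -> \bar R).
  have := integrableD mU iAB iC; exact: eq_integrable.
transitivity (\int[mu]_(p in U) ((A + - (2 * B) * u p) + m * (u p * u p))%:E)%E.
  by apply: eq_integral => p _; congr EFin; ring.
rewrite RintegralE // (RintegralD mU iAB iC) (RintegralD mU iA iB).
rewrite (RintegralZl _ mU (L2_integrable mU fU hu)) (RintegralZl _ mU (L2_mul mU hu hu)).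
rewrite Rintegral_cst // -/m -/B -/(dot U u u) -/A; congr EFin; ring.
Qed.

(** For [|s| >= 1/2] the map [h |-> z + s h] shrinks areas by a factor at most
    4, so the inner integral over [h] is at most [4 * m]. *)
Lemma convolution_bound (Gam : P -> R) (s : R) : measurable_fun setT Gam ->
  (forall p, 0 <= Gam p) -> 2^-1 <= `|s| ->
  (\int[mu]_h \int[mu]_z (chi (translate h s z) * Gam z)%:E <=
   (4 * m)%:E * \int[mu]_z (Gam z)%:E)%E.
Proof.
move=> mG G0 s2; have s0 : s != 0 by rewrite -normr_gt0; apply: lt_le_trans s2; rewrite invr_gt0.
have mt := measurable_translate2 s.
rewrite (@tonelli_swap _ _ P P R (@lebplane R) (@lebplane R)); last 2 first.
- apply/measurable_EFinP; apply: measurable_funM; first exact: (measurableT_comp mchi mt).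
  exact: (measurableT_comp mG measurable_snd).
- by move=> h z; rewrite lee_fin mulr_ge0.
have inner z : (\int[mu]_h (chi (translate h s z) * Gam z)%:E =
    (Gam z * (`|s * s|^-1 * m))%:E)%E.
  have sc := scales_area_diag z.1 z.2 s0 s0.
  have ss0 : 0 < `|s * s|^-1 by rewrite invr_gt0 normr_gt0 mulf_neq0.
  pose T (p : P) : P := (s * p.1 + z.1, s * p.2 + z.2).
  pose f (q : P) : \bar R := ((Gam z)%:E * (chi q)%:E)%E.
  have mf : measurable_fun setT f by apply: measurable_funeM; exact/measurable_EFinP.
  have f0 q : (0 <= f q)%E by rewrite /f -EFinM lee_fin mulr_ge0.
  transitivity (\int[mu]_h f (T h))%E.
    apply: eq_integral => h _; rewrite /f -EFinM mulrC /translate /T.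
    by rewrite ![_ + s * _]addrC.
  rewrite (ge0_integral_scales sc ss0 mf f0) /f.
  have mchiE : measurable_fun setT (fun q : P => (chi q)%:E) by exact/measurable_EFinP.
  have -> : (\int[mu]_q ((Gam z)%:E * (chi q)%:E) = (Gam z)%:E * m%:E)%E.
    by rewrite (ge0_intZl _ (G0 z) mchiE) // integral_indic // setIT; congr (_ * _)%E.
  by rewrite -!EFinM; congr EFin; ring.
have mGE : measurable_fun setT (fun z : P => (Gam z)%:E) by exact/measurable_EFinP.
rewrite -(ge0_intZl _ (mulr_ge0 (ler0n _ 4) m0) mGE) //.
rewrite [leLHS](eq_integral (fun z => (Gam z * (`|s * s|^-1 * m))%:E)); last by move=> z _; exact: inner.
apply: ge0_le_integral => //.
- by move=> z _; rewrite lee_fin !mulr_ge0 ?invr_ge0.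
- by apply/measurable_EFinP; apply: measurable_funM => //; exact: measurable_cst.
- by apply: measurable_funeM; exact/measurable_EFinP.
move=> z _; rewrite -EFinM lee_fin mulrC ler_wpM2r // ler_wpM2r //.
have h4 : 4^-1 <= `|s * s| by rewrite normrM; move: (`|s|) s2 => x; nra.
rewrite -(invrK 4) lef_pV2 ?posrE ?invr_gt0 //.
by apply: lt_le_trans h4; rewrite invr_gt0.
Qed.

(** Integrate the squared increments over pairs of points of [U] and bound each
    by the energy along the segment joining them. A point of the segment is at
    least half of [h] away from one of the two ends; integrating over the
    position of that end costs only a factor 4. *)
Theorem poincare u g (d : R) : segment_closed U -> in_H1 U u g ->
  (forall p q, U p -> U q -> `|p.1 - q.1| <= d /\ `|p.2 - q.2| <= d) ->
  m * dot U u u <= (\int[mu]_(p in U) u p) ^+ 2 +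
    4 * d ^+ 2 * m * (dot U (g 0) (g 0) + dot U (g 1) (g 1)).
Proof.
move=> cU ug hd; have [hu hg _] := ug.
set A := dot U u u; set B := \int[mu]_(p in U) u p.
pose Gam (p : P) : R := ext (g 0) U p ^+ 2 + ext (g 1) U p ^+ 2.
have mext i : measurable_fun setT (ext (g i) U : P -> R).
  by apply/(measurable_restrictT _ mU); have [] := hg i.
have mGam : measurable_fun setT Gam by apply: measurable_funD; exact: measurable_funX.
have Gam0 p : 0 <= Gam p by rewrite addr_ge0 ?sqr_ge0.
set a := dot U (g 0) (g 0) + dot U (g 1) (g 1).
have iGam : (\int[mu]_p (Gam p)%:E = a%:E)%E.
  have i2 i : mu.-integrable U (EFin \o (fun p => g i p * g i p) : P -> \bar R) by exact: L2_mul.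
  transitivity (\int[mu]_(p in U) (g 0 p * g 0 p + g 1 p * g 1 p)%:E)%E.
    rewrite [RHS]integral_mkcond; apply: eq_integral => p _.
    by rewrite /Gam !patchE; case: ifP => _; rewrite -?expr2 // !expr0n addr0.
  have i3 : mu.-integrable U (EFin \o (fun p => g 0 p * g 0 p + g 1 p * g 1 p) : P -> \bar R).
    by have := integrableD mU (i2 0) (i2 1); exact: eq_integrable.
  by rewrite RintegralE // (RintegralD mU (i2 0) (i2 1)).
pose N (h : P) (t : measurableTypeR R) (p : P) : R :=
  \1_(@unit_itv R) t * (chi p * (chi (translate h 1 p) * Gam (translate h t p))).
have N0 h t p : 0 <= N h t p by rewrite !mulr_ge0.
have mN : measurable_fun setT (fun z : (P * measurableTypeR R) * P => N z.1.1 z.1.2 z.2).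
  have m11 := measurableT_comp (@measurable_fst _ _ P (measurableTypeR R))
    (@measurable_fst _ _ (P * measurableTypeR R)%type P).
  have m12 := measurableT_comp (@measurable_snd _ _ P (measurableTypeR R))
    (@measurable_fst _ _ (P * measurableTypeR R)%type P).
  have m2 := @measurable_snd _ _ (P * measurableTypeR R)%type P.
  apply: measurable_funM; first exact: (measurableT_comp (measurable_indic (@measurable_unit R)) m12).
  apply: measurable_funM; first exact: (measurableT_comp mchi m2).
  apply: measurable_funM; last exact: (measurableT_comp mGam measurable_translate3).
  apply: (measurableT_comp mchi).
  apply: (measurableT_comp (measurable_translate2 1) (g := fun z => (z.1.1, z.2))).
  by apply/measurable_fun_pairP.
have d2 : 0 <= 2 * d ^+ 2 by rewrite mulr_ge0 ?sqr_ge0.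
(* Jensen along the segment; [d] bounds [h] whenever both ends lie in [U] *)
have step1 (h : P) : (\int[mu]_p (chi p * (chi (translate h 1 p) *
      (ext u U (translate h 1 p) - ext u U p) ^+ 2))%:E <=
    (2 * d ^+ 2)%:E * \int[leb]_t \int[mu]_p (N h t p)%:E)%E.
  have mNh : measurable_fun setT (fun z : P * measurableTypeR R => (N h z.2 z.1)%:E).
    apply/measurable_EFinP; apply: (measurableT_comp mN (g := fun z : P * measurableTypeR R => ((h, z.2), z.1))).
    apply/measurable_fun_pairP; split; last exact: measurable_fst.
    by apply/measurable_fun_pairP; split; [exact: measurable_cst|exact: measurable_snd].
  rewrite -(@tonelli_swap _ _ P (measurableTypeR R) R (@lebplane R) leb (fun p t => (N h t p)%:E)) //;
    last by move=> p t; rewrite lee_fin.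
  have mT : measurable_fun setT (fun p : P => \int[leb]_t (N h t p)%:E)%E.
    have := @measurable_fun_fubini_tonelli_F _ _ _ _ _ leb (fun z : P * measurableTypeR R => (N h z.2 z.1)%:E).
    by apply => // z; rewrite lee_fin.
  rewrite -(ge0_intZl _ d2 mT); last by move=> p; apply: integral_ge0 => t _; rewrite lee_fin.
  have [hh|hh] := boolP ((`|h.1| <= d) && (`|h.2| <= d)); last first.
    rewrite [leLHS]integral0_eq => [|p _]; last first.
      rewrite /= !chiE; case: (boolP (p \in _)) => [|_]; last by rewrite !mul0r.
      case: (boolP (translate h 1 p \in _)) => [|_]; last by rewrite mul0r mulr0.
      rewrite !inE => U1 Up; have [] := hd _ _ U1 Up; rewrite /translate /= !mul1r.
      by rewrite ![_ + _ - _]addrAC !subrr !add0r => h1 h2; rewrite h1 h2 in hh.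
    apply: integral_ge0 => p _; apply: mule_ge0; first by rewrite lee_fin.
    by apply: integral_ge0 => t _; rewrite lee_fin.
  have /andP[h1 h2] := hh.
  have mu' : measurable_fun setT (ext u U : P -> R).
    by have [mu_ _] := hu; apply/(measurable_restrictT _ mU).
  have mtr : measurable_fun setT (translate h 1 : P -> P) by have [] := scales_area_translate h 1.
  apply: ae_ge0_le_integral => //.
  - by move=> p _; rewrite lee_fin; exact: incr_ge0.
  - apply/measurable_EFinP; apply: measurable_funM => //; apply: measurable_funM.
      exact: measurableT_comp mchi mtr.
    by apply: measurable_funX; apply: measurable_funB => //; exact: measurableT_comp mu' mtr.
  - by move=> p _; rewrite mule_ge0 ?lee_fin //; apply: integral_ge0 => t _; rewrite lee_fin.
  - exact: measurable_funeM.
  have si := segment_identity h oU bU cU ug.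
  apply: (negligibleS _ si) => p /= nS hS; apply: nS => _.
  rewrite !chiE.
  have rhs0 : (0 <= (2 * d ^+ 2)%:E * \int[leb]_t (N h t p)%:E)%E.
    by rewrite mule_ge0 ?lee_fin //; apply: integral_ge0 => t _; rewrite lee_fin.
  case: (boolP (p \in _)) => [Up|_]; last by rewrite !mul0r.
  case: (boolP (translate h 1 p \in _)) => [U1|_]; last by rewrite mul0r mulr0.
  rewrite !patchE Up U1 !mul1r.
  have -> : u (translate h 1 p) - u p = segment_mean U g h p := hS (set_mem Up) (set_mem U1).
  have mk : measurable_fun setT ((fun t => directional U g h (translate h t p)) : measurableTypeR R -> R).
    have mdir : measurable_fun setT (directional U g h : P -> R).
      by apply: measurable_funD; apply: measurable_funM => //; exact: measurable_cst.
    exact: (measurableT_comp mdir (measurableT_comp (measurable_translate h) (measurable_pair1 p))).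
  apply: le_trans (unit_jensen mk) _; rewrite integral_mkcond.
  have mNp : measurable_fun setT (fun t => (N h t p)%:E).
    exact: (measurableT_comp mNh (measurable_pair1 p)).
  rewrite -(ge0_intZl _ d2 mNp); last by move=> t; rewrite lee_fin.
  apply: ge0_le_integral => //.
  - by move=> t _; rewrite patchE; case: ifP => // _; rewrite lee_fin sqr_ge0.
  - apply/(measurable_restrictT _ (@measurable_unit R)); apply: measurable_funTS.
    by apply/measurable_EFinP; exact: measurable_funX.
  - exact: measurable_funeM.
  - move=> t _; rewrite patchE; case: ifPn => ht; last first.
      by rewrite -EFinM lee_fin; exact: mulr_ge0 d2 (N0 _ _ _).
    rewrite -EFinM lee_fin /N !chiE indicE ht Up U1 !mul1r /directional /Gam.
    move: (ext (g 0) U _) (ext (g 1) U _) => x y.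
    have q1 : h.1 ^+ 2 <= d ^+ 2.
      by rewrite -(real_normK (num_real h.1)) lerXn2r ?nnegrE // (le_trans _ h1).
    have q2 : h.2 ^+ 2 <= d ^+ 2.
      by rewrite -(real_normK (num_real h.2)) lerXn2r ?nnegrE // (le_trans _ h2).
    have := sqr_ge0 (h.1 * y - h.2 * x).
    have := ler_wpM2r (addr_ge0 (sqr_ge0 x) (sqr_ge0 y)) (lerD q1 q2).
    by move: (h.1) (h.2) (d ^+ 2) => v w e; lra.
have mL : measurable_fun setT (fun z : P * measurableTypeR R => \int[mu]_p (N z.1 z.2 p)%:E)%E.
  have := @measurable_fun_fubini_tonelli_F _ _ _ _ _ (@lebplane R)
    (fun z : (P * measurableTypeR R) * P => (N z.1.1 z.1.2 z.2)%:E).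
  by apply => //; [exact/measurable_EFinP|move=> z; rewrite lee_fin].
have L0 k t : (0 <= \int[mu]_p (N k t p)%:E)%E by apply: integral_ge0 => p _; rewrite lee_fin.
have step2 : ((2 * m * A - 2 * B ^+ 2)%:E <= (2 * d ^+ 2)%:E * ((4 * m)%:E * a%:E))%E.
  rewrite -(double_variance hu).
  apply: (@le_trans _ _ (\int[mu]_h ((2 * d ^+ 2)%:E * \int[leb]_t \int[mu]_p (N h t p)%:E))%E).
    apply: ge0_le_integral => //.
    - by move=> h _; apply: integral_ge0 => p _; rewrite lee_fin; exact: incr_ge0.
    - have := @measurable_fun_fubini_tonelli_F _ _ _ _ _ (@lebplane R)
        (fun z : P * P => (chi z.2 * (chi (translate z.1 1 z.2) *
          (ext u U (translate z.1 1 z.2) - ext u U z.2) ^+ 2))%:E).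
      have mu' : measurable_fun setT (ext u U : P -> R).
        by have [mu_ _] := hu; apply/(measurable_restrictT _ mU).
      have mt := measurable_translate2 1.
      apply; last by move=> z; rewrite lee_fin; exact: incr_ge0.
      apply/measurable_EFinP; apply: measurable_funM.
        exact: (measurableT_comp mchi measurable_snd).
      apply: measurable_funM; first exact: (measurableT_comp mchi mt).
      apply: measurable_funX; apply: measurable_funB; first exact: (measurableT_comp mu' mt).
      exact: (measurableT_comp mu' measurable_snd).
    - apply: measurable_funeM.
      exact: (@measurable_fun_fubini_tonelli_F _ _ _ _ _ leb
        (fun z : P * measurableTypeR R => \int[mu]_p (N z.1 z.2 p)%:E)%E).
  have mLL : measurable_fun setT (fun h : P => \int[leb]_t \int[mu]_p (N h t p)%:E)%E.
    exact: (@measurable_fun_fubini_tonelli_F _ _ _ _ _ leb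
        (fun z : P * measurableTypeR R => \int[mu]_p (N z.1 z.2 p)%:E)%E).
  rewrite (ge0_intZl _ d2 mLL); last by move=> h; apply: integral_ge0 => t _.
  apply: lee_wpmul2l; first by rewrite lee_fin.
  rewrite (@tonelli_swap _ _ P (measurableTypeR R) R (@lebplane R) leb (fun h t => \int[mu]_p (N h t p)%:E)%E) //.
  apply: (@le_trans _ _ (\int[leb]_(t in @unit_itv R) ((4 * m)%:E * a%:E))%E); last first.
    by rewrite integral_cst ?[X in (_ * X)%E]leb_unit ?mule1 //; exact: measurable_unit.
  rewrite [leRHS]integral_mkcond; apply: ge0_le_integral => //.
  - by move=> t _; apply: integral_ge0 => h _.
  - exact: (@measurable_fun_fubini_tonelli_G _ _ _ _ _ (@lebplane R)
        (fun z : P * measurableTypeR R => \int[mu]_p (N z.1 z.2 p)%:E)%E).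
  - by apply/(measurable_restrictT _ (@measurable_unit R)); exact: measurable_cst.
  move=> t _; rewrite patchE; case: ifPn => ht; last first.
    rewrite integral0_eq // => h _; rewrite integral0_eq // => p _.
    by rewrite /N indicE (negbTE ht) mul0r.
  have := ht; rewrite inE /unit_itv /= in_itv /= => /andP[t0 t1].
  rewrite -iGam.
  have shiftN h : (\int[mu]_p (N h t p)%:E =
      \int[mu]_z (chi (translate h (- t) z) * (chi (translate h (1 - t) z) * Gam z))%:E)%E.
    have sc := scales_area_translate h (- t).
    have mNh : measurable_fun setT (fun p : P => (N h t p)%:E).
      by apply/measurable_EFinP; exact: (measurableT_comp mN (measurable_pair1 (h, t))).
    have := ge0_integral_scales sc ltr01 mNh (fun p => _); rewrite mul1e => <-; last first.
      by move=> p; rewrite lee_fin.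
    apply: eq_integral => z _; rewrite /N indicE ht mul1r; congr (chi _ * (chi _ * Gam _))%:E.
      by rewrite /translate /=; congr pair; ring.
    by case: z => x y; rewrite /translate /=; congr pair; ring.
  have mc s : measurable_fun setT (fun z : P * P => (chi (translate z.1 s z.2) * Gam z.2)%:E).
    apply/measurable_EFinP; apply: measurable_funM.
      exact: (measurableT_comp mchi (measurable_translate2 s)).
    exact: (measurableT_comp mGam measurable_snd).
  have mcz h s : measurable_fun setT (fun z : P => (chi (translate h s z) * Gam z)%:E).
    exact: (measurableT_comp (mc s) (measurable_pair1 h)).
  have mch s : measurable_fun setT (fun h : P => \int[mu]_z (chi (translate h s z) * Gam z)%:E)%E.
    have := @measurable_fun_fubini_tonelli_F _ _ _ _ _ (@lebplane R)
      (fun z : P * P => (chi (translate z.1 s z.2) * Gam z.2)%:E).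
    by apply => // z; rewrite lee_fin mulr_ge0.
  have bound s : 2^-1 <= `|s| -> (forall h z, chi (translate h (- t) z) *
      (chi (translate h (1 - t) z) * Gam z) <= chi (translate h s z) * Gam z) ->
      (\int[mu]_h \int[mu]_p (N h t p)%:E <= (4 * m)%:E * \int[mu]_z (Gam z)%:E)%E.
    move=> s2 hs; apply: le_trans (convolution_bound mGam Gam0 s2).
    apply: ge0_le_integral => //.
    - exact: (measurableT_comp mL (measurable_pair2 t)).
    move=> h _; rewrite shiftN; apply: ge0_le_integral => //.
    - by move=> z _; rewrite lee_fin !mulr_ge0.
    - apply/measurable_EFinP; apply: measurable_funM.
        by apply: measurableT_comp => //; have [] := scales_area_translate h (- t).
      apply: measurable_funM => //.
      by apply: measurableT_comp => //; have [] := scales_area_translate h (1 - t).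
    - by move=> z _; rewrite lee_fin.
  have [t2|t2] := lerP 2^-1 t.
    apply: (bound (- t)); first by rewrite normrN ger0_norm.
    by move=> h z; rewrite ler_wpM2l // ler_piMl.
  apply: (bound (1 - t)); first by rewrite ger0_norm; lra.
  by move=> h z; rewrite ler_piMl // mulr_ge0.
move: step2; rewrite -!EFinM lee_fin => step2.
by move: step2; rewrite -/a; move: (d ^+ 2) (B ^+ 2) => e b; lra.
Qed.

End Domain.
End Poincare.

(** * Weak gradients from increments *)
Section Converse.
Variable R : realType.
Local Notation P := (measurableTypeR R * measurableTypeR R)%type.
Local Notation mu := (leb2 R).
Local Notation leb := (@lebesgue_measure R).
Local Notation ext u U := (u \_ U).

Lemma continuous_measurable_plane (f : R * R -> R) : continuous f ->
  measurable_fun setT (f : P -> measurableTypeR R).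
Proof.
move=> cf; apply: (measurability _ (RGenOpens.measurableE R)).
move=> _ [_ [a [b ->]] <-]; rewrite setTI.
apply: open_measurable_plane; apply: open_comp; last exact: itv_open.
by move=> p _; exact: cf.
Qed.

Lemma mean_value_bound (k k' : R -> R) (M s : R) : (forall t : R, is_derive t 1 k (k' t)) ->
  (forall t, `|k' t| <= M) -> `|k s - k 0| <= M * `|s|.
Proof.
move=> dk kM; have ck := is_derive_continuous dk.
have [s0|s0] := leP 0 s.
  have [//|c _ ->] := @MVT_segment R k k' 0 s s0 (fun t _ => dk t).
    exact: continuous_subspaceT.
  by rewrite subr0 normrM ler_wpM2r.
have ckw : {within `[s, 0], continuous k} by exact: continuous_subspaceT.
have [c _ e] := @MVT_segment R k k' s 0 (ltW s0) (fun t _ => dk t) ckw.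
by rewrite distrC e sub0r normrM normrN ler_wpM2r.
Qed.

Section TestFunctions.
Variables (U : set (R * R)) (phi : R * R -> R) (i : 'I_2).
Hypothesis (tphi : test_function U phi).
Let v := basis_vec R i.

Lemma test_continuous : continuous phi.
Proof. by case: tphi => s _ _; have [] := s [::]. Qed.

Lemma test_pderiv_continuous : continuous (pderiv i phi).
Proof. by case: tphi => s _ _; have [] := s [:: i]. Qed.

Lemma test_line p (t : R) :
  is_derive t 1 (fun t => phi (translate v t p)) (pderiv i phi (translate v t p)).
Proof.
have [s _ _] := tphi; have [_ /(_ i (translate v t p)) d] := s [::].
have e : (fun h : R => h^-1 *: (((fun t => phi (translate v t p)) \o shift t) (h *: 1) -
      phi (translate v t p))) =
    (fun h : R => h^-1 *: ((phi \o shift (translate v t p)) (h *: v) - phi (translate v t p))).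
  apply/funext => h; congr (_ *: (phi _ - _)) => /=.
  rewrite /translate /= /GRing.scale /= mulr1; congr pair.
    by rewrite /= /GRing.scale /=; ring.
  by rewrite /= /GRing.scale /=; ring.
by split; [rewrite /derivable e|rewrite /derive e].
Qed.

Lemma test_off p : ~ support_of phi p -> phi p = 0.
Proof.
move=> np; apply/eqP; apply: contra_notT np => n0; exact: subset_closure.
Qed.

Lemma test_pderiv_off p : ~ support_of phi p -> pderiv i phi p = 0.
Proof.
move=> np; rewrite /pderiv -(@derive_cst _ _ _ (0 : R) p v).
apply: near_eq_derive.
have : nbhs p (~` support_of phi).
  by apply: open_nbhs_nbhs; split => //; apply: closed_openC; exact: closed_closure.
by apply: filterS => q /test_off.
Qed.

Lemma compact_bound (f : R * R -> R) : continuous f ->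
  (forall p, ~ support_of phi p -> f p = 0) -> exists2 M, 0 <= M & forall p, `|f p| <= M.
Proof.
move=> cf f0; have [_ cK _] := tphi.
have : compact (f @` support_of phi).
  by apply: continuous_compact => //; exact: continuous_subspaceT.
move=> /compact_bounded[M [_ hM]]; exists (`|M| + 1); first by rewrite addr_ge0.
move=> p; have [Kp|nK] := pselect (support_of phi p).
  by apply: (hM (`|M| + 1)); [rewrite (le_lt_trans (ler_norm _)) // ltrDl|exists p].
by rewrite f0 // normr0 addr_ge0.
Qed.

Lemma test_margin : open U ->
  exists2 e0 : R, 0 < e0 & forall p t, support_of phi p -> `|t| < e0 -> U (translate v t p).
Proof.
move=> oU; have [_ cK KU] := tphi.
have ct : continuous (fun z : (R * R) * R => translate v z.2 z.1).
  rewrite (_ : (fun z => _) = fun z : (R * R) * R => z.1 + z.2 *: v); last first.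
    by apply/funext => -[[x y] t].
  by move=> z; apply: cvgD; [exact: cvg_fst|apply: cvgZr_tmp; exact: cvg_snd].
have oV : open [set z : (R * R) * R | U (translate v z.2 z.1)].
  by apply: open_comp oU => z _; exact: ct.
have := (compact_near_coveringP (support_of phi)).1 cK R (nbhs (0 : R))
  (fun t p => U (translate v t p)) _.
have cov p : support_of phi p -> \forall x \near p & t \near nbhs (0 : R), U (translate v t x).
  move=> Kp; have := open_nbhs_nbhs (conj oV (_ : [set z | U (translate v z.2 z.1)] (p, 0))).
  by apply; rewrite /= /translate !mul0r !addr0; case: p Kp => x y /KU.
move=> /(_ _ cov) /nbhs_ballP[e0 e00 he]; exists e0 => // p t Kp te.
by apply: he Kp; rewrite /ball /= sub0r normrN.
Qed.

End TestFunctions.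

Lemma translate_scale (w : R * R) (e t : R) p : translate (e *: w) t p = translate w (t * e) p.
Proof. by rewrite /translate /= /GRing.scale /= !mulrA. Qed.

Lemma directional_basis (U : set (R * R)) (g : 'I_2 -> R * R -> R) i e p :
  directional U g (e *: basis_vec R i) p = e * ext (g i) U p.
Proof.
rewrite /directional /basis_vec; have [->|i1] := eqVneq i 0.
  by rewrite /= /GRing.scale /= mulr1 mulr0 mul0r addr0.
have -> : i = 1 by apply: val_inj; case: i i1 => -[|[|]].
by rewrite /= /GRing.scale /= mulr1 mulr0 mul0r add0r.
Qed.

(** The difference quotients of a test function converge to its derivative, and
    those of [u] in the same direction have become means of [g]. Only short
    segments parallel to the axes matter, since the support of the test function
    stays away from the boundary. *)
Theorem weak_gradient_of_segments (U : set (R * R)) u g :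
  open U -> bounded_set U -> in_L2 U u -> (forall i, in_L2 U (g i)) ->
  (forall i, exists2 e0 : R, 0 < e0 & forall e, 0 < e -> e < e0 ->
    {ae mu, forall p, U p -> U (translate (e *: basis_vec R i) 1 p) ->
       u (translate (e *: basis_vec R i) 1 p) - u p =
       segment_mean U g (e *: basis_vec R i) p}) ->
  weak_gradient U u g.
Proof.
move=> oU bU hu hg hs i phi tphi; set v := basis_vec R i; set psi := pderiv i phi.
have mU : measurable (U : set P) by exact: open_measurable_plane.
have fU : (mu U < +oo)%E by exact: bounded_finite_measure.
have [iu _] := L2_ext mU fU hu; have [ig _] := L2_ext mU fU (hg i).
have cphi := test_continuous tphi; have cpsi := test_pderiv_continuous (i := i) tphi.
have mphi := continuous_measurable_plane cphi; have mpsi := continuous_measurable_plane cpsi.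
have [K K0 hK] := compact_bound tphi cphi (@test_off phi).
have [M M0 hM] := compact_bound tphi cpsi (@test_pderiv_off phi i).
have [e1 e10 he1] := test_margin i tphi oU; have [e2 e20 he2] := hs i.
pose e0 := Num.min e1 e2; have e00 : 0 < e0 by rewrite lt_min e10.
pose e n : R := e0 * n.+2%:R^-1.
have en0 n : 0 < e n by rewrite mulr_gt0 ?invr_gt0.
have en1 n : e n < e0.
  by rewrite /e ltr_pdivrMr ?ltr0n // ltr_pMr // ltr1n.
have elt1 n : e n < e1 by rewrite (lt_le_trans (en1 n)) // ge_min lexx.
have elt2 n : e n < e2 by rewrite (lt_le_trans (en1 n)) // ge_min lexx orbT.
have ecv : e n @[n --> \oo] --> (0 : R).
  rewrite -[X in _ --> X](mulr0 e0); apply: cvgM; first exact: cvg_cst.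
  by have := @cvg_harmonic R; rewrite -cvg_shiftS.
have mtr h t (k : P -> R) : measurable_fun setT k -> measurable_fun setT (fun p => k (translate h t p)).
  by move=> mk; apply: (measurableT_comp mk); have [] := scales_area_translate h t.
have line p (t : R) : is_derive t 1 (fun t => phi (translate v t p)) (psi (translate v t p)).
  exact (@test_line U phi i tphi p t).
have tr0 p : translate v 0 p = p by case: p => x y; rewrite /translate !mul0r !addr0.
have lip p s : `|phi (translate v s p) - phi p| <= M * `|s|.
  by have := @mean_value_bound _ _ M s (line p) (fun t => hM _); rewrite tr0.
pose q n (p : P) : R := (e n)^-1 * (phi (translate v (- e n) p) - phi p).
have qM n p : `|q n p| <= M.
  rewrite /q normrM (gtr0_norm (_ : 0 < (e n)^-1)) ?invr_gt0 // mulrC ler_pdivrMr //.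
  by have := lip p (- e n); rewrite normrN (gtr0_norm (en0 n)).
have mq n : measurable_fun setT (q n : P -> R).
  apply: measurable_funM; first exact: measurable_cst.
  by apply: measurable_funB => //; exact: mtr.
pose X n := \int[mu]_p (ext u U p * q n p).
have Xlim : X n @[n --> \oo] --> \int[mu]_p (ext u U p * - psi p).
  pose f_ n (p : P) := (ext u U p * q n p)%:E.
  have iX n : mu.-integrable setT (EFin \o (fun p => ext u U p * q n p)).
    exact: (integrable_mulr_bounded (K := M)).
  have mext : measurable_fun setT (ext u U : P -> R) by have /integrableP[/measurable_EFinP] := iu.
  have [] := @dominated_convergence _ P R mu setT measurableT f_
     (fun p => (ext u U p * - psi p)%:E) (fun p => M%:E * `|(ext u U p)%:E|)%E.
  - by move=> n; apply/measurable_EFinP; apply: measurable_funM => //; exact: mq.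
  - by apply/measurable_EFinP; apply: measurable_funM => //; exact: measurable_funN.
  - apply: aeW => p _; apply/fine_cvgP; split; first exact: nearW.
    apply: cvgM; first exact: cvg_cst.
    have /is_derive1_caratheodory[k [kE ck k0]] := line p 0.
    rewrite (_ : (fun n => _) = fun n => - k (- e n)); last first.
      apply/funext => n; rewrite /q; have := kE (- e n); rewrite tr0 => ->.
      by field; rewrite gt_eqF.
    rewrite tr0 in k0; rewrite -k0; apply: cvgN.
    have ecN : - e n @[n --> \oo] --> (0 : R) by rewrite -[X in _ --> X]oppr0; exact: cvgN.
    exact: (@cvg_comp _ _ _ (fun n => - e n) k \oo (nbhs (0 : R)) (nbhs (k 0)) ecN ck).
  - by apply: integrableZl => //; exact: (integrable_abse iu).
  - apply: aeW => p n _; rewrite /f_ /= -EFinM lee_fin normrM mulrC ler_wpM2r //; exact: qM.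
  move=> fi _ cX; rewrite /X.
  have : fine (\int[mu]_p f_ n p)%E @[n --> \oo] --> fine (\int[mu]_p (ext u U p * - psi p)%:E)%E.
    by apply: fine_cvg; rewrite fineK //; exact: integrable_fin_num.
  exact.
pose Y := \int[mu]_p (ext (g i) U p * phi p).
have [C hC] : exists C, C = \int[mu]_p `|ext (g i) U p| by eexists.
have C0 : 0 <= C by rewrite hC; apply: Rintegral_ge0.
have XY n : `|X n - Y| <= M * e n * C.
  have iphi (w : P -> R) h t : mu.-integrable setT (EFin \o w) ->
      mu.-integrable setT (EFin \o (fun p => w p * phi (translate h t p))).
    move=> iw; apply: (integrable_mulr_bounded (K := K)) => //; exact: mtr.
  have iphi0 (w : P -> R) : mu.-integrable setT (EFin \o w) ->
      mu.-integrable setT (EFin \o (fun p => w p * phi p)).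
    by move=> iw; apply: (integrable_mulr_bounded (K := K)).
  pose h := e n *: v.
  have trh t p : translate h t p = translate v (t * e n) p by exact: translate_scale.
  have iu1 : mu.-integrable setT (EFin \o (fun p : P => ext u U (translate h 1 p))).
    exact: (integrable_scales (scales_area_translate h 1) ltr01 iu).
  have eX : e n * X n = \int[mu]_p (ext u U (translate h 1 p) * phi p) - \int[mu]_p (ext u U p * phi p).
    have -> : \int[mu]_p (ext u U (translate h 1 p) * phi p) =
       \int[mu]_p (ext u U p * phi (translate h (-1) p)).
      have := integral_translate h 1 (iphi _ h (-1) iu); rewrite /= => <-.
      apply: eq_Rintegral => -[x y] _; congr (_ * phi _).
      by rewrite /translate /=; congr pair; ring.
    rewrite -(RintegralB2 (iphi _ h (-1) iu) (iphi0 _ iu)) /X.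
    rewrite -(RintegralZl (e n) measurableT (integrable_mulr_bounded iu (mq n) (qM n))).
    apply: eq_Rintegral => p _; rewrite trh mulN1r /q.
    by field; rewrite gt_eqF.
  have eS : \int[mu]_p (ext u U (translate h 1 p) * phi p) - \int[mu]_p (ext u U p * phi p) =
      \int[mu]_p (segment_mean U g h p * phi p).
    rewrite -(RintegralB2 (iphi0 _ iu1) (iphi0 _ iu)).
    have im := segment_mean_integrable oU bU hg h.
    have iA := iphi0 _ iu1; have iB := iphi0 _ iu; have iM := iphi0 _ im.
    rewrite /Rintegral; congr fine; apply: ae_eq_integral => //.
    - have := integrableB measurableT iA iB; move=> /integrableP[mm _].
      by move: mm; congr (measurable_fun _ _).
    - by have /integrableP[] := iM.
    apply: (negligibleS _ (he2 _ (en0 n) (elt2 n))) => p /= nS hS; apply: nS => _.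
    have [Kp|nK] := pselect (support_of phi p); last by rewrite (test_off nK) !mulr0 subr0.
    have Up : U p by have [_ _] := tphi; apply.
    have Up1 : U (translate h 1 p).
      by rewrite trh mul1r; apply: he1 => //; rewrite gtr0_norm.
    by rewrite -mulrBl !patchE !mem_set // hS.
  have iY := segment_mean_test_integrable oU bU hg h mphi hK.
  have eT := segment_mean_test oU bU hg h mphi hK.
  have eG t : \int[mu]_p (directional U g h p * phi (translate h (- t) p)) =
      e n * \int[mu]_p (ext (g i) U p * phi (translate h (- t) p)).
    rewrite -(RintegralZl (e n) measurableT (iphi _ h (- t) ig)).
    by apply: eq_Rintegral => p _; rewrite directional_basis mulrA.
  have lu : leb (@unit_itv R) = 1%E := @leb_unit R.
  have mI := @measurable_unit R.
  have ic (c : R) : leb.-integrable (@unit_itv R) (EFin \o (fun=> c)).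
    apply/integrableP; split; first exact/measurable_EFinP.
    by rewrite (integral_cst leb mI `|c|%:E) [X in (_ * X)%E]lu mule1 ltry.
  have XYe : e n * (X n - Y) = \int[leb]_(t in @unit_itv R)
      (\int[mu]_p (directional U g h p * phi (translate h (- t) p)) - e n * Y).
    rewrite mulrBr eX eS eT (RintegralB mI iY (ic (e n * Y))).
    by rewrite Rintegral_cst // [X in fine X]lu mulr1.
  have bound t : unit_itv t -> `|\int[mu]_p (directional U g h p * phi (translate h (- t) p)) - e n * Y|
      <= e n * (M * e n * C).
    rewrite /unit_itv /= in_itv /= => /andP[t0 t1].
    rewrite eG -mulrBr normrM (gtr0_norm (en0 n)) /Y.
    apply: ler_wpM2l; first exact: ltW.
    rewrite -(RintegralB2 (iphi _ h (- t) ig) (iphi0 _ ig)).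
    have iB : mu.-integrable setT (EFin \o (fun p : P =>
        ext (g i) U p * phi (translate h (- t) p) - ext (g i) U p * phi p)).
      exact: (integrableB measurableT (iphi _ h (- t) ig) (iphi0 _ ig)).
    have lB := le_normr_Rintegral measurableT iB.
    refine (le_trans lB _).
    rewrite hC -(RintegralZl (M * e n) measurableT (integrable_norm ig)).
    apply: le_Rintegral => //.
    - exact: (integrable_norm iB).
    - by have := integrableZl measurableT (M * e n) (integrable_norm ig); exact: eq_integrable.
    - move=> p _ /=; rewrite -mulrBr normrM mulrC ler_wpM2r //.
      rewrite trh; apply: le_trans (lip p _) _; rewrite ler_wpM2l // normrM normrN (ger0_norm t0).
      by rewrite (gtr0_norm (en0 n)); apply: ler_piMl; first exact: ltW.
  rewrite -(ler_pM2l (en0 n)) -[e n in X in X <= _](gtr0_norm (en0 n)) -normrM XYe.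
  have iD : leb.-integrable (@unit_itv R) (EFin \o (fun t =>
      \int[mu]_p (directional U g h p * phi (translate h (- t) p)) - e n * Y)).
    exact: (integrableB mI iY (ic (e n * Y))).
  apply: le_trans (le_normr_Rintegral mI iD) _.
  have -> : e n * (M * e n * C) = \int[leb]_(t in @unit_itv R) (e n * (M * e n * C)).
    by rewrite Rintegral_cst // [X in fine X]lu mulr1.
  by apply: le_Rintegral => //; exact: integrable_norm iD.
have Ylim : X n @[n --> \oo] --> Y.
  apply/cvgrPdist_le => d d0.
  have MC0 : 0 < M * C + 1 by rewrite ltr_wpDl // mulr_ge0.
  have dM : 0 < d / (M * C + 1) by rewrite divr_gt0.
  have /cvgrPdist_le/(_ _ dM) := ecv; apply: filterS => n; rewrite sub0r normrN (gtr0_norm (en0 n)) => en.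
  rewrite distrC; apply: le_trans (XY n) _; rewrite ler_pdivlMr // in en.
  by apply: le_trans en; have := en0 n; lra.
have e3 : \int[mu]_p (ext u U p * - psi p) = Y by apply: (cvg_unique _ Xlim Ylim); exact: norm_hausdorff.
rewrite !(Rintegral_ext U) -/psi -/Y -e3.
have ipsi : mu.-integrable setT (EFin \o (fun p => ext u U p * psi p)).
  exact: (integrable_mulr_bounded (K := M)).
have -> : \int[mu]_p (ext u U p * - psi p) = -1 * \int[mu]_p (ext u U p * psi p).
  by rewrite -(RintegralZl (-1) measurableT ipsi); apply: eq_Rintegral => p _; ring.
by rewrite mulN1r opprK.
Qed.

End Converse.

(** * Completeness of the space of square integrable functions *)
Section L2Complete.
Variable R : realType.
Local Notation P := (measurableTypeR R * measurableTypeR R)%type.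
Local Notation mu := (leb2 R).
Variable D : set (R * R).
Hypotheses (mD : measurable (D : set P)) (finD : (mu D < +oo)%E).
Implicit Types u v : R * R -> R.

Lemma L2_sub u v : in_L2 D u -> in_L2 D v -> in_L2 D (fun p => u p - v p).
Proof.
move=> hu hv; have := L2_lin mD (-1) hv hu; congr in_L2.
by apply/funext => p; rewrite mulN1r addrC.
Qed.

Lemma L2_abs u : in_L2 D u -> in_L2 D (fun p => `|u p|).
Proof.
move=> [mu_ iu]; split; first exact: measurableT_comp.
by apply: eq_integrable iu => // p _; rewrite real_normK // num_real.
Qed.

Lemma dot_abs u : dot D (fun p => `|u p|) (fun p => `|u p|) = dot D u u.
Proof. by apply: eq_Rintegral => p _; rewrite -normrM ger0_norm // -expr2 sqr_ge0. Qed.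

Lemma dotE u : in_L2 D u -> (\int[mu]_(p in D) ((u p) ^+ 2)%:E = (dot D u u)%:E)%E.
Proof. by move=> hu; rewrite -(RintegralE_D mD (L2_mul mD hu hu)); apply: eq_integral. Qed.

Lemma limn_einf_le_ub (h : nat -> \bar R) c : (forall n, (h n <= c)%E) -> (limn_einf h <= c)%E.
Proof.
move=> hc; rewrite limn_einf_lim; apply: lime_le; first exact: is_cvg_einfs.
by apply: nearW => n; apply: le_trans (hc n); apply: ereal_inf_lbound; exists n => /=.
Qed.

Lemma cvg_absolute_increments (w : nat -> R) (c : R) :
  (forall n, \sum_(0 <= k < n) `|w k.+1 - w k| <= c) -> cvgn w.
Proof.
move=> hc; have : cvgn (series (telescope w)).
  apply: normed_cvg; apply: nondecreasing_is_cvgn.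
    by apply: nondecreasing_series => k _ _; exact: normr_ge0.
  by exists c => _ [n _ <-]; exact: hc.
move=> cs; rewrite (_ : w = series (telescope w) \+ cst (w 0%N)); last first.
  by apply/funext => n; rewrite telescopeK /= subrK.
by apply: is_cvgD => //; exact: is_cvg_cst.
Qed.

(** A sequence whose consecutive distances are summable converges almost
    everywhere, since the sum of the absolute increments is integrable. *)
Lemma L2_fast_cauchy (w : nat -> R * R -> R) : (forall n, in_L2 D (w n)) ->
  (forall k, dot D (fun p => w k.+1 p - w k p) (fun p => w k.+1 p - w k p) <= (4 ^+ k)^-1) ->
  {ae mu, forall p, D p -> cvgn (w ^~ p)}.
Proof.
move=> hw hd; pose d k p := w k.+1 p - w k p.
have hdL k : in_L2 D (d k) by exact: L2_sub.
pose m := fine (mu D); have m0 : 0 <= m by exact: fine_ge0.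
have intd k : (\int[mu]_(p in D) `|d k p|%:E <= ((m + 1) * (2 ^+ k)^-1)%:E)%E.
  rewrite (RintegralE_D mD (L2_integrable mD finD (L2_abs (hdL k)))) lee_fin.
  have B0 : 0 <= (m + 1) * (2 ^+ k)^-1 by rewrite mulr_ge0 ?invr_ge0 ?exprn_ge0 // addr_ge0.
  rewrite -(@ler_pXn2r _ 2) // ?nnegrE ?Rintegral_ge0 //.
  apply: le_trans (cauchy_schwarz_cst mD finD (L2_abs (hdL k))) _.
  rewrite dot_abs; apply: (@le_trans _ _ (m * (4 ^+ k)^-1)); first exact: (ler_wpM2l m0 (hd k)).
  rewrite exprMn exprVn -exprM mulnC exprM (_ : 2 ^+ 2 = 4 :> R); last by ring.
  apply: ler_wpM2r; first by rewrite invr_ge0 exprn_ge0.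
  by nra.
pose s p : \bar R := (\sum_(k <oo) `|d k p|%:E)%E.
have md k : measurable_fun (D : set P) (fun p => `|d k p|%:E).
  by have [h _] := L2_abs (hdL k); exact/measurable_EFinP.
have is_ : mu.-integrable D (s : P -> \bar R).
  apply/integrableP; split.
    apply: ge0_emeasurable_sum => [k p _ _|k _]; first by rewrite lee_fin.
    exact: md.
  have -> : (\int[mu]_(p in D) `|s p| = \int[mu]_(p in D) s p)%E.
    by apply: eq_integral => p _; rewrite gee0_abs // nneseries_ge0.
  rewrite integral_nneseries //.
  apply: (@le_lt_trans _ _ (2 * (m + 1))%:E); last exact: ltry.
  apply: lime_le; first by apply: is_cvg_nneseries => k _ _; apply: integral_ge0.
  apply: nearW => n.
  apply: (@le_trans _ _ (\sum_(0 <= k < n) ((m + 1) * (2 ^+ k)^-1)%:E)%E).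
    by apply: lee_sum => k _; exact: intd.
  rewrite sumEFin lee_fin -mulr_sumr mulrC ler_wpM2r ?addr_ge0 //.
  have -> : \sum_(0 <= k < n) (2 ^+ k)^-1 = 2 - 2 * (2 ^+ n)^-1 :> R.
    elim: n => [|n IH]; first by rewrite big_geq // expr0; field.
    rewrite big_nat_recr //= IH exprS; have : (2 : R) ^+ n != 0 by rewrite expf_neq0.
    by move=> n0; field.
  by rewrite gerBl mulr_ge0 // invr_ge0 exprn_ge0.
apply: (negligibleS _ (integrable_ae mD is_)) => p /= nS hp; apply: nS => Dp.
apply: (@cvg_absolute_increments _ (fine (s p))) => n.
rewrite -lee_fin fineK; last exact: hp.
by rewrite -sumEFin; exact: nneseries_lim_ge.
Qed.

(** The limit is the pointwise limit of a fast subsequence; Fatou's lemma bounds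
    its distance to the terms of the whole sequence. *)
Theorem L2_complete (u : nat -> R * R -> R) : (forall n, in_L2 D (u n)) ->
  (forall e : R, 0 < e -> exists N, forall m n, (N <= m)%N -> (N <= n)%N ->
     dot D (fun p => u m p - u n p) (fun p => u m p - u n p) < e) ->
  exists2 v, in_L2 D v &
    dot D (fun p => u n p - v p) (fun p => u n p - v p) @[n --> \oo] --> 0.
Proof.
move=> hu hC.
have [g hg] : {g : nat -> nat & forall k m n, (g k <= m)%N -> (g k <= n)%N ->
    dot D (fun p => u m p - u n p) (fun p => u m p - u n p) < (4 ^+ k)^-1}.
  apply: (@choice _ _ (fun k N => forall m n, (N <= m)%N -> (N <= n)%N ->
    dot D (fun p => u m p - u n p) (fun p => u m p - u n p) < (4 ^+ k)^-1)) => k.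
  by have [|N hN] := hC (4 ^+ k)^-1; [rewrite invr_gt0 exprn_gt0|exists N].
pose f k := (\sum_(j < k.+1) (g j).+1)%N.
have gf k : (g k <= f k)%N by rewrite /f big_ord_recr /=; apply: leq_trans (leqnSn _) (leq_addl _ _).
have fS k : (f k <= f k.+1)%N by rewrite /f [X in (_ <= X)%N]big_ord_recr /= leq_addr.
have fm k l : (k <= l)%N -> (f k <= f l)%N.
  by elim: l => [|l IH]; [rewrite leqn0 => /eqP->|
    rewrite leq_eqVlt => /predU1P[->//|/IH h]; exact: leq_trans h (fS l)].
pose w k := u (f k).
have hw k : in_L2 D (w k) by exact: hu.
have cw : {ae mu, forall p, D p -> cvgn (w ^~ p)}.
  apply: L2_fast_cauchy => // k; apply/ltW/hg; first exact: leq_trans (gf k) (fS k).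
  exact: gf.
pose v p := fine (limn_esup (fun k => (w k p)%:E)).
have mv : measurable_fun (D : set P) v.
  apply: measurableT_comp; first exact: fine_measurable.
  by apply: measurable_fun_limn_esup => k; apply/measurable_EFinP; have [] := hw k.
have vlim p : cvgn (w ^~ p) -> w k p @[k --> \oo] --> v p.
  move=> /cvg_ex[l hl]; suff -> : v p = l by [].
  have hl' : (w k p)%:E @[k --> \oo] --> l%:E by apply: cvg_EFin; [exact: nearW|].
  by rewrite /v (cvg_limn_einf_sup hl').2.
have key e N n : (forall m n, (N <= m)%N -> (N <= n)%N ->
     dot D (fun p => u m p - u n p) (fun p => u m p - u n p) < e) -> (N <= n)%N ->
   (\int[mu]_(p in D) ((u n p - v p) ^+ 2)%:E <= e%:E)%E.
  move=> hN Nn; have [K hK] : exists K, (N <= f K)%N.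
    by exists N; elim: (N) => // j IH; apply: leq_ltn_trans IH _; rewrite /f [X in (_ < X)%N]big_ord_recr /= addnS ltnS leq_addr.
  pose h k p := ((u n p - w (k + K)%N p) ^+ 2)%:E.
  have hL k : in_L2 D (fun p => u n p - w (k + K)%N p) by apply: L2_sub.
  have mh k : measurable_fun (D : set P) (h k).
    by apply/measurable_EFinP; apply: measurable_funX; have [] := hL k.
  have h0 k p : D p -> (0 <= h k p)%E by move=> _; rewrite lee_fin sqr_ge0.
  apply: (@le_trans _ _ (\int[mu]_(p in D) limn_einf (h ^~ p))%E).
    apply: ae_ge0_le_integral => //.
    - by move=> p _; rewrite lee_fin sqr_ge0.
    - apply/measurable_EFinP; apply: measurable_funX; apply: measurable_funB => //.
      by have [] := hu n.
    - move=> p _; rewrite limn_einf_lim; apply: lime_ge; first exact: is_cvg_einfs.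
      by apply: nearW => k; apply: le_ereal_inf_tmp => _ [j _ <-]; rewrite lee_fin sqr_ge0.
    - rewrite /limn_einf; apply: measurableT_comp => //.
      by apply: measurable_fun_limn_esup => k; apply: measurableT_comp => //.
    apply: (negligibleS _ cw) => p /= nS hp; apply: nS => Dp.
    have : h k p @[k --> \oo] --> ((u n p - v p) ^+ 2)%:E.
      apply: cvg_EFin; first exact: nearW.
      have cwp := vlim _ (hp Dp); rewrite -(cvg_shiftn K) in cwp.
      have c1 : u n p - w (k + K)%N p @[k --> \oo] --> u n p - v p.
        by apply: cvgB => //; exact: cvg_cst.
      by apply: cvgM.
    by move=> /cvg_limn_einf_sup[-> _].
  apply: le_trans (fatou mu mD mh h0) _; apply: limn_einf_le_ub => k.
  rewrite /h dotE // lee_fin; apply/ltW/hN => //.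
  by apply: leq_trans hK _; apply: fm; exact: leq_addl.
have vL : in_L2 D v.
  have [N hN] := hC 1 ltr01.
  have h : in_L2 D (fun p => u N p - v p).
    have muv : measurable_fun (D : set P) (fun p => u N p - v p).
      by apply: measurable_funB => //; have [] := hu N.
    split => //; apply/integrableP; split.
      by apply/measurable_EFinP; exact: measurable_funX.
    apply: (@le_lt_trans _ _ 1%:E); last exact: ltry.
    apply: le_trans (key _ _ _ hN (leqnn N)).
    rewrite le_eqVlt; apply/orP; left; apply/eqP/eq_integral => p _; by rewrite gee0_abs // lee_fin sqr_ge0.
  have := L2_sub (hu N) h; congr in_L2; apply/funext => p; ring.
have uvL n : in_L2 D (fun p => u n p - v p) by exact: L2_sub.
exists v => //.
apply/cvgrPdist_le => e e0; have [N hN] := hC _ e0.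
exists N => // n /= Nn; rewrite sub0r normrN ger0_norm ?dot_ge0 //.
by rewrite -lee_fin -dotE //; exact: key hN Nn.
Qed.

End L2Complete.

(** * The space H1 of a convex domain *)

(** Bundled, so that the algebraic structure of the space below can be inferred. *)
Record domain (R : realType) := Domain {
  dom_set :> set (R * R);
  dom_nonempty : dom_set !=set0;
  dom_open : open dom_set;
  dom_bounded : bounded_set dom_set;
  dom_segment : segment_closed dom_set }.

Section H1.
Variable R : realType.
Local Notation P := (measurableTypeR R * measurableTypeR R)%type.
Local Notation mu := (leb2 R).
Variable U : domain R.

Lemma dom_measurable : measurable (U : set P).
Proof. apply: open_measurable_plane; exact: dom_open. Qed.

Lemma dom_finite : (mu U < +oo)%E.
Proof. apply: bounded_finite_measure; [exact: dom_bounded|exact: dom_measurable]. Qed.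

Let mU := dom_measurable.
Let fU := dom_finite.

Local Notation fields := ((R * R -> R) * ('I_2 -> R * R -> R))%type.

Definition H1_pred : {pred fields} := fun x => `[< in_H1 U x.1 x.2 >].

Lemma test_L2 phi : test_function U phi -> in_L2 U phi.
Proof.
move=> tphi; have cphi := test_continuous tphi.
have [K K0 hK] := compact_bound tphi cphi (@test_off R phi).
apply: (L2_bounded mU fU _ hK).
by apply: measurable_funTS; exact: continuous_measurable_plane.
Qed.

Lemma test_pderiv_L2 i phi : test_function U phi -> in_L2 U (pderiv i phi).
Proof.
move=> tphi; have cphi := test_pderiv_continuous (i := i) tphi.
have [K K0 hK] := compact_bound tphi cphi (@test_pderiv_off R phi i).
apply: (L2_bounded mU fU _ hK).
by apply: measurable_funTS; exact: continuous_measurable_plane.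
Qed.

Lemma weak_gradientE u g : weak_gradient U u g <->
  forall i phi, test_function U phi -> dot U u (pderiv i phi) = - dot U (g i) phi.
Proof. by []. Qed.

Lemma in_H1_lin (c : R) u g v h : in_H1 U u g -> in_H1 U v h ->
  in_H1 U (fun p => c * u p + v p) (fun i p => c * g i p + h i p).
Proof.
move=> [hu hg hw] [hv hh hw']; split => [|i|i phi tphi]; try exact: L2_lin.
have := test_pderiv_L2 i tphi; have := test_L2 tphi => tL dL.
rewrite -/(dot U (fun p => c * u p + v p) (pderiv i phi)) -/(dot U (fun p => c * g i p + h i p) phi).
rewrite !dot_lin //; move: (hw i _ tphi) (hw' i _ tphi); rewrite -!/(dot _ _ _) => -> ->.
by rewrite mulrN opprD.
Qed.

Lemma in_H1_0 : in_H1 U (fun=> 0) (fun _ _ => 0).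
Proof.
have h : in_L2 U (fun=> 0 : R) := L2_cst mU fU 0.
split => // i phi tphi.
have z (f : R * R -> R) : \int[mu]_(p in U) (0 * f p) = 0.
  rewrite -[RHS](mul0r (fine (mu U))) -(Rintegral_cst mu mU).
  by apply: eq_Rintegral => p _; rewrite mul0r.
by rewrite !z oppr0.
Qed.

Lemma fields_lin1 (c : R) (x y : fields) : (c *: x + y).1 = fun p => c * x.1 p + y.1 p.
Proof. exact. Qed.

Lemma fields_lin2 (c : R) (x y : fields) :
  (c *: x + y).2 = fun i p => c * x.2 i p + y.2 i p.
Proof. exact. Qed.

Lemma H1_submod_closed : submod_closed H1_pred.
Proof.
split; first by apply/asboolP; exact: in_H1_0.
move=> c x y /asboolP hx /asboolP hy; apply/asboolP.
by rewrite fields_lin1 fields_lin2; exact: in_H1_lin.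
Qed.

HB.instance Definition _ := GRing.isSubmodClosed.Build R fields H1_pred H1_submod_closed.

(** Pairs of a function and a weak gradient, so that the forms below need no
    uniqueness of the gradient; functions equal almost everywhere are not
    identified. *)
Record H1 := H1Of { H1_val :> fields; H1P : H1_val \in H1_pred }.
HB.instance Definition _ := [isSub for H1_val].
HB.instance Definition _ := [Choice of H1 by <:].
HB.instance Definition _ := [SubChoice_isSubLmodule of H1 by <:].

Definition fn (x : H1) : R * R -> R := (H1_val x).1.
Definition grad (x : H1) : 'I_2 -> R * R -> R := (H1_val x).2.

Lemma H1_in x : in_H1 U (fn x) (grad x).
Proof. by have := H1P x; move/asboolP. Qed.

Lemma H1_of u g : in_H1 U u g -> {x : H1 | fn x = u /\ grad x = g}.
Proof.
move=> h; have hp : (u, g) \in H1_pred by exact/asboolP.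
by exists (H1Of hp).
Qed.

Lemma H1_val_lin c x y : H1_val (c *: x + y) = c *: H1_val x + H1_val y.
Proof. exact. Qed.

Lemma fn_lin c x y : fn (c *: x + y) = fun p => c * fn x p + fn y p.
Proof. by rewrite /fn H1_val_lin fields_lin1. Qed.

Lemma grad_lin c x y i : grad (c *: x + y) i = fun p => c * grad x i p + grad y i p.
Proof. by rewrite /grad H1_val_lin fields_lin2. Qed.

Lemma fn_comb n (c : 'I_n -> R) (x : 'I_n -> H1) p :
  fn (\sum_(i < n) c i *: x i) p = \sum_(i < n) c i * fn (x i) p.
Proof. by rewrite (@lin_comb R H1 (fun x => fn x p)) // => a y z; rewrite fn_lin. Qed.

Lemma fn_sub x y : fn (x - y) = fun p => fn x p - fn y p.
Proof. by rewrite addrC -scaleN1r fn_lin; apply/funext => p; rewrite mulN1r addrC. Qed.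

Lemma grad_sub x y i : grad (x - y) i = fun p => grad x i p - grad y i p.
Proof. by rewrite addrC -scaleN1r grad_lin; apply/funext => p; rewrite mulN1r addrC. Qed.

Definition mass (x y : H1) : R := dot U (fn x) (fn y).
Definition energy (x y : H1) : R := dot U (grad x 0) (grad y 0) + dot U (grad x 1) (grad y 1).

Lemma fn_L2 x : in_L2 U (fn x). Proof. by have [] := H1_in x. Qed.
Lemma grad_L2 x i : in_L2 U (grad x i). Proof. by have [] := H1_in x. Qed.

Lemma mass_psd : psd_form mass.
Proof.
split => [c x y z|x y|x]; rewrite /mass.
- by rewrite fn_lin dot_lin //; exact: fn_L2.
- exact: dotC.
- exact: dot_ge0.
Qed.

Lemma energy_psd : psd_form energy.
Proof.
split => [c x y z|x y|x]; rewrite /energy.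
- rewrite !grad_lin (dot_lin mU c (grad_L2 x 0) (grad_L2 y 0) (grad_L2 z 0)).
  by rewrite (dot_lin mU c (grad_L2 x 1) (grad_L2 y 1) (grad_L2 z 1)); ring.
- by rewrite (dotC U (grad x 0)) (dotC U (grad x 1)).
- by apply: addr_ge0; exact: dot_ge0.
Qed.

Lemma energyE x y :
  \int[mu]_(p in U) (\sum_(i < 2) grad x i p * grad y i p) = energy x y.
Proof.
rewrite /energy /dot -(RintegralD mU (L2_mul mU (grad_L2 x 0) (grad_L2 y 0)) (L2_mul mU (grad_L2 x 1) (grad_L2 y 1))).
apply: eq_Rintegral => p _; rewrite !big_ord_recl big_ord0 addr0.
by congr (_ + grad x _ p * grad y _ p); apply: val_inj.
Qed.

Lemma mass_eq0 x : mass x x = 0 <-> ae_zero U (fn x).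
Proof. exact: (dot_eq0 mU (fn_L2 x)). Qed.

Lemma neumann_eigenspaceE la u :
  neumann_eigenspace U la u <-> exists2 x, fn x = u & eigvec energy mass la x.
Proof.
split=> [[g ug hu]|[x <- ex]].
  have [x [xu xg]] := H1_of ug; exists x => // y.
  have := hu _ _ (H1_in y); rewrite -xg -xu energyE; exact.
exists (grad x) => [|phi h ph]; first exact: H1_in.
have [y [<- <-]] := H1_of ph; rewrite energyE; exact: ex.
Qed.

Lemma multiplicity_geE la n : multiplicity_ge U la n <->
  exists2 x : 'I_n -> H1, (forall i, eigvec energy mass la (x i)) & indep mass x.
Proof.
split=> [[u [eu iu]]|[x ex ix]].
  have [x hx] : {x : 'I_n -> H1 & forall i, fn (x i) = u i /\ eigvec energy mass la (x i)}.
    apply: (@choice _ _ (fun i x => fn x = u i /\ eigvec energy mass la x)) => i.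
    by have [x] := (neumann_eigenspaceE la (u i)).1 (eu i); exists x.
  exists x => [i|c /mass_eq0 h]; first by have [] := hx i.
  apply: iu; apply: (negligibleS _ h) => p /= nS h0; apply: nS => Up.
  by rewrite -[RHS](h0 Up) fn_comb; apply: eq_bigr => i _; rewrite (hx i).1.
exists (fun i => fn (x i)); split=> [i|c h].
  by apply/neumann_eigenspaceE; exists (x i).
apply: ix; apply/mass_eq0; apply: (negligibleS _ h) => p /= nS h0; apply: nS => Up.
by rewrite fn_comb h0.
Qed.

(** The eigenvalues of a spectral system are counted by [multiplicity_occurs],
    and a list with this property is unique. *)
Theorem spectral_neumann nu e : spectral_system energy mass nu e ->
  neumann_eigenvalue U = nu.
Proof.
move=> sp; have hs : neumann_spectrum U nu.
  split; first by have [] := sp.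
  move=> la n; rewrite multiplicity_geE.
  exact: (multiplicity_occurs energy_psd mass_psd la n sp).
by apply: (neumann_spectrum_unique _ hs); rewrite /neumann_eigenvalue; exact: (xgetPex _ (ex_intro _ nu hs)).
Qed.

Lemma dot_cvg (u : nat -> R * R -> R) v w : (forall n, in_L2 U (u n)) -> in_L2 U v ->
  in_L2 U w -> dot U (fun p => u n p - v p) (fun p => u n p - v p) @[n --> \oo] --> 0 ->
  dot U (u n) w @[n --> \oo] --> dot U v w.
Proof.
move=> hu hv hw cu.
have uvL n : in_L2 U (fun p => u n p - v p) by exact: L2_sub.
pose q := dot U w w; have q0 : 0 <= q by exact: dot_ge0.
have cs n : (dot U (u n) w - dot U v w) ^+ 2 <=
    q * dot U (fun p => u n p - v p) (fun p => u n p - v p).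
  have -> : dot U (u n) w - dot U v w = dot U (fun p => u n p - v p) w.
    have := dot_lin mU (-1) hv (hu n) hw.
    rewrite (_ : (fun p => _ * v p + u n p) = fun p => u n p - v p); last first.
      by apply/funext => p; ring.
    by move=> ->; ring.
  exact: (cauchy_schwarz mU).
apply/cvgrPdist_lt => e e0; have q1 : 0 < q + 1 by rewrite ltr_wpDl.
have d0 : 0 < e ^+ 2 / (q + 1) by rewrite divr_gt0 ?exprn_gt0.
have /cvgrPdist_lt/(_ _ d0) := cu; apply: filterS => n.
rewrite sub0r normrN ger0_norm ?dot_ge0 // ltr_pdivlMr // => h.
rewrite distrC -(@ltr_pXn2r _ 2) ?nnegrE //; last exact: ltW.
rewrite real_normK ?num_real //.
apply: le_lt_trans (cs n) _; apply: le_lt_trans h.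
by rewrite mulrC ler_wpM2l ?dot_ge0 // lerDl.
Qed.

Theorem H1_complete : energy_complete energy mass.
Proof.
move=> x hC.
have massB m n : mass (x m - x n) (x m - x n) =
    dot U (fun p => fn (x m) p - fn (x n) p) (fun p => fn (x m) p - fn (x n) p).
  by rewrite /mass fn_sub.
have [u hu cu] : exists2 u, in_L2 U u &
    dot U (fun p => fn (x n) p - u p) (fun p => fn (x n) p - u p) @[n --> \oo] --> 0.
  apply: (L2_complete mU fU) => [n|e e0]; first exact: fn_L2.
  have [N hN] := hC e e0; exists N => m n Nm Nn; rewrite -massB.
  by apply: le_lt_trans (hN m n Nm Nn); rewrite lerDr; exact: (form_ge0 energy_psd).
have [g hg] : exists g, forall i, in_L2 U (g i) /\
    dot U (fun p => grad (x n) i p - g i p) (fun p => grad (x n) i p - g i p) @[n --> \oo] --> 0.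
  suff /choice[g hg] : forall i, exists gi, in_L2 U gi /\
    dot U (fun p => grad (x n) i p - gi p) (fun p => grad (x n) i p - gi p) @[n --> \oo] --> 0.
    by exists g.
  move=> i; have [|e e0|gi hgi cgi] := @L2_complete _ _ mU fU (fun n => grad (x n) i).
  - by move=> n; exact: grad_L2.
  - have [N hN] := hC e e0; exists N => m n Nm Nn.
    apply: le_lt_trans (hN m n Nm Nn); rewrite /energy -grad_sub.
    have d0 := dot_ge0 U (grad (x m - x n) 0); have d1 := dot_ge0 U (grad (x m - x n) 1).
    have dm := form_ge0 mass_psd (x m - x n).
    have [->|i1] := eqVneq i 0; first by rewrite -addrA lerDl addr_ge0.
    have -> : i = 1 by apply: val_inj; case: i i1 => -[|[|]].
    by rewrite -addrA [leRHS]addrCA lerDl addr_ge0.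
  - by exists gi.
have hH : in_H1 U u g.
  split => // [i|]; first by have [] := hg i.
  apply/weak_gradientE => i phi tphi.
  have [hgi cgi] := hg i; have tL := test_L2 tphi; have dL := test_pderiv_L2 i tphi.
  have c1 := dot_cvg (fun n => fn_L2 (x n)) hu dL cu.
  have c2 := dot_cvg (fun n => grad_L2 (x n) i) hgi tL cgi.
  have e n : dot U (fn (x n)) (pderiv i phi) = - dot U (grad (x n) i) phi.
    by have [_ _ /weak_gradientE] := H1_in (x n); apply.
  apply: (cvg_unique _ c1); first exact: norm_hausdorff.
  by rewrite (_ : (fun n => dot U (fn (x n)) (pderiv i phi)) = fun n => - dot U (grad (x n) i) phi);
    [exact: cvgN|exact/funext].
have [y [yu yg]] := H1_of hH; exists y; split.
  rewrite -[0]addr0; under eq_fun do rewrite /energy !grad_sub yg.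
  by apply: cvgD; [have [] := hg 0|have [] := hg 1].
by under eq_fun do rewrite /mass fn_sub yu.
Qed.


End H1.

(** * Cutting a domain along a line *)
Section Cuts.
Variable R : realType.
Local Notation P := (measurableTypeR R * measurableTypeR R)%type.
Local Notation mu := (leb2 R).
Implicit Types (V W : set (R * R)).

Definition crd (i : bool) (p : R * R) : R := if i then p.1 else p.2.
Definition below i (m : R) V : set (R * R) := V `&` [set p | crd i p < m].
Definition above i (m : R) V : set (R * R) := V `&` [set p | m < crd i p].

Definition shape V := [/\ open V, bounded_set V & segment_closed V].

Lemma continuous_crd i : continuous (crd i).
Proof. by case: i => p; [exact: cvg_fst|exact: cvg_snd]. Qed.

Lemma segment_lt (x y m t : R) : x < m -> y < m -> 0 <= t -> t <= 1 -> x + t * (y - x) < m.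
Proof.
move=> xm ym t0 t1; have [xy|yx] := lerP x y.
  by apply: le_lt_trans ym; nra.
by apply: le_lt_trans xm; nra.
Qed.

Lemma below_shape i m V : shape V -> shape (below i m V).
Proof.
move=> [oV bV cV]; split.
- apply: openI => //.
  exact: (open_comp (fun p _ => @continuous_crd i p) (@open_lt R m)).
- by have [M _ hM] := bounded_rect bV; apply: (@rect_bounded _ _ M) => p [/hM].
- move=> p q t [Vp pm] [Vq qm] t0 t1; split; first exact: cV.
  by rewrite /= in pm qm *; case: i pm qm => /= pm qm; exact: segment_lt.
Qed.

Lemma above_shape i m V : shape V -> shape (above i m V).
Proof.
move=> [oV bV cV]; split.
- apply: openI => //.
  exact: (open_comp (fun p _ => @continuous_crd i p) (@open_gt R m)).
- by have [M _ hM] := bounded_rect bV; apply: (@rect_bounded _ _ M) => p [/hM].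
- move=> p q t [Vp pm] [Vq qm] t0 t1; split; first exact: cV.
  rewrite /= in pm qm *; case: i pm qm => /= pm qm.
    by have := @segment_lt (- p.1) (- q.1) (- m) t; rewrite !ltrN2 => /(_ pm qm t0 t1); lra.
  by have := @segment_lt (- p.2) (- q.2) (- m) t; rewrite !ltrN2 => /(_ pm qm t0 t1); lra.
Qed.

Lemma line_null i (m : R) : mu [set p | crd i p = m] = 0%E.
Proof.
have m1 : measurable ([set m] : set (measurableTypeR R)) by exact: measurable_set1.
case: i.
  rewrite (_ : [set p | _] = [set m] `*` setT); last first.
    by apply/seteqP; split=> -[x y] /=; [move=> ->|case].
  by rewrite product_measure1E // [X in (X * _)%E]lebesgue_measure_set1 mul0e.
rewrite (_ : [set p | _] = setT `*` [set m]); last first.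
  by apply/seteqP; split=> -[x y] /=; [move=> ->|case].
by rewrite product_measure1E // [X in (_ * X)%E]lebesgue_measure_set1 mule0.
Qed.

Lemma shape_measurable V : shape V -> measurable (V : set P).
Proof. by case=> oV _ _; exact: open_measurable_plane. Qed.

Lemma Rintegral_cut i m V (f : R * R -> R) : shape V ->
  mu.-integrable V (EFin \o f : P -> \bar R) ->
  \int[mu]_(p in V) f p = \int[mu]_(p in below i m V) f p + \int[mu]_(p in above i m V) f p.
Proof.
move=> sV fi; have mV := shape_measurable sV.
have mB := shape_measurable (below_shape i m sV).
have mA := shape_measurable (above_shape i m sV).
pose N : set P := V `\` (below i m V `|` above i m V).
have mN : measurable N by apply: measurableD => //; exact: measurableU.
have N0 : mu N = 0%E.
  apply/eqP; rewrite eq_le measure_ge0 andbT -(line_null i m); apply: le_measure.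
  - by rewrite inE.
  - rewrite inE (_ : [set p | _] = (crd i : P -> measurableTypeR R) @^-1` [set m]) //.
    have mc : measurable_fun setT (crd i : P -> measurableTypeR R).
      by case: (i); [exact: measurable_fst|exact: measurable_snd].
    by rewrite -[X in measurable X]setTI; apply: mc => //; exact: measurable_set1.
  - move=> p [Vp np] /=; apply/eqP; rewrite eq_le !leNgt; apply/andP; split; apply/negP => h.
      by apply: np; right.
    by apply: np; left.
have VN : V `\` N = below i m V `|` above i m V.
  apply/seteqP; split=> p.
    by move=> [Vp nN]; apply: contrapT => h; apply: nN.
  by move=> h; split; [case: h => -[]|move=> [_]; apply].
rewrite /Rintegral (negligible_integral mN mV fi N0) VN.
apply: (Rintegral_setU (mu := mu)) => //.
  by rewrite -VN; apply: (integrableS mV _ _ fi); [exact: measurableD|exact: subDsetl].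
apply/disj_setPS => p [[_ pm] [_ mp]]; move: pm mp; rewrite /= => pm mp.
by have := lt_trans pm mp; rewrite ltxx.
Qed.

Lemma L2_restrict V W u : measurable (V : set P) -> measurable (W : set P) -> W `<=` V ->
  in_L2 V u -> in_L2 W u.
Proof.
move=> mV mW WV [mu_ iu]; split; first exact: measurable_funS mu_.
exact: integrableS iu.
Qed.

Lemma H1_restrict V W u g : open V -> open W -> W `<=` V -> in_H1 V u g -> in_H1 W u g.
Proof.
move=> oV oW WV [hu hg hw].
have mV : measurable (V : set P) by exact: open_measurable_plane.
have mW : measurable (W : set P) by exact: open_measurable_plane.
split => [|i|i phi tphi]; try exact: L2_restrict WV _.
have [sphi cphi KW] := tphi.
have tV : test_function V phi by split => //; exact: subset_trans WV.
have e (f k : R * R -> R) : (forall p, ~ support_of phi p -> k p = 0) ->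
    \int[mu]_(p in W) (f p * k p) = \int[mu]_(p in V) (f p * k p).
  move=> k0; rewrite (Rintegral_ext W) (Rintegral_ext V); apply: eq_Rintegral => p _.
  have [Kp|/k0->] := pselect (support_of phi p); last by rewrite !mulr0.
  by rewrite !patchE !mem_set //; [exact/WV/KW|exact: KW].
by rewrite (e u _ (@test_pderiv_off R phi i)) (e (g i) _ (@test_off R phi)); exact: hw.
Qed.

(** Strips of width [d] are cut off one after the other. *)
Lemma strip_induction i (d : R) (Q : set (R * R) -> Prop) :
  (forall V m, shape V -> Q (below i m V) -> Q (above i m V) -> Q V) ->
  forall n a V, shape V -> (forall p, V p -> a <= crd i p <= a + d * n.+1%:R) ->
  (forall W b, shape W -> W `<=` V -> (forall p, W p -> b <= crd i p <= b + d) -> Q W) -> Q V.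
Proof.
move=> cut; elim=> [|n IH] a V sV hV thin.
  by apply: (thin V a) => // p /hV; rewrite mulr1.
apply: (cut V (a + d)) => //.
  apply: (thin _ a); [exact: below_shape|by move=> p []|].
  by move=> p [/hV/andP[-> _] /= /ltW].
apply: (IH (a + d)); first exact: above_shape.
  move=> p [/hV/andP[_ h] /= /ltW ->] /=; apply: le_trans h _.
  by rewrite -[n.+2%:R]natr1 mulrDr mulr1 -addrA lerD2l addrC.
by move=> W b sW WV; apply: thin => //; apply: subset_trans WV _ => p [].
Qed.

End Cuts.

(** * The Friedrichs inequality *)
Section Friedrichs.
Variable R : realType.
Local Notation P := (measurableTypeR R * measurableTypeR R)%type.
Local Notation mu := (leb2 R).
Implicit Types (V W : set (R * R)).

Definition dirichlet V (g : 'I_2 -> R * R -> R) := dot V (g 0) (g 0) + dot V (g 1) (g 1).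

(** The Friedrichs inequality for [V] with the constant [c] in front of the
    energy, the functionals being weighted means over the sets [S j]. *)
Definition controlled (c : R) V := exists N (w : 'I_N -> R) (S : 'I_N -> set (R * R)),
  [/\ forall j, 0 <= w j, forall j, measurable (S j : set P) /\ S j `<=` V &
   forall u g, in_H1 V u g ->
     dot V u u <= c * dirichlet V g + \sum_(j < N) w j * (\int[mu]_(p in S j) u p) ^+ 2].

Lemma dot_cut i m V u v : shape V -> in_L2 V u -> in_L2 V v ->
  dot V u v = dot (below i m V) u v + dot (above i m V) u v.
Proof.
move=> sV hu hv; apply: Rintegral_cut => //.
exact: (L2_mul (shape_measurable sV) hu hv).
Qed.

Lemma controlled_cut c i m V : shape V ->
  controlled c (below i m V) -> controlled c (above i m V) -> controlled c V.
Proof.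
move=> sV [N1 [w1 [S1 [w10 S1V h1]]]] [N2 [w2 [S2 [w20 S2V h2]]]].
exists (N1 + N2)%N, (fun j => match fintype.split j with inl k => w1 k | inr k => w2 k end),
  (fun j => match fintype.split j with inl k => S1 k | inr k => S2 k end); split.
- by move=> j; case: (fintype.split j).
- move=> j; case: (fintype.split j) => k.
    by have [mS SV] := S1V k; split => //; apply: subset_trans SV _ => p [].
  by have [mS SV] := S2V k; split => //; apply: subset_trans SV _ => p [].
move=> u g ug; have [hu hg _] := ug; have [oV _ _] := sV.
have [oB _ _] := below_shape i m sV; have [oA _ _] := above_shape i m sV.
have ugB : in_H1 (below i m V) u g by apply: H1_restrict ug => // p [].
have ugA : in_H1 (above i m V) u g by apply: H1_restrict ug => // p [].
rewrite (dot_cut i m sV hu hu) /dirichlet (dot_cut i m sV (hg 0) (hg 0)).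
rewrite (dot_cut i m sV (hg 1) (hg 1)) big_split_ord /=.
have -> : \sum_(j < N1) match fintype.split (lshift N2 j) with inl k => w1 k | inr k => w2 k end *
    (\int[mu]_(p in match fintype.split (lshift N2 j) with inl k => S1 k | inr k => S2 k end) u p) ^+ 2 =
    \sum_(j < N1) w1 j * (\int[mu]_(p in S1 j) u p) ^+ 2.
  by apply: eq_bigr => j _; rewrite (unsplitK (inl j)).
have -> : \sum_(j < N2) match fintype.split (rshift N1 j) with inl k => w1 k | inr k => w2 k end *
    (\int[mu]_(p in match fintype.split (rshift N1 j) with inl k => S1 k | inr k => S2 k end) u p) ^+ 2 =
    \sum_(j < N2) w2 j * (\int[mu]_(p in S2 j) u p) ^+ 2.
  by apply: eq_bigr => j _; rewrite (unsplitK (inr j)).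
by have := lerD (h1 _ _ ugB) (h2 _ _ ugA); rewrite /dirichlet; congr (_ <= _); ring.
Qed.

(** The mean over [V] is the only functional needed, by the Poincare inequality. *)
Lemma controlled_thin d V a b : shape V ->
  (forall p, V p -> a <= crd true p <= a + d) -> (forall p, V p -> b <= crd false p <= b + d) ->
  controlled (4 * d ^+ 2) V.
Proof.
move=> sV ha hb; have [oV bV cV] := sV.
have mV := shape_measurable sV; have m0 : 0 <= fine (mu V) by exact: fine_ge0.
exists 1%N, (fun=> (fine (mu V))^-1), (fun=> V); split => //.
- by move=> _; rewrite invr_ge0.
- by move=> _; split; [exact: mV|].
move=> u g ug; have [hu hg _] := ug; rewrite big_ord_recl big_ord0 addr0.
have hd p q : V p -> V q -> `|p.1 - q.1| <= d /\ `|p.2 - q.2| <= d.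
  move=> Vp Vq; move: (ha p Vp) (ha q Vq) (hb p Vp) (hb q Vq).
  rewrite /crd; move: p.1 p.2 q.1 q.2 => x y x' y' /andP[? ?] /andP[? ?] /andP[? ?] /andP[? ?].
  by rewrite !ler_norml; split; apply/andP; split; lra.
have := poincare oV bV cV ug hd.
have D0 : 0 <= dirichlet V g by apply: addr_ge0; exact: dot_ge0.
rewrite -/(dirichlet V g); move: D0.
have [m1|m1] := ltrP 0 (fine (mu V)).
  move: (dirichlet _ _) (dot _ _ _) (Rintegral _ _ _) (fine _) m1 => D q I m m1 D0 h.
  rewrite -(ler_pM2l m1) mulrDr mulrA [m * (_ * I ^+ 2)]mulrA divff ?gt_eqF // mul1r.
  by move: h; congr (_ <= _); ring.
have mV0 : mu V = 0%E.
  have : fine (mu V) = 0 by apply/eqP; rewrite eq_le m0 m1.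
  by move=> h; rewrite -[LHS]fineK ?h // ge0_fin_numE //; exact: bounded_finite_measure.
move=> D0 _; have -> : dot V u u = 0.
  rewrite /dot /Rintegral null_set_integral //.
  by have [mu_ _] := hu; apply/measurable_EFinP/measurable_funM.
apply: addr_ge0; apply: mulr_ge0 => //; last exact: sqr_ge0.
  by apply: mulr_ge0 => //; exact: sqr_ge0.
by rewrite invr_ge0.
Qed.

Lemma bounded_strip V d : bounded_set V -> 0 < d ->
  exists n a, forall i p, V p -> a <= crd i p <= a + d * n.+1%:R.
Proof.
move=> bV d0; have [M M0 hM] := bounded_rect bV.
exists (Num.bound (2 * M / d)), (- M) => i p /hM[].
have : 2 * M / d < (Num.bound (2 * M / d)).+1%:R.
  apply: (@lt_trans _ _ (Num.bound (2 * M / d))%:R); last by rewrite ltr_nat.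
  by apply: archi_boundP; rewrite divr_ge0 ?mulr_ge0 // ltW.
rewrite ltr_pdivrMr //; move: ((Num.bound _).+1%:R) => n hn.
by rewrite !ler_norml => /andP[h1 h2] /andP[h3 h4]; rewrite /crd; case: i; apply/andP; split; lra.
Qed.

(** Cut [V] into cells of diameter of order [sqrt c] by vertical and then by
    horizontal lines. *)
Theorem controlled_small V c : shape V -> 0 < c -> controlled c V.
Proof.
move=> sV c0; pose d := Num.sqrt (c / 4).
have d0 : 0 < d by rewrite sqrtr_gt0 divr_gt0.
have dc : 4 * d ^+ 2 = c by rewrite sqr_sqrtr ?divr_ge0 ?ltW //; field.
have [_ bV _] := sV; have [n [a hV]] := bounded_strip bV d0.
apply: (@strip_induction R true d (controlled c) _ n a V sV (hV true)).
  by move=> W m sW; exact: controlled_cut.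
move=> W b sW WV hb.
apply: (@strip_induction R false d (controlled c) _ n a W sW).
- by move=> W' m sW'; exact: controlled_cut.
- by move=> p /WV; exact: hV.
move=> W' b' sW' W'W hb'; rewrite -dc; apply: (@controlled_thin d W' b b' sW' _ hb') => p Wp.
exact/hb/W'W.
Qed.

End Friedrichs.

(** * The Neumann spectrum of a convex domain *)
Section Spectrum.
Variable R : realType.
Local Notation P := (measurableTypeR R * measurableTypeR R)%type.
Local Notation mu := (leb2 R).
Variable U : domain R.

Lemma dom_shape : shape U.
Proof. split; [exact: dom_open|exact: dom_bounded|exact: dom_segment]. Qed.

Lemma dot_subset (S V : set (R * R)) u : measurable (V : set P) -> measurable (S : set P) ->
  S `<=` V -> in_L2 V u -> dot S u u <= dot V u u.
Proof.
move=> mV mS SV hu; have hS := L2_restrict mV mS SV hu.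
rewrite -lee_fin -(dotE mV hu) -(dotE mS hS); apply: ge0_subset_integral => //.
- by have [h _] := hu; apply/measurable_EFinP/measurable_funX.
- by move=> p _; rewrite lee_fin sqr_ge0.
Qed.

Theorem H1_friedrichs : friedrichs (@energy R U) (@mass R U).
Proof.
move=> L L0; have Li : 0 < L^-1 by rewrite invr_gt0.
have [N [w [S [w0 hS h]]]] := controlled_small dom_shape Li.
have mU : measurable (U : set P) := dom_measurable U.
have SL j x : in_L2 (S j) (@fn R U x).
  by have [mS SU] := hS j; exact: L2_restrict mU mS SU (fn_L2 x).
have Sfin j : (mu (S j) < +oo)%E.
  have [mS SU] := hS j; apply: le_lt_trans (dom_finite U).
  by apply: le_measure => //; rewrite inE.
exists N, (fun j x => Num.sqrt (w j) * \int[mu]_(p in S j) fn x p),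
  (\sum_(j < N) w j * fine (mu (S j))).
have sqrE j (x : H1 U) : (Num.sqrt (w j) * \int[mu]_(p in S j) fn x p) ^+ 2 =
    w j * (\int[mu]_(p in S j) fn x p) ^+ 2 by rewrite exprMn sqr_sqrtr.
split=> [j c x y|j x|x].
- have [mS SU] := hS j; rewrite -!dot_cst1 fn_lin.
  by rewrite (dot_lin mS c (SL j x) (SL j y) (L2_cst mS (Sfin j) 1)); ring.
- have [mS SU] := hS j; rewrite sqrE.
  have m0 k : 0 <= w k * fine (mu (S k)) by apply: mulr_ge0 => //; exact: fine_ge0.
  apply: (@le_trans _ _ (w j * fine (mu (S j)) * mass x x)).
    rewrite -mulrA; apply: ler_wpM2l => //.
    apply: le_trans (cauchy_schwarz_cst mS (Sfin j) (SL j x)) _.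
    apply: ler_wpM2l; first exact: fine_ge0.
    exact: dot_subset SU (fn_L2 x).
  apply: ler_wpM2r; first exact: (form_ge0 (mass_psd U)).
  by rewrite (bigD1 j) //= lerDl; apply: sumr_ge0.
under eq_bigr do rewrite sqrE.
by rewrite mulrC; apply: h; exact: H1_in.
Qed.

Lemma open_not_negligible (V : set (R * R)) (Q : R * R -> Prop) : open V -> V !=set0 ->
  {ae mu, forall p, V p -> Q p} -> exists2 p, V p & Q p.
Proof.
move=> oV [[x y] Vxy] hQ; apply: contrapT => nQ.
have := open_nbhs_nbhs (conj oV Vxy) => /nbhs_ballP[e e0 he].
pose J z : set (measurableTypeR R) := `]z - e, z + e[%classic.
have mJ z : measurable (J z) by exact: measurable_itv.
have JV : J x `*` J y `<=` V.
  move=> [x' y'] [/= hx hy]; apply: he; split; rewrite /ball /= ltr_distlC.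
    by move: hx; rewrite /J /= in_itv.
  by move: hy; rewrite /J /= in_itv.
have lJ z : (@lebesgue_measure R (J z) = (2 * e)%:E)%E.
  rewrite /J lebesgue_measure_itv /= lte_fin (_ : z - e < z + e = true); last first.
    by apply/idP; move: e0 => /=; lra.
  by rewrite -EFinB; congr EFin; ring.
have [N [mN N0 hN]] := hQ.
have : (mu (J x `*` J y) <= mu N)%E.
  apply: le_measure; rewrite ?inE //; first exact: measurableX.
  move=> p /JV Vp; apply: hN => /= h; apply: nQ; exists p => //; exact: h.
rewrite N0 product_measure1E //; have ex := lJ x; have ey := lJ y.
rewrite [X in (X * _)%E]ex [X in (_ * X)%E]ey -EFinM lee_fin leNgt.
by rewrite !mulr_gt0.
Qed.

(** The fundamental theorem of calculus gives the increments of such a function,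
    so that [weak_gradient_of_segments] applies. *)
Lemma H1_of_fst (f f' : R -> R) : bumpable f -> bumpable f' ->
  (forall x : R, is_derive x 1 f (f' x)) ->
  in_H1 U (fun p => f p.1) (fun i p => if i == 0 then f' p.1 else 0).
Proof.
move=> bf bf' df.
have mU : measurable (U : set P) := dom_measurable U; have fU := dom_finite U.
have L2f k : bumpable k -> in_L2 U (fun p => k p.1).
  move=> bk; have [K hK] := bumpable_bounded bk.
  have mk : measurable_fun (U : set P) (fun p : P => k p.1 : R).
    apply: measurable_funTS; apply: (measurableT_comp (f := k)); last exact: measurable_fst.
    exact: continuous_measurable_fun (bumpable_continuous bk).
  exact: (L2_bounded mU fU mk (fun p => hK p.1)).
have hg (i : 'I_2) : in_L2 U (fun p => if i == 0 then f' p.1 else 0).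
  by case: (i == 0); [exact: L2f|exact: L2_cst].
split => //; first exact: L2f.
have key := weak_gradient_of_segments (@dom_open _ U) (@dom_bounded _ U) (L2f f bf) hg.
apply: key.
move=> i; exists 1 => // e e0 _; apply: aeW => p Up Up1.
have seg t : unit_itv t -> (U : set _) (translate (e *: basis_vec R i) t p).
  rewrite /unit_itv /= in_itv /= => /andP[t0 t1].
  exact: segment_closed_translate (@dom_segment _ U) Up Up1 t0 t1.
rewrite /segment_mean.
have -> : \int[lebesgue_measure]_(t in @unit_itv R)
    directional U (fun i p => if i == 0 then f' p.1 else 0) (e *: basis_vec R i)
      (translate (e *: basis_vec R i) t p) =
    \int[lebesgue_measure]_(t in @unit_itv R)
       (e * if i == 0 then f' (p.1 + t * e) else 0).
  apply: eq_Rintegral => t; rewrite inE => /seg Ut.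
  rewrite directional_basis patchE mem_set //; congr (_ * _).
  by have [->|//] := eqVneq i 0; rewrite /translate /= /GRing.scale /= mulr1.
have [->|i1] := eqVneq i 0.
  have dk (t : R) : is_derive t 1 (fun t : R => f (p.1 + t * e)) (e * f' (p.1 + t * e)).
    have dl : is_derive (t : R) 1 (fun t : R => p.1 + t * e) e.
      by apply: is_derive_eq; rewrite /GRing.scale /=; ring.
    by have := @is_derive1_comp R f (fun t => p.1 + t * e) t _ _ (df _) dl; rewrite mulrC.
  have ck : continuous (fun t : R => e * f' (p.1 + t * e)).
    move=> t; apply: cvgM; first exact: cvg_cst.
    apply: (@cvg_comp _ _ _ (fun t : R => p.1 + t * e) f' (nbhs t) (nbhs (p.1 + t * e : R)));
      last exact: (bumpable_continuous bf').
    by apply: cvgD; [exact: cvg_cst|apply: cvgM; [exact: cvg_id|exact: cvg_cst]].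
  rewrite (FTC_unit dk ck).
  by rewrite /translate /= /GRing.scale /= mulr1 mul0r addr0 mul1r.
have -> : i = 1 by apply: val_inj; case: i i1 {seg Up1} => -[|[|]].
rewrite Rintegral_cst; last exact: measurable_unit.
by rewrite /translate /= /GRing.scale /= !mulr0 addr0 subrr mul0r.
Qed.

(** Bumps in the first coordinate, supported in disjoint strips meeting [U]. *)
Theorem H1_infinite_dim : infinite_dim (@mass R U).
Proof.
move=> n; have [p0 Up0] := dom_nonempty U.
have [e e0 he] : exists2 e : R, 0 < e & forall t, 0 <= t -> t < e -> (U : set _) (p0.1 + t, p0.2).
  have := open_nbhs_nbhs (conj (@dom_open _ U) Up0) => /nbhs_ballP[e e0 he].
  exists e => // t t0 te; apply: he; split; rewrite /ball /=; last by rewrite subrr normr0.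
  by rewrite opprD addNKr normrN ger0_norm.
pose a (i : nat) : R := p0.1 + e * (i%:R / n%:R).
have [n0|n0] := posnP n; first by exists (fun=> 0) => c _ i; have := ltn_ord i; rewrite [X in (_ < X)%N]n0.
have nR : 0 < n%:R :> R by rewrite ltr0n.
have aS i : a i < a i.+1.
  by rewrite /a ltrD2l ltr_pM2l // ltr_pM2r ?invr_gt0 // ltr_nat.
have am i j : (i <= j)%N -> a i <= a j.
  by move=> ij; rewrite /a lerD2l ler_pM2l // ler_pM2r ?invr_gt0 // ler_nat.
have [x hx] : {x : 'I_n -> H1 U & forall i, fn (x i) = fun p => bump 0 (a i) (a i.+1) p.1}.
  apply: (@choice _ _ (fun (i : 'I_n) (x : H1 U) => fn x = fun p => bump 0 (a i) (a i.+1) p.1)) => i.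
  have [f' bf' df] := bumpable_derive (bumpable_bump 0 (a i) (a i.+1)).
  by have [x [h _]] := H1_of (H1_of_fst (bumpable_bump 0 (a i) (a i.+1)) bf' df); exists x.
exists x => c /mass_eq0 h i.
pose V := (U : set (R * R)) `&` (fst @^-1` `]a i, a i.+1[%classic).
have oV : open V.
  apply: openI; first exact: dom_open.
  by apply: open_comp; [move=> p _; exact: cvg_fst|exact: itv_open].
have V0 : V !=set0.
  pose t := e * ((i%:R + 2^-1) / n%:R); exists (p0.1 + t, p0.2); split.
    apply: he; first by apply: mulr_ge0; [exact: ltW|apply: divr_ge0 => //; apply: addr_ge0].
    rewrite /t gtr_pMr // ltr_pdivrMr // mul1r.
    have : (i.+1%:R : R) <= n%:R by rewrite ler_nat.
    by rewrite -natr1; lra.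
  rewrite /= in_itv /= /a /t !ltrD2l !ltr_pM2l // !ltr_pM2r ?invr_gt0 // -[i.+1%:R]natr1.
  by apply/andP; split; lra.
have [p [Up pi] vp] : exists2 p, V p & fn (\sum_(i < n) c i *: x i) p = 0.
  apply: (open_not_negligible oV V0); apply: (negligibleS _ h) => p /= nS h0; apply: nS.
  by move=> [Up _]; exact: h0.
move: vp; rewrite fn_comb (bigD1 i) //= big1 => [|j ji].
  rewrite addr0 hx => /eqP; rewrite mulf_eq0 => /orP[/eqP//|/eqP b0].
  by move: pi; rewrite /= in_itv /= -(bump_gt0 0) b0 ltxx.
rewrite hx bump_eq0 ?mulr0 //; apply/negP => /andP[p1 p2].
move: pi; rewrite /= in_itv /= => /andP[p3 p4].
move: ji; rewrite -val_eqE /= neq_ltn => /orP[ji|ij].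
  by have := lt_le_trans p2 (am _ _ ji); move/(lt_trans p3); rewrite ltxx.
by have := lt_le_trans p4 (am _ _ ij); move/(lt_trans p1); rewrite ltxx.
Qed.

Theorem neumann_spectral_system : exists e : nat -> H1 U,
  spectral_system (@energy R U) (@mass R U) (neumann_eigenvalue U) e.
Proof.
have [nu [e sp]] := spectral_theorem (energy_psd U) (mass_psd U) (@H1_complete R U)
  H1_friedrichs H1_infinite_dim.
by exists e; rewrite (spectral_neumann sp).
Qed.

End Spectrum.

(** * Similarities *)
Section Similarity.
Variable R : realType.
Local Notation P := (measurableTypeR R * measurableTypeR R)%type.
Local Notation mu := (leb2 R).
Local Notation ext u U := (u \_ U).

Definition similarity (a b : R) (p : R * R) : R * R := (a * p.1 - b * p.2, b * p.1 + a * p.2).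

(** By the chain rule, the gradient of [u \o similarity a b] when [g] is that of
    [u]. *)
Definition pull_grad (a b : R) (g : 'I_2 -> R * R -> R) (i : 'I_2) (p : R * R) : R :=
  if i == 0 then a * g 0 (similarity a b p) + b * g 1 (similarity a b p)
  else - b * g 0 (similarity a b p) + a * g 1 (similarity a b p).

Lemma similarity_translate a b h t p :
  similarity a b (translate h t p) = translate (similarity a b h) t (similarity a b p).
Proof. by rewrite /similarity /translate /=; congr pair; ring. Qed.

Lemma L2_similarity (U V : set (R * R)) (a b : R) u : a != 0 ->
  measurable (U : set P) -> measurable (V : set P) -> (mu U < +oo)%E ->
  (forall p, V p -> U (similarity a b p)) -> in_L2 U u -> in_L2 V (u \o similarity a b).
Proof.
move=> a0 mU mV fU VU hu; have sc := scales_area_similarity b a0.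
have [iu iu2] := L2_ext mU fU hu.
have e : {in V, (fun p => ext u U (similarity a b p)) =1 u \o similarity a b}.
  by move=> p; rewrite inE => Vp; rewrite patchE mem_set //=; exact: VU.
have c0 : 0 < (a ^+ 2 + b ^+ 2)^-1.
  by rewrite invr_gt0 ltr_wpDr ?sqr_ge0 // lt_def sqrf_eq0 a0 sqr_ge0.
split.
  apply: (eq_measurable_fun _ e); apply: measurable_funTS.
  have /integrableP[/measurable_EFinP m _] := iu.
  by apply: (measurableT_comp m); have [] := sc.
have := integrable_scales sc c0 iu2.
move=> /(integrableS measurableT mV (@subsetT _ _)); apply: eq_integrable => // p Vp.
by have := e p Vp => /= ->.
Qed.

(** Increments of [u] along a segment pull back to increments along the segment
    mapped to it, so the chain rule needs no approximation by smooth functions. *)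
Theorem H1_similarity (U V : set (R * R)) (a b : R) u g : a != 0 -> shape U -> shape V ->
  (forall p, V p -> U (similarity a b p)) -> in_H1 U u g ->
  in_H1 V (u \o similarity a b) (pull_grad a b g).
Proof.
move=> a0 sU sV VU ug; have [hu hg _] := ug.
have [oU bU cU] := sU; have [oV bV cV] := sV.
have mU := shape_measurable sU; have mV := shape_measurable sV.
have fU : (mu U < +oo)%E by exact: bounded_finite_measure.
have hpu : in_L2 V (u \o similarity a b) by exact: L2_similarity VU hu.
have hpg i : in_L2 V (pull_grad a b g i).
  have h j : in_L2 V (g j \o similarity a b) by apply: L2_similarity VU _.
  have z : in_L2 V (fun=> 0 : R) by apply: L2_cst => //; exact: bounded_finite_measure.
  have l x y := L2_lin mV x (h 0) (L2_lin mV y (h 1) z).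
  rewrite (_ : pull_grad a b g i = if i == 0
     then fun p => a * (g 0 \o similarity a b) p + (b * (g 1 \o similarity a b) p + 0)
     else fun p => - b * (g 0 \o similarity a b) p + (a * (g 1 \o similarity a b) p + 0)).
    by case: (i == 0).
  by apply/funext => p; rewrite /pull_grad; case: (i == 0); rewrite addr0.
split => //; have key := weak_gradient_of_segments oV bV hpu hpg; apply: key.
move=> i; exists 1 => // e e0 _; set h := e *: basis_vec R i.
have := ae_scales (scales_area_similarity b a0) (segment_identity (similarity a b h) oU bU cU ug).
move=> hseg; apply: (negligibleS _ hseg) => p /= nS hp; apply: nS => Vp Vp1.
rewrite /= similarity_translate hp; last 2 first.
- exact: VU.
- by have := VU _ Vp1; rewrite similarity_translate.
apply: eq_Rintegral => t; rewrite inE /unit_itv /= in_itv /= => /andP[t0 t1].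
have Vt : V (translate h t p) by exact: segment_closed_translate cV Vp Vp1 t0 t1.
have Ut := VU _ Vt; rewrite -[translate _ t _]similarity_translate.
by rewrite /directional !patchE !mem_set // /pull_grad /similarity /=; ring.
Qed.

End Similarity.

(** * Discs and rotations *)
Section Rotations.
Variable R : realType.
Local Notation P := (measurableTypeR R * measurableTypeR R)%type.
Local Notation mu := (leb2 R).
Local Notation ext u U := (u \_ U).

Lemma Rintegral_isometry (U : set (R * R)) (a b : R) f : a != 0 -> a ^+ 2 + b ^+ 2 = 1 ->
  measurable (U : set P) -> (forall p, U (similarity a b p) <-> U p) ->
  mu.-integrable U (EFin \o f : P -> \bar R) ->
  \int[mu]_(p in U) f (similarity a b p) = \int[mu]_(p in U) f p.
Proof.
move=> a0 ab mU hU fi; rewrite [LHS]Rintegral_mkcond [RHS]Rintegral_mkcond.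
have fi' : mu.-integrable setT (EFin \o (ext f U : P -> R)).
  have /(integrable_mkcond _ mU) := fi.
  by apply: eq_integrable => // p _; rewrite /= !patchE; case: ifP.
have sc := scales_area_similarity b a0.
have c0 : 0 < (a ^+ 2 + b ^+ 2)^-1 by rewrite ab invr1.
have := integral_scales sc c0 fi'; rewrite ab invr1 mul1r => <-.
apply: eq_Rintegral => p _; rewrite !patchE.
have [Up|nU] := pselect (U p).
  by rewrite !mem_set //; exact/hU.
by rewrite !memNset // => /hU.
Qed.

Variable U : domain R.

(** Testing the rotated function against [z] is testing [x] against [z] rotated
    back. *)
Lemma rotate_eigvec (a b la : R) (x : H1 U) : a != 0 -> a ^+ 2 + b ^+ 2 = 1 ->
  (forall p, (U : set _) (similarity a b p) <-> (U : set _) p) ->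
  eigvec (@energy R U) (@mass R U) la x ->
  exists2 y : H1 U, fn y = fn x \o similarity a b & eigvec (@energy R U) (@mass R U) la y.
Proof.
move=> a0 ab hU ex; have mU : measurable (U : set P) := dom_measurable U.
have sU := dom_shape U.
have inv p : similarity a (- b) (similarity a b p) = p.
  case: p => p1 p2; rewrite /similarity /=; congr pair.
    by rewrite -[RHS]mul1r -ab; ring.
  by rewrite -[RHS]mul1r -ab; ring.
have inv' p : similarity a b (similarity a (- b) p) = p.
  case: p => p1 p2; rewrite /similarity /=; congr pair.
    by rewrite -[RHS]mul1r -ab; ring.
  by rewrite -[RHS]mul1r -ab; ring.
have hU' p : (U : set _) p -> (U : set _) (similarity a (- b) p).
  by move=> Up; apply/hU; rewrite inv'.
have [y [yu yg]] := H1_of (H1_similarity a0 sU sU (fun p => (hU p).2) (H1_in x)).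
exists y => // z.
have [w [wu wg]] := H1_of (H1_similarity a0 sU sU hU' (H1_in z)).
have -> : energy y z = energy x w.
  pose F q := \sum_(i < 2) grad x i q * grad w i q.
  rewrite -!energyE -/(F _); transitivity (\int[mu]_(p in U) F (similarity a b p)); last first.
    apply: (Rintegral_isometry (f := F) a0 ab mU hU).
    have := integrableD mU (L2_mul mU (grad_L2 x 0) (grad_L2 w 0))
      (L2_mul mU (grad_L2 x 1) (grad_L2 w 1)).
    apply: eq_integrable => // p _; rewrite /F /= !big_ord_recl big_ord0 addr0.
    by have -> : lift ord0 ord0 = 1 :> 'I_2 by exact: val_inj.
  apply: eq_Rintegral => p _; rewrite /F !big_ord_recl !big_ord0 !addr0 yg wg /pull_grad /= inv.
  have -> : lift ord0 ord0 = 1 :> 'I_2 by exact: val_inj.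
  by have -> : ord0 = 0 :> 'I_2 by []; ring.
have -> : mass y z = mass x w.
  pose F q := fn x q * fn w q.
  rewrite /mass /dot; transitivity (\int[mu]_(p in U) F (similarity a b p)); last first.
    exact: (Rintegral_isometry (f := F) a0 ab mU hU (L2_mul mU (fn_L2 x) (fn_L2 w))).
  by apply: eq_Rintegral => p _; rewrite /F yu wu /= inv.
exact: ex.
Qed.

End Rotations.

Section Discs.
Variable R : realType.
Local Notation P := (measurableTypeR R * measurableTypeR R)%type.
Local Notation mu := (leb2 R).

Lemma continuous_sqnorm : continuous (fun p : R * R => p.1 ^+ 2 + p.2 ^+ 2).
Proof. by move=> p; apply: cvgD; apply: cvgM; (exact: cvg_fst || exact: cvg_snd). Qed.

(** [r] is the square of the radius. *)
Definition disc_set (r : R) : set (R * R) := [set p | p.1 ^+ 2 + p.2 ^+ 2 < r].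

Lemma disc_shape r : shape (disc_set r).
Proof.
split.
- exact: (open_comp (fun p _ => @continuous_sqnorm p) (@open_lt R r)).
- apply: (@rect_bounded _ _ (1 + `|r|)) => p pr; have r0 := ler_norm r.
  have [h1 h2] : p.1 ^+ 2 <= `|r| /\ p.2 ^+ 2 <= `|r|.
    move: pr; rewrite /disc_set /=; move: (sqr_ge0 p.1) (sqr_ge0 p.2) r0.
    by move: (p.1 ^+ 2) (p.2 ^+ 2) `|r| => x y z x0 y0 rz h; split; lra.
  have aux (x : R) : x ^+ 2 <= `|r| -> `|x| <= 1 + `|r|.
    rewrite -(real_normK (num_real x)); move: (normr_ge0 x) (normr_ge0 r).
    by move: `|x| `|r| => y z y0 z0 h; rewrite leNgt; apply/negP => yz; nra.
  by split; apply: aux.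
- move=> p q t; rewrite /disc_set /=; move: p.1 p.2 q.1 q.2 => x y x' y' h h' t0 t1.
  apply: (@le_lt_trans _ _ ((1 - t) * (x ^+ 2 + y ^+ 2) + t * (x' ^+ 2 + y' ^+ 2))).
    have := mulr_ge0 (mulr_ge0 t0 (_ : 0 <= 1 - t)) (addr_ge0 (sqr_ge0 (x' - x)) (sqr_ge0 (y' - y))).
    by rewrite subr_ge0 => /(_ t1); nra.
  by have := @segment_lt _ _ _ _ t h h' t0 t1; congr (_ < _); ring.
Qed.

Lemma disc_nonempty r : 0 < r -> disc_set r !=set0.
Proof. by exists (0, 0); rewrite /disc_set /= expr0n addr0. Qed.

Definition disc (r : R) (r0 : 0 < r) : domain R :=
  Domain (disc_nonempty r0) (let: And3 oV _ _ := disc_shape r in oV)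
    (let: And3 _ bV _ := disc_shape r in bV) (let: And3 _ _ cV := disc_shape r in cV).

Lemma disc_similarity r (a b : R) p : a ^+ 2 + b ^+ 2 = 1 ->
  disc_set r (similarity a b p) <-> disc_set r p.
Proof.
move=> ab; rewrite /disc_set /similarity /=.
suff -> : (a * p.1 - b * p.2) ^+ 2 + (b * p.1 + a * p.2) ^+ 2 = p.1 ^+ 2 + p.2 ^+ 2 by [].
by rewrite -[RHS]mul1r -ab; ring.
Qed.

End Discs.

(** * Eigenfunctions vanishing on caps *)
Section Stabilisation.
Variables (R : realType) (H : lmodType R) (b : H -> H -> R) (K : R -> H -> Prop).
Hypothesis bP : psd_form b.
Hypothesis K_mono : forall c d x, c <= d -> K c x -> K d x.
Hypothesis K_comb : forall c n (z : 'I_n -> R) (x : 'I_n -> H),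
  (forall i, K c (x i)) -> K c (\sum_(i < n) z i *: x i).
Hypothesis K_null : forall c d x y, K c x -> K d y -> b (y - x) (y - x) = 0 -> K c y.

(** Take [c1] where the dimension of [K c1] is largest. *)
Lemma bounded_dim_stabilises (N : nat) (c0 : R) : c0 < 1 ->
  (forall c n (x : 'I_n -> H), (forall i, K c (x i)) -> indep b x -> (n <= N)%N) ->
  exists c1, [/\ c0 <= c1, c1 < 1 & forall c x, c1 <= c -> c < 1 -> K c x -> K c1 x].
Proof.
move=> c01 hN.
pose Q n := `[< exists c, [/\ c0 <= c, c < 1 & exists2 x : 'I_n -> H, forall i, K c (x i) & indep b x] >].
have Q0 : exists n, Q n.
  exists 0%N; apply/asboolP; exists c0; split => //.
  by exists (fun=> 0) => [[]//|z _ []].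
have QN n : Q n -> (n <= N)%N by move/asboolP => [c [_ _ [x xK xi]]]; exact: hN xK xi.
case: (ex_maxnP Q0 QN) => n /asboolP[c1 [c01' c11 [x xK xi]]] nmax.
exists c1; split => // c y c1c c1' Ky.
pose w (i : 'I_n.+1) := oapp x y (unlift ord0 i).
have w0 : w ord0 = y by rewrite /w unlift_none.
have wl i : w (lift ord0 i) = x i by rewrite /w liftK.
have wK i : K c (w i).
  by case: (unliftP ord0 i) => [j|] ->; [rewrite wl; exact: K_mono c1c _|rewrite w0].
have : ~ indep b w.
  move=> wi; suff : Q n.+1 by move=> /nmax; rewrite ltnn.
  by apply/asboolP; exists c; split => //; [exact: le_trans c1c|exists w].
move=> nw; have [z [zb [i zi]]] : exists z : 'I_n.+1 -> R,
    b (\sum_(i < n.+1) z i *: w i) (\sum_(i < n.+1) z i *: w i) = 0 /\ exists i, z i != 0.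
  apply: contrapT => h; apply: nw => z zb i; apply/eqP; apply: contra_notT h => zi.
  by exists z; split => //; exists i.
move: zb; rewrite big_ord_recl w0 (eq_bigr (fun i => z (lift ord0 i) *: x i)); last first.
  by move=> j _; rewrite wl.
set s := \sum_(i < n) _ => zb.
have z0 : z ord0 != 0.
  apply/eqP => z0; move: zb; rewrite z0 scale0r add0r => /xi h.
  by case: (unliftP ord0 i) zi => [j|] ->; rewrite ?h ?z0 eqxx.
have Ks : K c1 (- (z ord0)^-1 *: s).
  rewrite /s scaler_sumr.
  by under eq_bigr do rewrite scalerA; exact: K_comb.
apply: (K_null Ks Ky).
have -> : y - - (z ord0)^-1 *: s = (z ord0)^-1 *: (z ord0 *: y + s).
  by rewrite scaleNr opprK scalerDr scalerA mulVf // scale1r.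
by rewrite (formZl bP) (formZr bP) zb !mulr0.
Qed.

End Stabilisation.

Section Caps.
Variable R : realType.
Local Notation P := (measurableTypeR R * measurableTypeR R)%type.
Local Notation mu := (leb2 R).
Local Notation B := (disc (@ltr01 R)).

Definition rot (phi : R) : R * R -> R * R := similarity (cos phi) (sin phi).

Lemma rot_comp phi psi p : rot phi (rot psi p) = rot (phi + psi) p.
Proof. by rewrite /rot /similarity cosD sinD /=; congr pair; ring. Qed.

Lemma rot0 p : rot 0 p = p.
Proof. by case: p => x y; rewrite /rot /similarity cos0 sin0 /=; congr pair; ring. Qed.

Lemma ae_rot (phi : R) k (Q : P -> Prop) : cos phi != 0 ->
  {ae mu, forall p, Q p} -> {ae mu, forall p, Q (rot (phi *+ k) p)}.
Proof.
move=> c0; elim: k Q => [|k IH] Q hQ.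
  by apply: (negligibleS _ hQ) => p /= nS hp; apply: nS; rewrite mulr0n rot0.
have h := ae_scales (scales_area_similarity (sin phi) c0) (IH Q hQ).
apply: (negligibleS _ h) => p /= nS hp; apply: nS.
by rewrite mulrSr -rot_comp.
Qed.

Definition cap (c : R) : set (R * R) := above true c (disc_set 1).

Definition vanishing (la c : R) (x : H1 B) : Prop :=
  eigvec (@energy R B) (@mass R B) la x /\ ae_zero (cap c) (fn x).

(** The cap above [c] is so thin that its rotation by [phi] stays in the cap
    above [c1]. *)
Lemma rotate_vanishing la phi c1 c (x : H1 B) : c1 < cos phi ->
  1 - (cos phi - c1) ^+ 2 / 8 <= c -> 0 < c1 -> vanishing la c1 x ->
  exists2 y, vanishing la c y & fn y = fn x \o rot phi.
Proof.
move=> c1a hc c10 [ex zx]; have a0 : cos phi != 0 by rewrite gt_eqF // (lt_trans c10).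
have [y yu ey] := @rotate_eigvec R B _ _ la x a0 (cos2Dsin2 phi)
  (fun p => @disc_similarity R 1 (cos phi) (sin phi) p (cos2Dsin2 phi)) ex.
exists y => //; split => //.
have := ae_scales (scales_area_similarity (sin phi) a0) zx.
move=> h; apply: (negligibleS _ h) => p /= nS hp; apply: nS => -[Bp pc].
rewrite yu /=; apply: hp; split; first exact/disc_similarity/Bp/cos2Dsin2.
move: pc Bp; rewrite /crd /disc_set /similarity /=; move: p.1 p.2 => x1 x2 pc Bp.
have s1 : `|sin phi| <= 1 by exact: sin_max.
have cle : cos phi <= 1 by exact: cos_le1.
have : `|sin phi * x2| <= `|x2| by rewrite normrM ler_piMl.
move: (sin phi * x2) (cos phi) c1a cle hc {a0} => z a c1a cle hc zx2.
have x2s : `|x2| < (a - c1) / 2.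
  rewrite -(@ltr_pXn2r _ 2) ?nnegrE ?real_normK ?num_real //; last by lra.
  by nra.
have a1 : 0 < a by lra.
have h1 : a - (a - c1) ^+ 2 / 8 <= a * x1.
  have := sqr_ge0 (a - c1); move: ((a - c1) ^+ 2) hc => q hc q0.
  have : a * (1 - q / 8) <= a * x1 by rewrite ler_pM2l //; lra.
  by nra.
have h2 : (a - c1) ^+ 2 / 8 <= (a - c1) / 8 by nra.
by have := ler_norm z; lra.
Qed.

Section Annulus.
Variables (la c1 : R).
Hypotheses (c10 : 0 < c1) (c11 : c1 < 1).
Hypothesis stable : forall c (x : H1 B), c1 <= c -> c < 1 -> vanishing la c x -> vanishing la c1 x.

Lemma rot_vanishing phi k (x : H1 B) : c1 < cos phi -> vanishing la c1 x ->
  exists2 y, vanishing la c1 y & fn y = fn x \o rot (phi *+ k).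
Proof.
move=> ca vx; elim: k => [|k [y vy yx]].
  by exists x => //; apply/funext => p; rewrite /= mulr0n rot0.
pose c := Num.max c1 (1 - (cos phi - c1) ^+ 2 / 8).
have [|z vz zy] := @rotate_vanishing la phi c1 c y ca _ c10 vy.
  by rewrite le_max lexx orbT.
exists z; last by rewrite zy yx; apply/funext => p; rewrite /= rot_comp mulrSr.
apply: (stable _ _ vz); first by rewrite le_max lexx.
by rewrite gt_max c11 /= gtrBl divr_gt0 // exprn_gt0 // subr_gt0.
Qed.

Lemma vanishing_orbit phi k (x : H1 B) : c1 < cos phi -> vanishing la c1 x ->
  {ae mu, forall q, cap c1 (rot ((- phi) *+ k) q) -> fn x q = 0}.
Proof.
move=> ca vx; have [y [_ zy] yx] := rot_vanishing k ca vx.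
have c0 : cos (- phi) != 0 by rewrite cosN gt_eqF // (lt_trans c10).
have := ae_rot k c0 zy => h; apply: (negligibleS _ h) => q /= nS hq; apply: nS => /hq.
by rewrite yx /= rot_comp mulNrn subrr rot0.
Qed.

(** Some multiple of the angle [phi] brings a point of polar angle [t] into the
    sector of half-angle [phi] around the first axis; the sign of the second
    coordinate decides the sense of the rotation. *)
Lemma rot_into_cap phi q : 0 < phi -> phi <= pi -> c1 < cos phi ->
  disc_set 1 q -> (c1 / cos phi) ^+ 2 < q.1 ^+ 2 + q.2 ^+ 2 ->
  exists k, cap c1 (rot ((- phi) *+ k) q) \/ cap c1 (rot (phi *+ k) q).
Proof.
move=> phi0 phipi ca Bq rq; have a0 : 0 < cos phi by exact: lt_trans ca.
have Br psi : disc_set 1 (rot psi q) by apply/disc_similarity => //; exact: cos2Dsin2.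
pose rho := Num.sqrt (q.1 ^+ 2 + q.2 ^+ 2).
have r0 : 0 < c1 / cos phi by rewrite divr_gt0.
have rho2 : rho ^+ 2 = q.1 ^+ 2 + q.2 ^+ 2 by rewrite sqr_sqrtr // addr_ge0 ?sqr_ge0.
have rho0 : 0 <= rho by exact: sqrtr_ge0.
have rr : c1 / cos phi < rho by rewrite -(@ltr_pXn2r _ 2) ?nnegrE ?rho2 // ltW.
have rhop : 0 < rho by exact: lt_trans rr.
pose s := q.1 / rho.
have s2 : s ^+ 2 <= 1.
  by rewrite /s expr_div_n ler_pdivrMr ?exprn_gt0 // mul1r rho2 lerDl sqr_ge0.
have sI : -1 <= s <= 1.
  by rewrite -ler_norml -(@ler_pXn2r _ 2) ?nnegrE // real_normK ?num_real // expr1n.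
pose t := acos s.
have ct : rho * cos t = q.1 by rewrite /t acosK ?in_itv //= /s mulrC divfK // gt_eqF.
have t0 : 0 <= t by exact: acos_ge0.
have st : rho * sin t = `|q.2|.
  rewrite /t sin_acos // -sqrtr_sqr -[rho]ger0_norm // -sqrtr_sqr -sqrtrM ?sqr_ge0 //.
  rewrite mulrBr mulr1 /s expr_div_n mulrCA divff ?mulr1 ?rho2 ?gt_eqF ?exprn_gt0 //.
    by rewrite addrC addKr.
  by rewrite -rho2 exprn_gt0.
pose k := Num.truncn (t / phi).
have /andP[k1 k2] := truncn_itv (divr_ge0 t0 (ltW phi0)).
pose d := t - phi *+ k.
have d0 : 0 <= d by rewrite subr_ge0 -mulr_natr mulrC -ler_pdivlMr.
have d1 : d < phi by rewrite ltrBlDr -mulrS -mulr_natr mulrC -ltr_pdivrMr.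
have cd : c1 < rho * cos d.
  have : cos phi < cos d.
    by rewrite ltr_cos // in_itv /= ?d0 ?(ltW phi0) //= (le_trans (ltW d1)).
  move=> h; apply: (@lt_trans _ _ (rho * cos phi)); first by rewrite -ltr_pdivrMr.
  by rewrite ltr_pM2l.
exists k; have [q2|q2] := lerP 0 q.2.
  left; split => //; rewrite /= /crd /rot /similarity /=.
  rewrite mulNrn cosN sinN mulNr opprK -ct -[X in _ + _ * X](ger0_norm q2) -st.
  by move: cd; rewrite /d cosB; congr (_ < _); ring.
right; split => //; rewrite /= /crd /rot /similarity /=.
have -> : q.2 = - (rho * sin t) by rewrite st ltr0_norm // opprK.
by move: cd; rewrite -ct /d cosB; congr (_ < _); ring.
Qed.

(** By stability the eigenfunction vanishes on the images of the cap under all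
    multiples of one small rotation, and these images cover an annulus. *)
Theorem vanishing_annulus : exists2 r : R, 0 < r < 1 &
  forall x : H1 B, vanishing la c1 x ->
  {ae mu, forall q, disc_set 1 q -> r < q.1 ^+ 2 + q.2 ^+ 2 -> fn x q = 0}.
Proof.
pose a : R := (1 + c1) / 2; have a1 : c1 < a by rewrite /a; move: c11; lra.
have a2 : -1 <= a < 1 by rewrite /a; apply/andP; move: c10 c11; split; lra.
have aI : -1 <= a <= 1 by have /andP[-> /ltW->] := a2.
pose phi := acos a; have cphi : cos phi = a by rewrite acosK // in_itv.
have phi0 : 0 < phi by exact: acos_gt0.
have phipi : phi <= pi by exact: acos_lepi.
have ca : c1 < cos phi by rewrite cphi.
have a0 : 0 < a by exact: lt_trans a1.
exists ((c1 / cos phi) ^+ 2).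
  have q0 : 0 < c1 / cos phi by rewrite cphi divr_gt0.
  have q1 : c1 / cos phi < 1 by rewrite cphi ltr_pdivrMr ?mul1r.
  by move: (c1 / cos phi) q0 q1 => z z0 z1; rewrite exprn_gt0 //=; nra.
move=> x vx; have h1 := ae_foralln (fun k => vanishing_orbit k ca vx).
have can : c1 < cos (- phi) by rewrite cosN.
have h2 := ae_foralln (fun k => vanishing_orbit k can vx).
apply: (negligibleS _ (negligibleU h1 h2)) => q /= nS.
apply: contrapT => h; apply: nS => Bq rq.
have {h}[h3 h4] : (forall k, cap c1 (rot ((- phi) *+ k) q) -> fn x q = 0) /\
    (forall k, cap c1 (rot ((- - phi) *+ k) q) -> fn x q = 0).
  by split; apply: contrapT => h'; apply: h; [left|right].
have [k [h|h]] := rot_into_cap phi0 phipi ca Bq rq; first exact: h3 h.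
by apply: (h4 k); rewrite opprK.
Qed.

End Annulus.

End Caps.

(** * Eigenfunctions with compact support *)
Section Truncation.
Variable R : realType.
Local Notation P := (measurableTypeR R * measurableTypeR R)%type.
Local Notation mu := (leb2 R).
Local Notation ext u U := (u \_ U).

Lemma dot_ae (U : set (R * R)) u v w : measurable (U : set P) -> in_L2 U u -> in_L2 U v ->
  in_L2 U w -> {ae mu, forall p, U p -> u p = v p} -> dot U u w = dot U v w.
Proof.
move=> mU [mu_ _] [mv _] [mw _] h; rewrite /dot /Rintegral; congr fine.
apply: ae_eq_integral => //; try by apply/measurable_EFinP; exact: measurable_funM.
by apply: (negligibleS _ h) => p /= nS hp; apply: nS => Up; rewrite hp.
Qed.

Lemma dotZl (U : set (R * R)) (c : R) u v : measurable (U : set P) -> in_L2 U u -> in_L2 U v ->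
  dot U (fun p => c * u p) v = c * dot U u v.
Proof.
move=> mU hu hv; rewrite /dot -(RintegralZl c mU (L2_mul mU hu hv)).
by apply: eq_Rintegral => p _; rewrite mulrA.
Qed.

Lemma L2_patch (U D : set (R * R)) u : measurable (U : set P) -> measurable (D : set P) ->
  in_L2 U u -> in_L2 U (ext u D).
Proof.
move=> mU mD [mu_ iu].
have e : ext u D = fun p => u p * \1_D p.
  by apply/funext => p; rewrite patchE indicE; case: ifP => _; rewrite ?mulr1 ?mulr0.
have m : measurable_fun (U : set P) (ext u D).
  by rewrite e; apply: measurable_funM => //; exact: measurable_indic.
split => //; apply: (le_integrable mU _ _ iu).
  exact/measurable_EFinP/measurable_funX.
move=> p _ /=; rewrite lee_fin !ger0_norm ?sqr_ge0 //.
by rewrite patchE; case: ifP => // _; rewrite expr0n sqr_ge0.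
Qed.

Lemma in_H1_ae (U : domain R) u g u' g' : in_H1 U u g -> in_L2 U u' -> (forall i, in_L2 U (g' i)) ->
  {ae mu, forall p, (U : set _) p -> u p = u' p} ->
  (forall i, {ae mu, forall p, (U : set _) p -> g i p = g' i p}) -> in_H1 U u' g'.
Proof.
move=> [hu hg hw] hu' hg' eu eg; have mU : measurable (U : set P) := dom_measurable U.
split => //; apply/weak_gradientE => i phi tphi.
rewrite -(dot_ae mU hu hu' (test_pderiv_L2 i tphi) eu).
rewrite -(dot_ae mU (hg i) (hg' i) (test_L2 tphi) (eg i)).
by move/weak_gradientE: hw; apply.
Qed.

(** The weak formulation on [A] reads [0 = - \int g phi]. *)
Lemma gradient_vanishes (U A : set (R * R)) u g i : open U -> bounded_set U -> open A ->
  A `<=` U -> in_H1 U u g -> ae_zero A u -> ae_zero A (g i).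
Proof.
move=> oU bU oA AU ug zu; have [hu hg hw] := H1_restrict oU oA AU ug.
have mA : measurable (A : set P) by exact: open_measurable_plane.
have fA : (mu A < +oo)%E.
  apply: bounded_finite_measure => //; have [M _ hM] := bounded_rect bU.
  by apply: (@rect_bounded _ _ M) => p /AU/hM.
have [ig _] := L2_ext mA fA (hg i).
have := @fundamental_lemma R A (ext (g i) A) oA ig.
move=> h; suff : {ae mu, forall p, A p -> ext (g i) A p = 0}.
  by move=> k; apply: (negligibleS _ k) => p /= nS hp; apply: nS => Ap;
     rewrite -(hp Ap) patchE mem_set.
apply: h => n a b c d abcd.
rewrite -(Rintegral_ext A (g i)).
have tphi := test_function_bump n n abcd.
have := hw i _ tphi; move/(congr1 (fun z => - z)); rewrite opprK => <-.
suff -> : \int[mu]_(p in A) (u p * pderiv i (tensor (bump n a b) (bump n c d)) p) = 0.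
  by rewrite oppr0.
have z : in_L2 A (fun=> 0 : R) by exact: L2_cst.
have tL : in_L2 A (pderiv i (tensor (bump n a b) (bump n c d))).
  have cphi := test_pderiv_continuous (i := i) tphi.
  have [K K0 hK] := compact_bound tphi cphi (@test_pderiv_off R _ i).
  have m : measurable_fun (A : set P) (pderiv i (tensor (bump n a b) (bump n c d))).
    by apply: measurable_funTS; exact: continuous_measurable_plane.
  exact: (L2_bounded mA fA m hK).
have e := dot_ae mA hu z tL zu; rewrite /dot in e; rewrite e.
rewrite -[RHS](mul0r (fine (mu A))) -(Rintegral_cst mu mA).
by apply: eq_Rintegral => p _; rewrite mul0r.
Qed.

End Truncation.

Section CompactSupport.
Variable R : realType.
Local Notation P := (measurableTypeR R * measurableTypeR R)%type.
Local Notation mu := (leb2 R).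
Local Notation ext u U := (u \_ U).
Local Notation B := (disc (@ltr01 R)).
Let mB : measurable (disc_set 1 : set P) := shape_measurable (disc_shape 1).

Definition core (r : R) : set (R * R) := [set q | q.1 ^+ 2 + q.2 ^+ 2 <= r].

Lemma measurable_core r : measurable (core r : set P).
Proof.
rewrite -[core r]setCK; apply: measurableC; apply: open_measurable_plane.
rewrite (_ : ~` _ = [set q : R * R | r < q.1 ^+ 2 + q.2 ^+ 2]).
  exact: (open_comp (fun p _ => @continuous_sqnorm R p) (@open_gt R r)).
by apply/seteqP; split => q /=; rewrite /core /= ltNge => /negP.
Qed.

(** An exact zero outside the core controls also the values that a dilation takes
    from outside the disc, about which the class modulo null sets says nothing. *)
Lemma exact_support (r la : R) (x : H1 B) : eigvec (@energy R B) (@mass R B) la x ->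
  {ae mu, forall q, disc_set 1 q -> r < q.1 ^+ 2 + q.2 ^+ 2 -> fn x q = 0} ->
  exists y : H1 B, [/\ eigvec (@energy R B) (@mass R B) la y, mass y y = mass x x,
    forall q, ~ core r q -> fn y q = 0 & forall i q, ~ core r q -> grad y i q = 0].
Proof.
move=> ex zx; have [oB bB cB] := disc_shape (1 : R).
pose A := disc_set 1 `&` [set q : R * R | r < q.1 ^+ 2 + q.2 ^+ 2].
have oA : open A.
  apply: openI => //.
  exact: (open_comp (fun p _ => @continuous_sqnorm R p) (@open_gt R r)).
have AB : A `<=` disc_set 1 by move=> p [].
have zA : ae_zero A (fn x).
  by apply: (negligibleS _ zx) => p /= nS hp; apply: nS => -[Bp rp]; exact: hp.
have zg i : ae_zero A (grad x i) by exact: gradient_vanishes oB bB oA AB (H1_in x) zA.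
have eq_core (w : R * R -> R) : ae_zero A w ->
    {ae mu, forall p, disc_set 1 p -> w p = ext w (core r) p}.
  move=> h; apply: (negligibleS _ h) => p /= nS hp; apply: nS => Bp.
  have [cp|nc] := pselect (core r p); first by rewrite patchE mem_set.
  rewrite patchE memNset // hp //; split => //.
  by move: nc; rewrite /core /= => /negP; rewrite -ltNge.
have L2c w : in_L2 (disc_set 1) w -> in_L2 (disc_set 1) (ext w (core r)).
  exact: (L2_patch mB (measurable_core r)).
have hy : in_H1 B (ext (fn x) (core r)) (fun i => ext (grad x i) (core r)).
  apply: (in_H1_ae (H1_in x)) => [|i||i].
  - exact: L2c (fn_L2 x).
  - exact: L2c (grad_L2 x i).
  - exact: eq_core.
  - exact: eq_core.
have [y [yu yg]] := H1_of hy; exists y.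
have ym z : mass y z = mass x z.
  rewrite /mass yu; apply/esym/(dot_ae mB (fn_L2 x) _ (fn_L2 z)); first exact: L2c (fn_L2 x).
  exact: eq_core.
have ye z : energy y z = energy x z.
  by rewrite /energy yg; congr (_ + _); apply/esym/(dot_ae mB (grad_L2 x _) _ (grad_L2 z _));
     [exact: L2c (grad_L2 x _)|exact: eq_core|exact: L2c (grad_L2 x _)|exact: eq_core].
split => [z||q nq|i q nq].
- by rewrite ye ym.
- by rewrite ym (form_sym (mass_psd B)) ym.
- by rewrite yu patchE memNset.
- by rewrite yg patchE memNset.
Qed.

(** Short segments that meet the core stay in the disc: the other segments then
    avoid the core altogether. *)
Lemma core_margin (r e t : R) i q : core r q -> 0 < r -> `|t| <= e -> e < (1 - r) / 3 ->
  disc_set 1 (translate (basis_vec R i) t q).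
Proof.
rewrite /core /disc_set /translate /= => cq r0 te er.
have [t1 t2] : - e <= t /\ t <= e by move: te; rewrite ler_norml => /andP[].
have aux (x y : R) : x ^+ 2 + y ^+ 2 <= r -> (x + t) ^+ 2 + y ^+ 2 < 1.
  move=> h; have x1 : `|x| <= 1.
    rewrite leNgt; apply/negP => x1; have : 1 < `|x| ^+ 2 by nra.
    by rewrite real_normK ?num_real //; move: (sqr_ge0 y); lra.
  have xt : x * t <= e.
    apply: le_trans (ler_norm _) _; rewrite normrM -[leRHS]mul1r.
    exact: ler_pM.
  have tt : t ^+ 2 <= e.
    rewrite -(real_normK (num_real t)); have := normr_ge0 t.
    by move: `|t| te => z ze z0; nra.
  by nra.
case: q cq => x y /= cq; have [->|i1] := eqVneq i 0.
  by rewrite /= mulr1 mulr0 addr0; exact: aux.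
have -> : i = 1 by apply: val_inj; case: i i1 => -[|[|]].
by rewrite /= mulr1 mulr0 addr0 addrC; apply: aux; rewrite addrC.
Qed.

Lemma zero_extension (r : R) (x : H1 B) : 0 < r -> r < 1 ->
  (forall q, ~ core r q -> fn x q = 0) -> (forall i q, ~ core r q -> grad x i q = 0) ->
  in_H1 (disc_set 4) (fn x) (grad x).
Proof.
move=> r0 r1 xu xg; have [oB bB cB] := disc_shape (1 : R).
have [oV bV cV] := disc_shape (4 : R).
have mV := shape_measurable (disc_shape (4 : R)).
have BV : disc_set 1 `<=` disc_set (4 : R).
  by move=> p; rewrite /disc_set /=; move: (_ + _) => z; lra.
have cB1 : core r `<=` disc_set 1.
  by move=> p; rewrite /core /disc_set /=; move: (_ + _) => z; lra.
have L2V w : in_L2 (disc_set 1) w -> (forall q, ~ core r q -> w q = 0) -> in_L2 (disc_set 4) w.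
  move=> [mw iw] zw; have e : w = ext w (disc_set 1).
    apply/funext => q; rewrite patchE; case: ifPn => //.
    by rewrite notin_setE => nB; apply: zw => /cB1.
  split; first by rewrite e; apply: measurable_funTS; exact/(measurable_restrictT _ mB).
  have /(integrable_mkcond _ mB) h := iw.
  have := integrableS measurableT mV (@subsetT _ _) h.
  apply: eq_integrable => // p _; rewrite /= !patchE; case: ifPn => //.
  by rewrite notin_setE => nB; rewrite zw ?expr0n // => /cB1.
have hu : in_L2 (disc_set 4) (fn x) by apply: L2V xu; exact: fn_L2 x.
have hg i : in_L2 (disc_set 4) (grad x i) by apply: L2V (xg i); exact: grad_L2 x i.
split => //; have key := weak_gradient_of_segments oV bV hu hg; apply: key.
move=> i; exists ((1 - r) / 3); first by rewrite divr_gt0 // subr_gt0.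
move=> e e0 er; set h := e *: basis_vec R i.
have hs := segment_identity h oB bB cB (H1_in x).
apply: (negligibleS _ hs) => p /= nS hp; apply: nS => Vp Vp1.
have [Bp|nB] := pselect (disc_set 1 p /\ disc_set 1 (translate h 1 p)).
  rewrite (hp Bp.1 Bp.2); apply: eq_Rintegral => t.
  rewrite inE /unit_itv /= in_itv /= => /andP[t0 t1].
  have Bt := segment_closed_translate cB Bp.1 Bp.2 t0 t1.
  by rewrite /directional !patchE !mem_set //; exact: BV.
have off t : 0 <= t -> t <= 1 -> ~ core r (translate h t p).
  move=> t0 t1 ct; apply: nB.
  have back d : translate (basis_vec R i) d (translate h t p) =
      translate (basis_vec R i) (d + t * e) p.
    by rewrite /h translate_scale /translate /=; congr pair; ring.
  split.
    have := @core_margin r e (- (t * e)) i _ ct r0 _ er; rewrite back.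
    rewrite addNr normrN normrM !ger0_norm ?(ltW e0) // => /(_ _).
    rewrite (_ : translate _ 0 p = p); last by case: (p) => a b; rewrite /translate !mul0r !addr0.
    by apply; rewrite ler_piMl // ltW.
  have := @core_margin r e ((1 - t) * e) i _ ct r0 _ er; rewrite back.
  rewrite (_ : (1 - t) * e + t * e = 1 * e); last by ring.
  rewrite -translate_scale; apply; rewrite normrM !ger0_norm ?subr_ge0 ?(ltW e0) //.
  by apply: ler_piMl; [exact: ltW|rewrite gerBl].
have tr0 : translate h 0 p = p by case: (p) => a b; rewrite /translate !mul0r !addr0.
rewrite xu; last exact: off.
rewrite xu; last by rewrite -tr0; exact: off.
rewrite subrr; apply/esym; rewrite /segment_mean.
rewrite -[RHS](mul0r (fine (@lebesgue_measure R (@unit_itv R)))) -(Rintegral_cst _ (@measurable_unit R)).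
apply: eq_Rintegral => t; rewrite inE /unit_itv /= in_itv /= => /andP[t0 t1].
rewrite /directional !patchE; case: ifP => _; last by rewrite !mulr0 addr0.
by rewrite !xg ?mulr0 ?addr0 //; exact: off.
Qed.

(** The substitution [p = s q]; as [k] is supported in the disc, no boundary
    term appears although the dilation moves the disc. *)
Lemma dot_dilate (r s : R) k w : r < 1 -> 0 < s -> s <= 1 ->
  in_L2 (disc_set 1) k -> (forall q, ~ core r q -> k q = 0) -> in_L2 (disc_set 1) w ->
  dot (disc_set 1) (k \o similarity s^-1 0) w =
  s ^+ 2 * dot (disc_set 1) k (w \o similarity s 0).
Proof.
move=> r1 s0 s1 hk zk hw.
have fB : (mu (disc_set 1) < +oo)%E by have := dom_finite B.
have sn : s != 0 by rewrite gt_eqF.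
have si : s^-1 != 0 by rewrite invr_eq0.
have Bs q : disc_set 1 q -> disc_set 1 (similarity s 0 q).
  rewrite /disc_set /similarity /= !mul0r subr0 add0r !exprMn -mulrDr => h.
  apply: le_lt_trans h; rewrite ler_piMl ?addr_ge0 ?sqr_ge0 //.
  by rewrite expr_le1 // ltW.
have hws : in_L2 (disc_set 1) (w \o similarity s 0).
  exact: (L2_similarity sn mB mB fB Bs hw).
pose F q := ext (fun q => k q * (w \o similarity s 0) q) (disc_set 1) q.
have iF : mu.-integrable setT (EFin \o (F : P -> R)).
  have /(integrable_mkcond _ mB) := L2_mul mB hk hws.
  by apply: eq_integrable => // p _; rewrite /F /= !patchE; case: ifP.
have sc := scales_area_similarity 0 si.
have c0 : 0 < (s^-1 ^+ 2 + 0 ^+ 2 : R)^-1.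
  by rewrite expr0n addr0 invr_gt0 exprn_gt0 // invr_gt0.
have := integral_scales sc c0 iF.
rewrite [X in X^-1 * _](_ : _ = (s ^+ 2)^-1); last by rewrite expr0n addr0 exprVn.
rewrite invrK => e.
have -> : dot (disc_set 1) k (w \o similarity s 0) = \int[mu]_p F p.
  by rewrite /dot Rintegral_mkcond.
rewrite -e /dot Rintegral_mkcond; apply: eq_Rintegral => p _.
rewrite /F patchE -[(s^-1 * p.1 - _, _)]/(similarity s^-1 0 p) patchE /=.
have inv : similarity s 0 (similarity s^-1 0 p) = p.
  case: p => a b; rewrite /similarity /= !mul0r !subr0 !add0r.
  by rewrite !mulrA divff // !mul1r.
rewrite inv; have [ck|nk] := pselect (core r (similarity s^-1 0 p)).
  have Bq : disc_set 1 (similarity s^-1 0 p).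
    by move: ck; rewrite /core /disc_set /=; move: (_ + _) => z; lra.
  by rewrite !mem_set // -inv; exact: Bs.
by rewrite zk // !mul0r; do 2!case: ifP.
Qed.

Lemma dilate_eigvec (r la s : R) (x : H1 B) : 0 < r -> r < 1 -> 1 / 2 < s -> s <= 1 ->
  eigvec (@energy R B) (@mass R B) la x ->
  (forall q, ~ core r q -> fn x q = 0) -> (forall i q, ~ core r q -> grad x i q = 0) ->
  exists2 y : H1 B, eigvec (@energy R B) (@mass R B) (la / s ^+ 2) y &
    mass y y = s ^+ 2 * mass x x.
Proof.
move=> r0 r1 s2 s1 ex xu xg; have s0 : 0 < s by lra.
have sn : s != 0 by rewrite gt_eqF.
have si : s^-1 != 0 by rewrite invr_eq0.
have B4 p : disc_set 1 p -> disc_set 4 (similarity s^-1 0 p).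
  rewrite /disc_set /similarity /= !mul0r subr0 add0r !exprMn -mulrDr => h.
  have q0 : 0 <= p.1 ^+ 2 + p.2 ^+ 2 by rewrite addr_ge0 ?sqr_ge0.
  rewrite exprVn mulrC ltr_pdivrMr ?exprn_gt0 //.
  by move: (p.1 ^+ 2 + p.2 ^+ 2) q0 h => z z0 z1; nra.
have Bs q : disc_set 1 q -> disc_set 1 (similarity s 0 q).
  rewrite /disc_set /similarity /= !mul0r subr0 add0r !exprMn -mulrDr => h.
  apply: le_lt_trans h; rewrite ler_piMl ?addr_ge0 ?sqr_ge0 //.
  by rewrite expr_le1 // ltW.
have hV := zero_extension r0 r1 xu xg.
have [y [yu yg]] := @H1_of R B _ _ (H1_similarity si (disc_shape 4) (disc_shape 1) B4 hV).
have inv q : similarity s^-1 0 (similarity s 0 q) = q.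
  case: q => a b; rewrite /similarity /= !mul0r !subr0 !add0r.
  by rewrite !mulrA mulVf // !mul1r.
have massE (z : H1 B) : mass y z = s ^+ 2 * dot (disc_set 1) (fn x) (fn z \o similarity s 0).
  by rewrite /mass yu; exact: (dot_dilate r1 s0 s1 (fn_L2 x) xu (fn_L2 z)).
exists y; last first.
  rewrite massE; congr (_ * _); rewrite /mass; apply: eq_Rintegral => q _.
  by rewrite yu /= inv.
move=> z; have [w [wu wg]] := @H1_of R B _ _ (H1_similarity sn (disc_shape 1) (disc_shape 1) Bs (H1_in z)).
have fB : (mu (disc_set 1) < +oo)%E by have := dom_finite B.
have hzs i : in_L2 (disc_set 1) (grad z i \o similarity s 0).
  exact: (L2_similarity sn mB mB fB Bs (grad_L2 z i)).
have gE i : dot (disc_set 1) (grad y i) (grad z i) = dot (disc_set 1) (grad x i) (grad w i).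
  have -> : grad y i = fun p => s^-1 * (grad x i \o similarity s^-1 0) p.
    apply/funext => p; rewrite yg /pull_grad !mul0r oppr0 !mul0r addr0 add0r.
    have [->//|i1] := eqVneq i 0.
    by have -> : i = 1 by apply: val_inj; case: i i1 => -[|[|]].
  have -> : grad w i = fun p => s * (grad z i \o similarity s 0) p.
    apply/funext => p; rewrite wg /pull_grad !mul0r oppr0 !mul0r addr0 add0r.
    have [->//|i1] := eqVneq i 0.
    by have -> : i = 1 by apply: val_inj; case: i i1 => -[|[|]].
  have hxs : in_L2 (disc_set 1) (grad x i \o similarity s^-1 0).
    apply: (L2_similarity si (shape_measurable (disc_shape (4 : R))) mB _ B4).
      by have := dom_finite (disc (ltr0n R 4)).
    by have [_ h _] := hV; exact: h.
  rewrite (dotZl _ mB hxs (grad_L2 z i)) dotC [RHS]dotC (dotZl _ mB (hzs i) (grad_L2 x i)).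
  rewrite (dotC _ (grad z i)) (dotC _ (grad z i \o _)).
  rewrite (dot_dilate r1 s0 s1 (grad_L2 x i) (xg i) (grad_L2 z i)).
  by rewrite expr2 !mulrA mulVf // mul1r.
have -> : energy y z = energy x w by rewrite /energy; congr (_ + _); exact: gE.
by rewrite ex massE /mass wu; field.
Qed.

(** Its dilates would be eigenfunctions for a whole interval of eigenvalues,
    whereas only finitely many eigenvalues lie below [4 * la]. *)
Lemma no_compact_eigvec (r la : R) (x : H1 B) : 0 < r -> r < 1 -> 0 < la ->
  eigvec (@energy R B) (@mass R B) la x ->
  (forall q, ~ core r q -> fn x q = 0) -> (forall i q, ~ core r q -> grad x i q = 0) ->
  mass x x = 0.
Proof.
move=> r0 r1 la0 ex xu xg; apply: contrapT => xn.
have [e sp] := neumann_spectral_system B; set nu := neumann_eigenvalue B in sp.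
have [mono _ _ _ unb] := sp.
have occ s : 1 / 2 < s -> s <= 1 -> exists k, nu k = la / s ^+ 2.
  move=> s2 s1; have [y ey my] := dilate_eigvec r0 r1 s2 s1 ex xu xg.
  have [|t [_ ht]] := (multiplicity_occurs (energy_psd B) (mass_psd B) (la / s ^+ 2) 1 sp).1.
    exists (fun=> y) => // c; rewrite big_ord_recl big_ord0 addr0 => h i.
    move: h; rewrite (formZl (mass_psd B)) (formZr (mass_psd B)) my.
    have s0 : s != 0 by rewrite gt_eqF //; lra.
    move/eqP; rewrite !mulf_eq0 (negbTE s0) /=.
    have -> : (mass x x == 0) = false by apply/eqP.
    by rewrite !orbF orbb => /eqP; rewrite (ord1 i).
  by exists (t ord0).
have [K hK] := unb (4 * la).
pose s (j : 'I_K.+1) : R := 1 - j%:R / (2 * K.+1%:R).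
have d0 : 0 < 2 * K.+1%:R :> R by rewrite mulr_gt0.
have sj j : 1 / 2 < s j /\ s j <= 1.
  have h : (j%:R : R) < K.+1%:R by rewrite ltr_nat.
  have h0 : 0 <= (j%:R : R) / (2 * K.+1%:R) by rewrite divr_ge0 // ltW.
  have h1 : (j%:R : R) / (2 * K.+1%:R) < 1 / 2.
    rewrite ltr_pdivrMr //; move: h; move: (K.+1%:R) => z; lra.
  by move: h0 h1; rewrite /s; move: (j%:R / (2 * K.+1%:R)) => z h0 h1; split; lra.
have [k hk] : {k : 'I_K.+1 -> nat & forall j, nu (k j) = la / s j ^+ 2}.
  apply: (@choice _ _ (fun (j : 'I_K.+1) k => nu k = la / s j ^+ 2)) => j.
  by have [h1 h2] := sj j; exact: occ.
have kK j : (k j < K)%N.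
  rewrite ltnNge; apply/negP => /mono; rewrite hk leNgt => /negP; apply.
  apply: le_lt_trans hK; have [h1 h2] := sj j.
  rewrite ler_pdivrMr ?exprn_gt0 //; last by lra.
  move: (s j) h1 => z h1; have q : 1 <= 4 * z ^+ 2 by nra.
  by have := ler_wpM2l (ltW la0) q; lra.
have kinj : injective (fun j => Ordinal (kK j)).
  move=> i j /(congr1 val) /= kij.
  have E : la / s i ^+ 2 = la / s j ^+ 2 by rewrite -!hk kij.
  have [i1 i2] := sj i; have [j1 j2] := sj j.
  have h : s i ^+ 2 = s j ^+ 2.
    by apply: invr_inj; apply: (mulfI _ E); rewrite gt_eqF.
  have sij : s i = s j by move: (s i) (s j) h i1 j1 => a b h a1 b1; nra.
  apply: val_inj; apply/eqP; rewrite -(@eqr_nat R); apply/eqP.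
  have d1 : (2 * K.+1%:R : R) != 0 by rewrite gt_eqF.
  move: sij; rewrite /s => /(congr1 (fun z => (1 - z) * (2 * K.+1%:R))).
  have aux (z D : R) : D != 0 -> (1 - (1 - z / D)) * D = z by move=> D0; field.
  by rewrite !aux.
by have := leq_card _ kinj; rewrite !card_ord ltnn.
Qed.

(** Otherwise the eigenfunctions vanishing on the cap of height [1 - c] form a
    nonzero space for all [c] close to 1, whose bounded dimension becomes
    constant. The stable space is invariant under small rotations, so its
    elements vanish near the boundary, against [no_compact_eigvec]. *)
Theorem unique_continuation (la c0 : R) : 0 < la -> c0 < 1 ->
  exists c, [/\ c0 <= c, 0 < c, c < 1 & forall x : H1 B, vanishing la c x -> mass x x = 0].
Proof.
move=> la0 c01; apply: contrapT => hno.
pose d0 := Num.max c0 (1 / 2).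
have d01 : d0 < 1 by rewrite gt_max c01 /=; lra.
have nz c : d0 <= c -> c < 1 -> exists2 x : H1 B, vanishing la c x & mass x x <> 0.
  move=> dc c1; apply: contrapT => h; apply: hno.
  have [h1 h2] : c0 <= c /\ 1 / 2 <= c by move: dc; rewrite ge_max => /andP.
  exists c; split => //; first by apply: lt_le_trans h2; lra.
  by move=> x vx; apply: contrapT => mx; apply: h; exists x.
have mono c d (x : H1 B) : c <= d -> vanishing la c x -> vanishing la d x.
  move=> cd [ex zx]; split => //; apply: (negligibleS _ zx) => p /= nS hp; apply: nS.
  by move=> [Bp /= dp]; apply: hp; split => //=; exact: le_lt_trans dp.
have comb c n (z : 'I_n -> R) (x : 'I_n -> H1 B) : (forall i, vanishing la c (x i)) ->
    vanishing la c (\sum_(i < n) z i *: x i).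
  move=> hx; split.
    by apply: (eigvec_comb (energy_psd B) (mass_psd B)) => i; have [] := hx i.
  have h : {ae mu, forall p, forall i, cap c p -> fn (x i) p = 0}.
    have := @ae_foralln _ _ _ mu (fun (k : nat) p => forall i : 'I_n, nat_of_ord i = k -> cap c p -> fn (x i) p = 0).
    move=> /(_ _) hh; apply: (negligibleS _ (hh _)); last first.
      move=> k; have [kn|nk] := ltnP k n; last first.
        by apply: aeW => p i ik; have := ltn_ord i; rewrite ik ltnNge nk.
      have [_ h] := hx (Ordinal kn); apply: (negligibleS _ h) => p /= nS hp; apply: nS.
      by move=> i ik cp; rewrite (_ : i = Ordinal kn); [exact: hp|exact: val_inj].
    by move=> p /= nS hp; apply: nS => i; exact: (hp i i erefl).
  apply: (negligibleS _ h) => p /= nS hp; apply: nS => cp.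
  by rewrite fn_comb big1 // => i _; rewrite hp ?mulr0.
have null c d (x y : H1 B) : vanishing la c x -> vanishing la d y ->
    mass (y - x) (y - x) = 0 -> vanishing la c y.
  move=> [ex zx] [ey zy] /mass_eq0 h; split => //.
  apply: (negligibleS _ (negligibleU h zx)) => p /= nS.
  apply: contrapT => hn; apply: nS => cp.
  have {hn}[h1 h2] : (disc_set 1 p -> fn (y - x) p = 0) /\ (cap c p -> fn x p = 0).
    by split; apply: contrapT => h'; apply: hn; [left|right].
  have [Bp _] := cp; move: (h1 Bp); rewrite fn_sub (h2 cp) subr0; exact.
have [N hN] := friedrichs_finite (mass_psd B) (H1_friedrichs B) la.
have bdim c n (x : 'I_n -> H1 B) : (forall i, vanishing la c (x i)) ->
    indep (@mass R B) x -> (n <= N)%N.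
  move=> hx ix; apply: (hN n x ix) => z /=.
  have [ez _] := comb c n z x hx.
  by rewrite ez.
have [c1 [dc1 c11 stable]] := bounded_dim_stabilises (mass_psd B) mono comb null d01 bdim.
have c10 : 0 < c1.
  by apply: lt_le_trans dc1; rewrite lt_max; apply/orP; right; lra.
have [r /andP[r0 r1] ann] := vanishing_annulus c10 c11 stable.
have [x vx mx] := nz c1 dc1 c11.
have [y [ey my yu yg]] := exact_support vx.1 (ann x vx).
by apply: mx; rewrite -my; exact: no_compact_eigvec r0 r1 la0 ey yu yg.
Qed.

End CompactSupport.

(** * Cutting off a small cap *)
Section CutDisc.
Variable R : realType.
Local Notation P := (measurableTypeR R * measurableTypeR R)%type.
Local Notation mu := (leb2 R).
Local Notation B := (disc (@ltr01 R)).

Lemma mean_comb (U : domain R) (S : set (R * R)) n (c : 'I_n -> R) (x : 'I_n -> H1 U) :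
  measurable (S : set P) -> S `<=` U ->
  \int[mu]_(p in S) fn (\sum_(i < n) c i *: x i) p = \sum_(i < n) c i * \int[mu]_(p in S) fn (x i) p.
Proof.
move=> mS SU; have mU : measurable (U : set P) := dom_measurable U.
apply: (@lin_comb R (H1 U) (fun x => \int[mu]_(p in S) fn x p)) => a y z.
have SL w : in_L2 S (@fn R U w) by exact: L2_restrict mU mS SU (fn_L2 w).
have Sfin : (mu S < +oo)%E.
  by apply: le_lt_trans (dom_finite U); apply: le_measure => //; rewrite inE.
by rewrite -!dot_cst1 fn_lin (dot_lin mS a (SL y) (SL z) (L2_cst mS Sfin 1)).
Qed.

Lemma mass_comb (U : domain R) (nu : nat -> R) (e : nat -> H1 U) n (s : 'I_n -> nat) (c : 'I_n -> R) :
  spectral_system (@energy R U) (@mass R U) nu e -> injective s ->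
  let v := \sum_(i < n) c i *: e (s i) in
  mass v v = \sum_(i < n) c i ^+ 2 /\ energy v v = \sum_(i < n) nu (s i) * c i ^+ 2.
Proof.
move=> [_ on ev _ _] sinj v.
have mv i : mass (e (s i)) v = c i.
  rewrite /v (form_sumr (mass_psd U)) (bigD1 i) //= big1 => [|j ji].
    by rewrite (formZr (mass_psd U)) on eqxx mulr1 addr0.
  by rewrite (formZr (mass_psd U)) on (inj_eq sinj) eq_sym (negbTE ji) mulr0.
split.
  by rewrite {1}/v (form_comb (mass_psd U)); apply: eq_bigr => i _; rewrite mv expr2.
rewrite {1}/v (form_comb (energy_psd U)); apply: eq_bigr => i _.
by rewrite (ev (s i)) mv expr2; ring.
Qed.

Lemma eigenvalue_ge0 (U : domain R) nu (e : nat -> H1 U) k :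
  spectral_system (@energy R U) (@mass R U) nu e -> 0 <= nu k.
Proof.
move=> [_ on ev _ _]; have := form_ge0 (energy_psd U) (e k).
by rewrite ev on eqxx mulr1.
Qed.

Lemma disc_width p q : disc_set (1 : R) p -> disc_set 1 q ->
  `|p.1 - q.1| <= 2 /\ `|p.2 - q.2| <= 2.
Proof.
rewrite /disc_set /=; move: p.1 p.2 q.1 q.2 => x y x' y' h h'.
have aux (a b a' b' : R) : a ^+ 2 + b ^+ 2 < 1 -> a' ^+ 2 + b' ^+ 2 < 1 -> `|a - a'| <= 2.
  move=> l l'; have : (a - a') ^+ 2 <= 2 ^+ 2.
    by have := sqr_ge0 (a + a'); have := sqr_ge0 b; have := sqr_ge0 b'; nra.
  by rewrite -[X in X <= _](real_normK (num_real _)) ler_pXn2r ?nnegrE.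
by split; [exact: aux h h'|apply: (aux _ x _ x'); rewrite addrC].
Qed.

(** By the Poincare inequality only the constants have zero energy. *)
Lemma eigenvalue_gt0 nu (e : nat -> H1 B) k :
  spectral_system (@energy R B) (@mass R B) nu e -> 0 < nu k.+1.
Proof.
move=> sp; have [mono _ _ _ _] := sp.
rewrite lt_def (eigenvalue_ge0 _ sp) andbT; apply/eqP => nu0.
have nuk0 : nu k = 0.
  by apply/eqP; rewrite eq_le (eigenvalue_ge0 _ sp) andbT -nu0; exact: mono.
pose s (i : 'I_2) := (k + i)%N.
have sinj : injective s by move=> i j /addnI/val_inj.
have [c [i ci] hc] := @nontrivial_kernel R 2 1
  (fun i _ => \int[mu]_(p in disc_set 1) fn (e (s i)) p) isT.
pose v := \sum_(i < 2) c i *: e (s i).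
have [mv ev] := mass_comb c sp sinj; rewrite -/v in mv ev.
have e0 : energy v v = 0.
  rewrite ev big1 // => j _; suff -> : nu (s j) = 0 by rewrite mul0r.
  by case: j => -[|[|//]] hj; rewrite /s /= ?addn0 ?addn1.
have mB : measurable (disc_set 1 : set P) := shape_measurable (disc_shape (1 : R)).
have i0 : \int[mu]_(p in disc_set 1) fn v p = 0.
  by rewrite mean_comb //; exact: (hc ord0).
have [oB bB cB] := disc_shape (1 : R).
have hd p q : disc_set (1 : R) p -> disc_set 1 q -> `|p.1 - q.1| <= 2 /\ `|p.2 - q.2| <= 2.
  exact: disc_width.
have := poincare oB bB cB (H1_in v) hd.
rewrite i0 -/(dot _ _ _) -/(energy v v) e0 mulr0 addr0 expr0n /= -/(mass v v).
have m0 : 0 < fine (mu (disc_set 1)).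
  rewrite lt_def fine_ge0 // andbT; apply/eqP => z.
  have mz : mu (disc_set 1) = 0%E.
    by rewrite -[LHS]fineK ?z // ge0_fin_numE //; exact: dom_finite B.
  have nB : {ae mu, forall p, disc_set (1 : R) p -> False}.
    by exists (disc_set 1); split => // p /= h; apply: contrapT.
  by have [p _ []] := open_not_negligible oB (dom_nonempty B) nB.
rewrite pmulr_rle0 // mv leNgt => /negP; apply.
rewrite (bigD1 i) //= ltr_wpDr ?sumr_ge0 // => [j _|]; first exact: sqr_ge0.
by rewrite lt_def sqrf_eq0 ci sqr_ge0.
Qed.

Lemma cap_width (c : R) p q : 0 < c -> c < 1 -> cap c p -> cap c q ->
  `|p.1 - q.1| <= Num.sqrt (4 * (1 - c ^+ 2)) /\ `|p.2 - q.2| <= Num.sqrt (4 * (1 - c ^+ 2)).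
Proof.
move=> c0 c1; rewrite /cap /above /disc_set /crd /=.
move: p.1 p.2 q.1 q.2 => x y x' y' [h cx] [h' cx'].
have aux (z w : R) : z ^+ 2 <= w -> `|z| <= Num.sqrt w by rewrite -sqrtr_sqr; exact: ler_wsqrtr.
split; apply: aux; last by have := sqr_ge0 (y + y'); nra.
have x1 : x < 1 by have := sqr_ge0 y; nra.
have x1' : x' < 1 by have := sqr_ge0 y'; nra.
have h1 : (x - x') ^+ 2 <= (1 - c) ^+ 2 by nra.
by apply: le_trans h1 _; nra.
Qed.

(** The cap has width at most [2 * sqrt (1 - c ^+ 2)] in both directions. *)
Lemma cap_poincare (c : R) (x : H1 B) : 0 < c -> c < 1 ->
  \int[mu]_(p in cap c) fn x p = 0 ->
  dot (cap c) (fn x) (fn x) <= 16 * (1 - c ^+ 2) * dirichlet (cap c) (grad x).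
Proof.
move=> c0 c1 i0; have sC : shape (cap c) := above_shape true c (disc_shape 1).
have [oC bC cC] := sC; have mC := shape_measurable sC.
have [oB bB cB] := disc_shape (1 : R).
have xC : in_H1 (cap c) (fn x) (grad x) by apply: H1_restrict oB oC _ (H1_in x) => p [].
have [hu hg _] := xC.
have D0 : 0 <= dirichlet (cap c) (grad x) by apply: addr_ge0; exact: dot_ge0.
have q0 : 0 <= 4 * (1 - c ^+ 2) by nra.
have := poincare oC bC cC xC (fun p q => @cap_width c p q c0 c1).
rewrite i0 expr0n /= add0r sqr_sqrtr // -/(dirichlet (cap c) (grad x)).
have m0 : 0 <= fine (mu (cap c)) by exact: fine_ge0.
have [m1|m1] := ltrP 0 (fine (mu (cap c))).
  move: (dirichlet _ _) (dot _ _ _) (fine _) m1 => D q m m1 h.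
  by rewrite -(ler_pM2l m1); move: h; congr (_ <= _); ring.
have mz : mu (cap c) = 0%E.
  have z : fine (mu (cap c)) = 0 by apply/eqP; rewrite eq_le m0 m1.
  by rewrite -[LHS]fineK ?z // ge0_fin_numE //; exact: bounded_finite_measure.
move=> _; have -> : dot (cap c) (fn x) (fn x) = 0.
  rewrite /dot /Rintegral null_set_integral //.
  by have [mu_ _] := hu; apply/measurable_EFinP/measurable_funM.
by apply: mulr_ge0 => //; nra.
Qed.

Lemma cut_disc_nonempty (c : R) : 0 < c -> below true c (disc_set 1) !=set0.
Proof. by exists (0, 0); split => //; rewrite /disc_set /= expr0n addr0. Qed.

Definition cut_disc (c : R) (c0 : 0 < c) : domain R :=
  let sO := below_shape true c (disc_shape (1 : R)) in
  Domain (cut_disc_nonempty c0) (let: And3 oV _ _ := sO in oV)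
    (let: And3 _ bV _ := sO in bV) (let: And3 _ _ cV := sO in cV).

(** If the eigenvalue did not decrease, the test function [v] below would turn all
    estimates into equalities: it would be an eigenfunction of the disc vanishing
    on the cap, against the choice of [c] by [unique_continuation]. *)
Theorem cut_decreases k (c0 : R) : c0 < 1 ->
  neumann_eigenvalue (disc_set (1 : R)) k = neumann_eigenvalue (disc_set (1 : R)) k.+1 ->
  exists c, [/\ c0 <= c, 0 < c, c < 1 &
    neumann_eigenvalue (below true c (disc_set 1)) k < neumann_eigenvalue (disc_set 1) k].
Proof.
move=> c01 dbl; have [e sp] := neumann_spectral_system B.
rewrite [dom_set B]/= in sp; set nu := neumann_eigenvalue (disc_set 1) in sp dbl *.
have la0 : 0 < nu k by rewrite dbl; exact: (eigenvalue_gt0 k sp).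
pose d0 := Num.max c0 (1 - (64 * nu k)^-1).
have d01 : d0 < 1.
  by rewrite gt_max c01 /= gtrBl invr_gt0 mulr_gt0.
have [c [d0c c_gt0 c_lt1 uc]] := unique_continuation la0 d01.
have [c0c cnu] : c0 <= c /\ 1 - (64 * nu k)^-1 <= c by move: d0c; rewrite ge_max => /andP.
exists c; split => //; rewrite ltNge; apply/negP => nu_le.
pose Om := cut_disc c_gt0.
have [e' sp'] := neumann_spectral_system Om.
rewrite [dom_set Om]/= in sp'; set nu' := neumann_eigenvalue (below true c (disc_set 1)) in sp' nu_le.
have sB := disc_shape (1 : R); have [oB bB cB] := sB.
have sO := below_shape true c sB; have sC := above_shape true c sB.
have [oO bO cO] := sO; have mC := shape_measurable sC; have mO := shape_measurable sO.
have OB : below true c (disc_set 1) `<=` disc_set 1 by move=> p [].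
have CB : cap c `<=` disc_set 1 by move=> p [].
(* one condition for the mean over the cap, [k] for the min-max principle *)
have [a [i0 ai0] ha] := @nontrivial_kernel R k.+2 k.+1 (fun i (j : 'I_k.+1) =>
  if unlift ord0 j is Some j' then dot (below true c (disc_set 1)) (fn (e' j')) (fn (e i))
  else \int[mu]_(p in cap c) fn (e i) p) (ltnSn _).
pose v := \sum_(i < k.+2) a i *: e i.
have [mv ev] := @mass_comb B nu e k.+2 (@nat_of_ord _) a sp (@ord_inj _); rewrite -/v in mv ev.
have vC : \int[mu]_(p in cap c) fn v p = 0.
  by rewrite mean_comb //; have := ha ord0; rewrite unlift_none.
have [w [wu wg]] := @H1_of R Om _ _ (H1_restrict oB oO OB (H1_in v)).
have worth i : (i < k)%N -> mass (e' i) w = 0.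
  move=> ik; have := ha (lift ord0 (Ordinal ik)); rewrite liftK /mass wu.
  pose l (x : H1 B) := dot (below true c (disc_set 1)) (fn (e' i)) (fn x).
  have ll b x y : l (b *: x + y) = b * l x + l y.
    rewrite /l !(dotC _ (fn (e' i))) fn_lin.
    have L z := L2_restrict (dom_measurable B) mO OB (@fn_L2 R B z).
    exact: (dot_lin mO b (L x) (L y) (fn_L2 (e' i))).
  by have := lin_comb ll a (fun i : 'I_k.+2 => e i); rewrite -/v /l => ->.
have [mono _ ei _ _] := sp; have [_ _ _ vmin _] := sp'.
have min := vmin k w worth.
have massB : mass v v = mass w w + dot (cap c) (fn v) (fn v).
  by rewrite /mass wu; exact: (dot_cut true c sB (fn_L2 v) (fn_L2 v)).
have energyB : energy v v = energy w w + dirichlet (cap c) (grad v).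
  rewrite /energy /dirichlet wg (dot_cut true c sB (grad_L2 v 0) (grad_L2 v 0)).
  by rewrite (dot_cut true c sB (grad_L2 v 1) (grad_L2 v 1)) addrACA.
have capP := cap_poincare c_gt0 c_lt1 vC.
have D0 : 0 <= dirichlet (cap c) (grad v) by apply: addr_ge0; exact: dot_ge0.
have mC0 : 0 <= dot (cap c) (fn v) (fn v) by exact: dot_ge0.
have mw0 : 0 <= mass w w by exact: (form_ge0 (mass_psd Om)).
(* the Poincare constant of the cap; the choice of [d0] makes it small *)
have small : nu k * (16 * (1 - c ^+ 2)) <= 1 / 2.
  have : nu k * (1 - c) <= 1 / 64.
    have : 1 - c <= (64 * nu k)^-1 by lra.
    by rewrite -(ler_pM2l la0) invfM mulrCA divff ?gt_eqF // mulr1 div1r.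
  by move: (nu k) la0 => z z0; nra.
have nui (i : 'I_k.+2) : nu i <= nu k by rewrite dbl; apply: mono; exact: leq_ord.
have upper : energy v v <= nu k * mass v v.
  rewrite ev mv mulr_sumr; apply: ler_sum => i _.
  by apply: ler_wpM2r (nui i); exact: sqr_ge0.
have lower : nu k * mass w w <= energy w w.
  by apply: le_trans min; exact: ler_wpM2r.
have half : nu k * dot (cap c) (fn v) (fn v) <= 1 / 2 * dirichlet (cap c) (grad v).
  apply: (@le_trans _ _ (nu k * (16 * (1 - c ^+ 2)) * dirichlet (cap c) (grad v))).
    by rewrite -mulrA; apply: ler_wpM2l => //; exact: ltW.
  exact: ler_wpM2r.
have dC : dirichlet (cap c) (grad v) = 0.
  by apply/eqP; rewrite eq_le D0 andbT; move: upper; rewrite massB energyB; lra.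
have mC00 : dot (cap c) (fn v) (fn v) = 0.
  apply/eqP; rewrite eq_le mC0 andbT; move: half; rewrite dC mulr0.
  by rewrite pmulr_rle0.
have eqe : energy v v = nu k * mass v v.
  by apply/eqP; rewrite eq_le upper /= massB energyB mC00 dC !addr0.
have top (i : 'I_k.+2) : nu i * a i = nu k * a i.
  have : \sum_(i < k.+2) (nu k - nu i) * a i ^+ 2 = 0.
    under eq_bigr do rewrite mulrBl.
    by rewrite sumrB -ev -mulr_sumr -mv eqe subrr.
  have pos (j : 'I_k.+2) : true -> 0 <= (nu k - nu j) * a j ^+ 2.
    by move=> _; rewrite mulr_ge0 ?subr_ge0 ?sqr_ge0.
  move/eqP; rewrite psumr_eq0 // => /allP/(_ i (mem_index_enum _)) /=.
  rewrite mulf_eq0 sqrf_eq0 => /orP[|/eqP->]; last by rewrite !mulr0.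
  by rewrite subr_eq0 => /eqP->.
have vE : eigvec (@energy R B) (@mass R B) (nu k) v.
  move=> y; rewrite /v (form_comb (energy_psd B)) (form_comb (mass_psd B)) mulr_sumr.
  by apply: eq_bigr => i _; rewrite ei mulrA [a i * _]mulrC top -mulrA.
have vz : ae_zero (cap c) (fn v).
  by apply/(dot_eq0 mC); first exact: L2_restrict (dom_measurable B) mC CB (fn_L2 v).
have := uc v (conj vE vz); rewrite mv => /eqP.
rewrite psumr_eq0 => [/allP/(_ i0 (mem_index_enum _))|j _]; last exact: sqr_ge0.
by rewrite /= sqrf_eq0 (negbTE ai0).
Qed.

End CutDisc.

(** * Diameters and Hausdorff distances *)
Section Metric.
Variable R : realType.

Lemma eucl_dist_ge0 (p q : R * R) : 0 <= eucl_dist p q. Proof. exact: sqrtr_ge0. Qed.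

Lemma dist_to_set_le (A : set (R * R)) p q : A q -> dist_to_set A p <= eucl_dist p q.
Proof.
move=> Aq; apply: ge_inf; last by exists q.
by exists 0 => _ [r _ <-]; exact: eucl_dist_ge0.
Qed.

Lemma hausdorff_dist_le (A C : set (R * R)) (d : R) : A !=set0 -> C !=set0 ->
  (forall p, A p -> exists2 q, C q & eucl_dist p q <= d) ->
  (forall q, C q -> exists2 p, A p & eucl_dist q p <= d) ->
  hausdorff_dist A C <= d.
Proof.
move=> [p0 Ap0] [q0 Cq0] hAC hCA; rewrite /hausdorff_dist ge_max; apply/andP; split.
  apply: ge_sup; first by exists (dist_to_set C p0); exists p0.
  by move=> _ [p /hAC[q Cq pq] <-]; exact: le_trans (dist_to_set_le p Cq) pq.
apply: ge_sup; first by exists (dist_to_set A q0); exists q0.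
by move=> _ [q /hCA[p Ap qp] <-]; exact: le_trans (dist_to_set_le q Ap) qp.
Qed.

Lemma eucl_dist_disc (p q : R * R) : unit_disk p -> unit_disk q -> eucl_dist p q <= 2.
Proof.
rewrite /unit_disk /= /eucl_dist; move: p.1 p.2 q.1 q.2 => x y x' y' h h'.
rewrite -(@ler_pXn2r _ 2) ?nnegrE ?sqrtr_ge0 // sqr_sqrtr ?addr_ge0 ?sqr_ge0 //.
by have := sqr_ge0 (x + x'); have := sqr_ge0 (y + y'); nra.
Qed.

Lemma diameter_disc_ge : 2 <= diameter (@unit_disk R).
Proof.
apply/ler_addgt0Pr => e e0; pose t := Num.max 0 (1 - e / 2).
have t0 : 0 <= t by rewrite le_max lexx.
have t1 : t < 1 by rewrite gt_max ltr01 /= gtrBl divr_gt0.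
have te : 1 - e / 2 <= t by rewrite le_max lexx orbT.
have Bt s : s ^+ 2 = t ^+ 2 -> unit_disk (s, 0 : R).
  by move=> st; rewrite /unit_disk /= st expr0n addr0; nra.
apply: (@le_trans _ _ (2 * t + e)); first by lra.
rewrite lerD2r; apply: ub_le_sup.
  by exists 2 => _ [p [q [Bp Bq ->]]]; exact: eucl_dist_disc.
exists (t, 0), (- t, 0); split; [exact: Bt|by apply: Bt; rewrite sqrrN|].
rewrite /eucl_dist /= subrr expr0n addr0 sqrtr_sqr opprK ger0_norm ?addr_ge0 //; ring.
Qed.

Lemma diameter_subdisc (A : set (R * R)) : A !=set0 -> A `<=` unit_disk -> 0 <= diameter A <= 2.
Proof.
move=> [p0 Ap0] AB; have ub : ubound [set d | exists p q, [/\ A p, A q & d = eucl_dist p q]] 2.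
  by move=> _ [p [q [Ap Aq ->]]]; apply: eucl_dist_disc; exact: AB.
have h0 : [set d | exists p q, [/\ A p, A q & d = eucl_dist p q]] (eucl_dist p0 p0).
  by exists p0, p0.
apply/andP; split; last by apply: ge_sup => //; exists (eucl_dist p0 p0).
by apply: le_trans (eucl_dist_ge0 p0 p0) _; apply: ub_le_sup h0; exists 2.
Qed.

Lemma closure_disc (p : R * R) : closure unit_disk p -> p.1 ^+ 2 + p.2 ^+ 2 <= 1.
Proof.
have cl : closed [set q : R * R | q.1 ^+ 2 + q.2 ^+ 2 <= 1].
  exact: (closed_comp (fun p _ => @continuous_sqnorm R p) (@closed_le R 1)).
move=> cp; apply: cl; apply: closureS cp => q; rewrite /unit_disk /=; exact: ltW.
Qed.

(** The contraction by [c ^+ 2] maps the closed disc into the cut disc; the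
    factor [c] would only give points of the closure. *)
Lemma hausdorff_cut_disc (c : R) : 0 < c -> c < 1 ->
  hausdorff_dist (closure (below true c (disc_set 1))) (closure unit_disk) <= 1 - c ^+ 2.
Proof.
move=> c0 c1; have c2 : 0 < c ^+ 2 by rewrite exprn_gt0.
have OB : below true c (disc_set 1) `<=` unit_disk by move=> p [].
have [p0 Op0] := cut_disc_nonempty c0.
have d0 : 0 <= 1 - c ^+ 2 by nra.
apply: hausdorff_dist_le.
- by exists p0; exact: subset_closure.
- by exists p0; apply: subset_closure; exact: OB.
- move=> p Op; exists p; first exact: closureS OB _ Op.
  by rewrite /eucl_dist !subrr expr0n addr0 sqrtr0.
move=> q /closure_disc q1; exists (c ^+ 2 * q.1, c ^+ 2 * q.2).
  apply: subset_closure; split.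
    rewrite /disc_set /= !exprMn -mulrDr.
    have c4 : (c ^+ 2) ^+ 2 < 1 by rewrite expr_lt1 // ?expr_lt1 // ltW.
    apply: le_lt_trans c4; rewrite ler_piMr ?sqr_ge0 //.
  rewrite /= /crd /=; have q1' : q.1 <= 1 by have := sqr_ge0 q.2; nra.
  by nra.
rewrite /eucl_dist /= (_ : (q.1 - c ^+ 2 * q.1) ^+ 2 + (q.2 - c ^+ 2 * q.2) ^+ 2 =
  (1 - c ^+ 2) ^+ 2 * (q.1 ^+ 2 + q.2 ^+ 2)); last by ring.
rewrite -(@ler_pXn2r _ 2) ?nnegrE ?sqrtr_ge0 //.
rewrite sqr_sqrtr; last by rewrite mulr_ge0 ?addr_ge0 ?sqr_ge0.
by rewrite ler_piMr ?sqr_ge0.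
Qed.

End Metric.

Theorem theorem3p1 (R : realType) (k : nat) (k_ge1 : (1 <= k)%N)
    (double : neumann_eigenvalue unit_disk k.-1 =
              neumann_eigenvalue unit_disk k :> R) :
  ~ local_minimizer convex_domain
      (fun Omega : set (R * R) =>
         diameter Omega ^+ 2 * neumann_eigenvalue Omega k.-1)
      unit_disk.
Proof.
case: k k_ge1 double => // k _ /= dbl [delta d0 hmin].
have [|c [c0c c0 c1 drop]] := @cut_decreases R k (1 - delta / 2) _ dbl.
  by rewrite gtrBl divr_gt0.
set Om := below true c (disc_set 1) in drop.
have OB : Om `<=` unit_disk by move=> p [].
have COm : convex_domain Om.
  have [oO bO cO] := below_shape true c (disc_shape (1 : R)).
  by split => //; [exact: cut_disc_nonempty|exact/convex_setP].
have close : hausdorff_dist (closure Om) (closure unit_disk) < delta.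
  apply: le_lt_trans (hausdorff_cut_disc c0 c1) _; nra.
have := hmin Om COm close; rewrite leNgt => /negP; apply.
have /andP[D0 D2] := diameter_subdisc (cut_disc_nonempty c0) OB.
have DB := diameter_disc_ge R.
have [e sp] := neumann_spectral_system (cut_disc c0).
have nu0 : 0 <= neumann_eigenvalue Om k := eigenvalue_ge0 k sp.
apply: (@le_lt_trans _ _ (4 * neumann_eigenvalue Om k)).
  by apply: ler_wpM2r => //; move: (diameter Om) D0 D2 => z z0 z2; nra.
apply: (@lt_le_trans _ _ (4 * neumann_eigenvalue (@unit_disk R) k)).
  by rewrite ltr_pM2l.
apply: ler_wpM2r; last by move: (diameter _) DB => z z2; nra.
exact: le_trans nu0 (ltW drop).
Qed.
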